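(* For any dg ring $A$, the sequence $$\mathbf K_{\mathrm{ac}}(A\text{-Mod}_{\mathrm{proj}})\longrightarrow\mathbf K(A\text{-Mod}_{\mathrm{proj}})\longrightarrow\mathbf D(A)$$ given by the inclusion and the canonical functor is a recollement of triangulated categories.
   Context: Fix a grading group, i.e. an abelian group $\Gamma$ with a parity homomorphism $|\cdot|:\Gamma\to\mathbb Z/2\mathbb Z$ and a distinguished element $1\in\Gamma$ with $|1|=\bar 1$. Dg rings and dg modules are $\Gamma$-graded, with differential of degree $1$. For a dg ring $A$, $A\text{-Mod}_{\mathrm{proj}}$ is the class of dg $A$-modules whose underlying graded module over the underlying graded ring $A^\sharp$ is projective. $\mathbf K(A\text{-Mod}_{\mathrm{proj}})$ is the full triangulated subcategory on $A\text{-Mod}_{\mathrm{proj}}$ of the homotopy category of dg $A$-modules (morphisms are homotopy classes of dg module morphisms), $\mathbf K_{\mathrm{ac}}(A\text{-Mod}_{\mathrm{proj}})$ is its full subcategory of acyclic objects, and $\mathbf D(A)$ is the derived category of dg $A$-modules (localization at quasi-isomorphisms). A sequence of exact functors of triangulated categories $\mathcal T'\xrightarrow{F}\mathcal T\xrightarrow{G}\mathcal T''$ is a recollement if $F$ is fully faithful and has both a left and a right adjoint, $G$ has both a left and a right adjoint, each of which is fully faithful, and the essential image of $F$ equals the kernel of $G$. *)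

(* Defs.v *)
From HB Require Import structures.
From mathcomp Require Import all_boot all_algebra.

Set Implicit Arguments.
Unset Strict Implicit.
Unset Printing Implicit Defensive.

Import GRing.Theory.
Local Open Scope ring_scope.
Local Obligation Tactic := idtac.

Declare Scope cat_scope.
Delimit Scope cat_scope with cat.
Reserved Notation "f ≡ g" (at level 70, no associativity).
Reserved Notation "g ∘ f" (at level 40, left associativity).

(** * Categories

    Hom-sets are setoids: a set of morphisms that is a quotient (such as a set
    of homotopy classes) is given by its representatives and an equivalence
    relation, which plays the role of equality of morphisms. *)

Record category := Category {
  ob :> Type;
  hom : ob -> ob -> Type;
  eqh : forall X Y, hom X Y -> hom X Y -> Prop;
  idm : forall X, hom X X;
  comp : forall X Y Z, hom Y Z -> hom X Y -> hom X Z;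
  eqh_refl : forall X Y (f : hom X Y), eqh f f;
  eqh_sym : forall X Y (f g : hom X Y), eqh f g -> eqh g f;
  eqh_trans : forall X Y (f g h : hom X Y), eqh f g -> eqh g h -> eqh f h;
  comp_eqh : forall X Y Z (g g' : hom Y Z) (f f' : hom X Y),
    eqh g g' -> eqh f f' -> eqh (comp g f) (comp g' f');
  comp_idl : forall X Y (f : hom X Y), eqh (comp (idm Y) f) f;
  comp_idr : forall X Y (f : hom X Y), eqh (comp f (idm X)) f;
  comp_assoc : forall X Y Z T (h : hom Z T) (g : hom Y Z) (f : hom X Y),
    eqh (comp h (comp g f)) (comp (comp h g) f)
}.
Arguments hom {c} X Y.
Arguments eqh {c X Y} f g.
Arguments idm {c} X.
Arguments comp {c X Y Z} g f.
Arguments eqh_refl {c X Y} f.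
Notation "f ≡ g" := (eqh f g) : cat_scope.
Notation "g ∘ f" := (comp g f) : cat_scope.
Local Open Scope cat_scope.

Definition is_iso (C : category) (X Y : C) (f : hom X Y) : Prop :=
  exists g : hom Y X, g ∘ f ≡ idm X /\ f ∘ g ≡ idm Y.

Definition isomorphic (C : category) (X Y : C) : Prop :=
  exists f : hom X Y, is_iso f.

Definition is_initial (C : category) (Z : C) : Prop :=
  forall X : C, exists f : hom Z X, forall g : hom Z X, g ≡ f.

Definition is_terminal (C : category) (Z : C) : Prop :=
  forall X : C, exists f : hom X Z, forall g : hom X Z, g ≡ f.

Definition is_zero (C : category) (Z : C) : Prop :=
  is_initial Z /\ is_terminal Z.

Record functor (C D : category) := Functor {
  fob :> C -> D;
  fmap : forall X Y : C, hom X Y -> hom (fob X) (fob Y);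
  fmap_eqh : forall (X Y : C) (f g : hom X Y), f ≡ g -> fmap f ≡ fmap g;
  fmap_id : forall X : C, fmap (idm X) ≡ idm (fob X);
  fmap_comp : forall (X Y Z : C) (g : hom Y Z) (f : hom X Y),
    fmap (g ∘ f) ≡ fmap g ∘ fmap f
}.
Arguments fmap {C D} F {X Y} f : rename.

Program Definition functor_id (C : category) : functor C C :=
  @Functor C C (fun X => X) (fun X Y f => f) _ _ _.
Next Obligation. by []. Qed.
Next Obligation. by move=> C X; exact: eqh_refl. Qed.
Next Obligation. by move=> C X Y Z g f; exact: eqh_refl. Qed.

Program Definition functor_comp (C D E : category)
    (G : functor D E) (F : functor C D) : functor C E :=
  @Functor C E (fun X => G (F X)) (fun X Y f => fmap G (fmap F f)) _ _ _.
Next Obligation. by move=> C D E G F X Y f g fg; do 2!apply: fmap_eqh. Qed.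
Next Obligation.
move=> C D E G F X; apply: eqh_trans (fmap_id G (F X)).
by apply: fmap_eqh; apply: fmap_id.
Qed.
Next Obligation.
move=> C D E G F X Y Z g f; apply: eqh_trans (fmap_comp G _ _).
by apply: fmap_eqh; apply: fmap_comp.
Qed.

Record nat_trans (C D : category) (F G : functor C D) := NatTrans {
  nt_map :> forall X : C, hom (F X) (G X);
  nt_nat : forall (X Y : C) (f : hom X Y),
    nt_map Y ∘ fmap F f ≡ fmap G f ∘ nt_map X
}.

Definition is_nat_iso (C D : category) (F G : functor C D)
    (phi : nat_trans F G) : Prop :=
  forall X : C, is_iso (phi X).

Definition is_equivalence (C D : category) (F : functor C D) : Prop :=
  exists G : functor D C,
    (exists phi : nat_trans (functor_comp G F) (functor_id C), is_nat_iso phi)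
 /\ (exists psi : nat_trans (functor_comp F G) (functor_id D), is_nat_iso psi).

Definition fully_faithful (C D : category) (F : functor C D) : Prop :=
  forall X Y : C,
    (forall f g : hom X Y, fmap F f ≡ fmap F g -> f ≡ g)
 /\ (forall h : hom (F X) (F Y), exists f : hom X Y, fmap F f ≡ h).

Definition adjoint (C D : category) (L : functor C D) (R : functor D C)
    : Prop :=
  exists (eta : nat_trans (functor_id C) (functor_comp R L))
         (eps : nat_trans (functor_comp L R) (functor_id D)),
    (forall X : C, eps (L X) ∘ fmap L (eta X) ≡ idm (L X))
 /\ (forall Y : D, fmap R (eps Y) ∘ eta (R Y) ≡ idm (R Y)).

Definition has_left_adjoint (C D : category) (F : functor C D) : Prop :=
  exists L : functor D C, adjoint L F.

Definition has_right_adjoint (C D : category) (F : functor C D) : Prop :=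
  exists R : functor D C, adjoint F R.

(** ** Full subcategories *)

Program Definition full_sub (C : category) (P : C -> Prop) : category :=
  @Category {X : C | P X} (fun X Y => hom (sval X) (sval Y))
    (fun X Y f g => f ≡ g) (fun X => idm (sval X))
    (fun X Y Z g f => g ∘ f) _ _ _ _ _ _ _.
Next Obligation. by move=> C P X Y f; exact: eqh_refl. Qed.
Next Obligation. by move=> C P X Y f g; exact: eqh_sym. Qed.
Next Obligation. by move=> C P X Y f g h; exact: eqh_trans. Qed.
Next Obligation. by move=> C P X Y Z g g' f f'; exact: comp_eqh. Qed.
Next Obligation. by move=> C P X Y f; exact: comp_idl. Qed.
Next Obligation. by move=> C P X Y f; exact: comp_idr. Qed.
Next Obligation. by move=> C P X Y Z T h g f; exact: comp_assoc. Qed.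

Program Definition full_incl (C : category) (P : C -> Prop)
    : functor (full_sub P) C :=
  @Functor (full_sub P) C (fun X => sval X) (fun X Y f => f) _ _ _.
Next Obligation. by []. Qed.
Next Obligation. by move=> C P X; exact: eqh_refl. Qed.
Next Obligation. by move=> C P X Y Z g f; exact: eqh_refl. Qed.

(** ** Localization of a category at a class of morphisms

    The Gabriel-Zisman construction: a morphism [X -> Y] of the localization is a path
    of morphisms of [C] and of formal inverses of morphisms of [W], read from
    [X] to [Y], modulo the congruence generated by the relations of [C] and by
    [s s^-1 = 1] and [s^-1 s = 1] for [s] in [W]. *)

Section Localization.
Variables (C : category) (W : forall X Y : C, hom X Y -> Prop).

Inductive zpath : C -> C -> Type :=
| pnil X : zpath X X
| pfwd X Y Z : hom X Y -> zpath Y Z -> zpath X Z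
| pbwd X Y Z (s : hom Y X) : W s -> zpath Y Z -> zpath X Z.

Inductive zpath_eq : forall X Y : C, zpath X Y -> zpath X Y -> Prop :=
| peq_refl X Y (p : zpath X Y) : zpath_eq p p
| peq_sym X Y (p q : zpath X Y) : zpath_eq p q -> zpath_eq q p
| peq_trans X Y (p q r : zpath X Y) :
    zpath_eq p q -> zpath_eq q r -> zpath_eq p r
| peq_fwd X Y Z (f g : hom X Y) (p q : zpath Y Z) :
    f ≡ g -> zpath_eq p q -> zpath_eq (pfwd f p) (pfwd g q)
| peq_bwd X Y Z (s : hom Y X) (Ws : W s) (p q : zpath Y Z) :
    zpath_eq p q -> zpath_eq (pbwd Ws p) (pbwd Ws q)
| peq_id X Y (p : zpath X Y) : zpath_eq (pfwd (idm X) p) p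
| peq_comp X Y Z T (f : hom X Y) (g : hom Y Z) (p : zpath Z T) :
    zpath_eq (pfwd (g ∘ f) p) (pfwd f (pfwd g p))
| peq_fwdbwd X Y Z (s : hom X Y) (Ws : W s) (p : zpath X Z) :
    zpath_eq (pfwd s (pbwd Ws p)) p
| peq_bwdfwd X Y Z (s : hom Y X) (Ws : W s) (p : zpath X Z) :
    zpath_eq (pbwd Ws (pfwd s p)) p.

Fixpoint zcat X Y Z (p : zpath X Y) : zpath Y Z -> zpath X Z :=
  match p in zpath X Y return zpath Y Z -> zpath X Z with
  | pnil _ => fun q => q
  | pfwd _ _ _ f p' => fun q => pfwd f (zcat p' q)
  | pbwd _ _ _ _ Ws p' => fun q => pbwd Ws (zcat p' q)
  end.

Lemma zcat_nil X Y (p : zpath X Y) : zcat p (pnil Y) = p.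
Proof. by elim: p => //= [X' Y' Z f p -> | X' Y' Z s Ws p ->]. Qed.

Lemma zcatA X Y Z T (p : zpath X Y) (q : zpath Y Z) (r : zpath Z T) :
  zcat (zcat p q) r = zcat p (zcat q r).
Proof. by elim: p q => //= [X' Y' Z' f p IH | X' Y' Z' s Ws p IH] q; rewrite IH. Qed.

Lemma zcat_eq X Y Z (p p' : zpath X Y) (q q' : zpath Y Z) :
  zpath_eq p p' -> zpath_eq q q' -> zpath_eq (zcat p q) (zcat p' q').
Proof.
move=> pp qq; apply: (@peq_trans _ _ _ (zcat p q')).
  elim: p q q' qq {p' pp} => //= [X' Y' Z' f p IH|X' Y' Z' s Ws p IH] q q' qq.
    by apply: peq_fwd (eqh_refl f) (IH _ _ qq).
  exact: peq_bwd (IH _ _ qq).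
elim: pp q' {q qq} => {X Y p p'} /=.
- by move=> *; apply: peq_refl.
- by move=> X Y p p' _ IH q; apply: peq_sym.
- by move=> X Y p p' r _ IH1 _ IH2 q; apply: peq_trans (IH1 q) (IH2 q).
- by move=> X Y T f g p p' fg _ IH q; apply: peq_fwd.
- by move=> X Y T s Ws p p' _ IH q; apply: peq_bwd.
- by move=> *; apply: peq_id.
- by move=> *; apply: peq_comp.
- by move=> *; apply: peq_fwdbwd.
- by move=> *; apply: peq_bwdfwd.
Qed.

Program Definition localization : category :=
  @Category C zpath zpath_eq pnil (fun X Y Z q p => zcat p q) _ _ _ _ _ _ _.
Next Obligation. by move=> *; apply: peq_refl. Qed.
Next Obligation. by move=> *; apply: peq_sym. Qed.
Next Obligation. by move=> X Y p q r; apply: peq_trans. Qed.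
Next Obligation. by move=> *; apply: zcat_eq. Qed.
Next Obligation. by move=> X Y p; rewrite /= zcat_nil; apply: peq_refl. Qed.
Next Obligation. by move=> *; apply: peq_refl. Qed.
Next Obligation. by move=> *; rewrite /= zcatA; apply: peq_refl. Qed.

Program Definition loc_functor : functor C localization :=
  @Functor C localization (fun X => X) (fun X Y f => pfwd f (pnil Y)) _ _ _.
Next Obligation. by move=> X Y f g fg; apply: peq_fwd (peq_refl _). Qed.
Next Obligation. by move=> X; apply: peq_id. Qed.
Next Obligation. by move=> *; apply: peq_comp. Qed.

Section LocEndofunctor.
Variables (F : functor C C)
          (WF : forall (X Y : C) (s : hom X Y), W s -> W (fmap F s)).

Fixpoint zmap X Y (p : zpath X Y) : zpath (F X) (F Y) :=
  match p in zpath X Y return zpath (F X) (F Y) with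
  | pnil X => pnil (F X)
  | pfwd _ _ _ f p' => pfwd (fmap F f) (zmap p')
  | pbwd _ _ _ _ Ws p' => pbwd (WF Ws) (zmap p')
  end.

Lemma zmap_eq X Y (p q : zpath X Y) : zpath_eq p q -> zpath_eq (zmap p) (zmap q).
Proof.
elim=> {X Y p q} /=.
- by move=> *; apply: peq_refl.
- by move=> *; apply: peq_sym.
- by move=> X Y p q r _ IH1 _ IH2; apply: peq_trans IH1 IH2.
- by move=> X Y Z f g p q fg _ IH; apply: peq_fwd => //; apply: fmap_eqh.
- by move=> *; apply: peq_bwd.
- move=> X Y p; apply: peq_trans (peq_id _).
  by apply: peq_fwd (peq_refl _); apply: fmap_id.
- move=> X Y Z T f g p; apply: peq_trans (peq_comp _ _ _).
  by apply: peq_fwd (peq_refl _); apply: fmap_comp.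
- by move=> *; apply: peq_fwdbwd.
- by move=> *; apply: peq_bwdfwd.
Qed.

Lemma zmap_cat X Y Z (p : zpath X Y) (q : zpath Y Z) :
  zmap (zcat p q) = zcat (zmap p) (zmap q).
Proof.
by elim: p q => //= [X' Y' Z' f p IH | X' Y' Z' s Ws p IH] q; rewrite IH.
Qed.

Program Definition loc_endofunctor : functor localization localization :=
  @Functor localization localization F zmap _ _ _.
Next Obligation. exact: zmap_eq. Qed.
Next Obligation. by move=> X; apply: peq_refl. Qed.
Next Obligation. by move=> X Y Z q p; rewrite zmap_cat; apply: peq_refl. Qed.

End LocEndofunctor.
End Localization.

(** * Triangulated categories

    [triData] is the underlying data of a triangulated category: a shift
    functor and a class of distinguished triangles [X -> Y -> Z -> X[1] ].  The
    preadditive structure is kept apart because on an additive category it is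
    unique; [triangulated] below takes it as a parameter. *)

Record preadditive (C : category) := Preadditive {
  hadd : forall X Y : C, hom X Y -> hom X Y -> hom X Y;
  hzero : forall X Y : C, hom X Y;
  hopp : forall X Y : C, hom X Y -> hom X Y;
  hadd_eqh : forall (X Y : C) (f f' g g' : hom X Y),
    f ≡ f' -> g ≡ g' -> hadd f g ≡ hadd f' g';
  hopp_eqh : forall (X Y : C) (f f' : hom X Y), f ≡ f' -> hopp f ≡ hopp f';
  haddA : forall (X Y : C) (f g h : hom X Y),
    hadd f (hadd g h) ≡ hadd (hadd f g) h;
  haddC : forall (X Y : C) (f g : hom X Y), hadd f g ≡ hadd g f;
  hadd0 : forall (X Y : C) (f : hom X Y), hadd (hzero X Y) f ≡ f;
  haddN : forall (X Y : C) (f : hom X Y), hadd (hopp f) f ≡ hzero X Y;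
  comp_haddl : forall (X Y Z : C) (g g' : hom Y Z) (f : hom X Y),
    hadd g g' ∘ f ≡ hadd (g ∘ f) (g' ∘ f);
  comp_haddr : forall (X Y Z : C) (g : hom Y Z) (f f' : hom X Y),
    g ∘ hadd f f' ≡ hadd (g ∘ f) (g ∘ f')
}.

Definition additive_functor (C D : category) (P : preadditive C)
    (Q : preadditive D) (F : functor C D) : Prop :=
  forall (X Y : C) (f g : hom X Y),
    fmap F (hadd P f g) ≡ hadd Q (fmap F f) (fmap F g).

Definition is_biproduct (C : category) (P : preadditive C) (X Y S : C) : Prop :=
  exists (i : hom X S) (j : hom Y S) (p : hom S X) (q : hom S Y),
    [/\ p ∘ i ≡ idm X, q ∘ j ≡ idm Y, p ∘ j ≡ hzero P Y X, q ∘ i ≡ hzero P X Y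
      & hadd P (i ∘ p) (j ∘ q) ≡ idm S].

Definition additive_category (C : category) (P : preadditive C) : Prop :=
  (exists Z : C, is_zero Z) /\
  (forall X Y : C, exists S : C, is_biproduct P X Y S).

Record triData := TriData {
  tri_cat :> category;
  shift : functor tri_cat tri_cat;
  distinguished : forall X Y Z : tri_cat,
    hom X Y -> hom Y Z -> hom Z (shift X) -> Prop
}.
Arguments distinguished {t X Y Z} f g h.
Arguments shift {t}.

Definition tri_iso (C : category) (S : functor C C)
    (X Y Z : C) (f : hom X Y) (g : hom Y Z) (h : hom Z (S X))
    (X' Y' Z' : C) (f' : hom X' Y') (g' : hom Y' Z') (h' : hom Z' (S X'))
    : Prop :=
  exists (a : hom X X') (b : hom Y Y') (c : hom Z Z'),
    [/\ is_iso a, is_iso b & is_iso c]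
 /\ [/\ b ∘ f ≡ f' ∘ a, c ∘ g ≡ g' ∘ b & fmap S a ∘ h ≡ h' ∘ c].

(** The last field is the octahedral axiom. *)
Record triangulated (T : triData) (P : preadditive T) : Prop := Triangulated {
  tri_additive : additive_category P;
  tri_shift_additive : additive_functor P P (@shift T);
  tri_shift_equiv : is_equivalence (@shift T);
  tri_dist_iso : forall (X Y Z X' Y' Z' : T)
      (f : hom X Y) (g : hom Y Z) (h : hom Z (shift X))
      (f' : hom X' Y') (g' : hom Y' Z') (h' : hom Z' (shift X')),
    tri_iso f g h f' g' h' -> distinguished f g h -> distinguished f' g' h';
  tri_dist_id : forall X Z : T, is_zero Z ->
    distinguished (idm X) (hzero P X Z) (hzero P Z (shift X));
  tri_dist_cone : forall (X Y : T) (f : hom X Y),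
    exists (Z : T) (g : hom Y Z) (h : hom Z (shift X)), distinguished f g h;
  tri_dist_rot : forall (X Y Z : T)
      (f : hom X Y) (g : hom Y Z) (h : hom Z (shift X)),
    distinguished f g h <-> distinguished g h (hopp P (fmap shift f));
  tri_dist_map : forall (X Y Z X' Y' Z' : T)
      (f : hom X Y) (g : hom Y Z) (h : hom Z (shift X))
      (f' : hom X' Y') (g' : hom Y' Z') (h' : hom Z' (shift X'))
      (a : hom X X') (b : hom Y Y'),
    distinguished f g h -> distinguished f' g' h' -> b ∘ f ≡ f' ∘ a ->
    exists c : hom Z Z', c ∘ g ≡ g' ∘ b /\ fmap shift a ∘ h ≡ h' ∘ c;
  tri_dist_octa : forall (X Y Z X' Y' Z' : T) (f : hom X Y) (g : hom Y Z)
      (i : hom Y Z') (j : hom Z' (shift X))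
      (k : hom Z Y') (l : hom Y' (shift X))
      (m : hom Z X') (n : hom X' (shift Y)),
    distinguished f i j -> distinguished (g ∘ f) k l -> distinguished g m n ->
    exists (u : hom Z' Y') (v : hom Y' X'),
      distinguished u v (fmap shift i ∘ n)
   /\ [/\ u ∘ i ≡ k ∘ g, l ∘ u ≡ j, v ∘ k ≡ m & n ∘ v ≡ fmap shift f ∘ l]
}.

Definition exact_functor (T U : triData) (P : preadditive T)
    (Q : preadditive U) (F : functor T U) : Prop :=
  additive_functor P Q F /\
  exists phi : nat_trans (functor_comp F shift) (functor_comp shift F),
    is_nat_iso phi /\
    forall (X Y Z : T) (f : hom X Y) (g : hom Y Z) (h : hom Z (shift X)),
      distinguished f g h ->
      distinguished (fmap F f) (fmap F g) (phi X ∘ fmap F h).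

Definition recollement (T' T T'' : triData)
    (F : functor T' T) (G : functor T T'') : Prop :=
  (exists (P' : preadditive T') (P : preadditive T) (P'' : preadditive T''),
     [/\ triangulated P', triangulated P & triangulated P'']
  /\ (exact_functor P' P F /\ exact_functor P P'' G))
  /\ [/\ fully_faithful F, has_left_adjoint F & has_right_adjoint F]
  /\ (exists L : functor T'' T, adjoint L G /\ fully_faithful L)
  /\ (exists R : functor T'' T, adjoint G R /\ fully_faithful R)
  /\ (forall X : T, (exists Y : T', isomorphic (F Y) X) <-> is_zero (G X)).

Section FullSubTri.
Variables (T : triData) (P : T -> Prop).
Hypothesis shiftP : forall X : T, P X -> P (shift X).

Program Definition full_sub_shift : functor (full_sub P) (full_sub P) :=
  @Functor (full_sub P) (full_sub P)
    (fun X => exist P (shift (sval X)) (shiftP (svalP X)))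
    (fun X Y f => fmap shift f) _ _ _.
Next Obligation. by move=> X Y f g; exact: (@fmap_eqh _ _ (@shift T) (sval X) (sval Y)). Qed.
Next Obligation. by move=> X; exact: (fmap_id (@shift T)). Qed.
Next Obligation. by move=> X Y Z g f; exact: (fmap_comp (@shift T)). Qed.

Definition full_sub_tri : triData :=
  @TriData (full_sub P) full_sub_shift
    (fun X Y Z f g h => @distinguished T (sval X) (sval Y) (sval Z) f g h).

End FullSubTri.

Section LocTri.
Variables (T : triData) (W : forall X Y : T, hom X Y -> Prop).
Hypothesis shiftW : forall (X Y : T) (s : hom X Y), W s -> W (fmap shift s).

Definition localization_tri : triData :=
  @TriData (localization W) (loc_endofunctor shiftW)
    (fun X Y Z f g h => exists (X0 Y0 Z0 : T)
       (f0 : hom X0 Y0) (g0 : hom Y0 Z0) (h0 : hom Z0 (shift X0)),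
       distinguished f0 g0 h0 /\
       @tri_iso (localization W) (loc_endofunctor shiftW)
         X0 Y0 Z0 (fmap (loc_functor W) f0) (fmap (loc_functor W) g0)
         (fmap (loc_functor W) h0) X Y Z f g h).

End LocTri.

(** * Graded rings and modules

    Structure maps that involve sums of degrees take the target degree as an
    argument together with a proof of the degree equation, so that no transport
    along equalities of degrees appears in the axioms.  (Such proofs are unique,
    since a [zmodType] has decidable equality.) *)

Record gradingGroup := GradingGroup {
  gg_group :> zmodType;
  parity : {additive gg_group -> 'Z_2};
  gg1 : gg_group;
  parity_gg1 : parity gg1 = 1
}.
Arguments parity {g}.
Arguments gg1 {g}.

(** The sign [(-1)^s]. *)
Definition koszul (s : 'Z_2) (V : zmodType) (x : V) : V :=
  if s == 0 then x else - x.

Section Graded.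
Variable G : gradingGroup.

Record grRing := GrRing {
  gr_deg :> G -> zmodType;
  gmul : forall i j k : G, i + j = k -> gr_deg i -> gr_deg j -> gr_deg k;
  gone : gr_deg 0;
  gmulDl : forall i j k (e : i + j = k) (y : gr_deg j),
    {morph (fun x => gmul e x y) : x x' / x + x'};
  gmulDr : forall i j k (e : i + j = k) (x : gr_deg i),
    {morph gmul e x : y y' / y + y'};
  gmulA : forall i j l ij jl m (e1 : i + j = ij) (e2 : ij + l = m)
      (e3 : j + l = jl) (e4 : i + jl = m) x y z,
    gmul e2 (gmul e1 x y) z = gmul e4 x (gmul e3 y z);
  gmul1l : forall i (e : 0 + i = i) x, gmul e gone x = x;
  gmul1r : forall i (e : i + 0 = i) x, gmul e x gone = x
}.

(** Graded left modules. *)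
Record grMod (A : grRing) := GrMod {
  gm_deg :> G -> zmodType;
  gact : forall i j k : G, i + j = k -> A i -> gm_deg j -> gm_deg k;
  gactDl : forall i j k (e : i + j = k) (x : gm_deg j),
    {morph (fun a => gact e a x) : a a' / a + a'};
  gactDr : forall i j k (e : i + j = k) (a : A i),
    {morph gact e a : x x' / x + x'};
  gactA : forall i j l ij jl m (e1 : i + j = ij) (e2 : ij + l = m)
      (e3 : j + l = jl) (e4 : i + jl = m) (a : A i) (b : A j) x,
    gact e2 (gmul e1 a b) x = gact e4 a (gact e3 b x);
  gact1 : forall i (e : 0 + i = i) x, gact e (gone A) x = x
}.

(** Homogeneous morphisms of degree zero. *)
Record grHom (A : grRing) (M N : grMod A) := GrHom {
  gh :> forall i, M i -> N i;
  ghD : forall i, {morph @gh i : x y / x + y};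
  gh_act : forall i j k (e : i + j = k) (a : A i) (x : M j),
    gh (gact e a x) = gact e a (gh x)
}.

Arguments gh {A M N} g i x : rename.

Definition gr_projective (A : grRing) (M : grMod A) : Prop :=
  forall (N L : grMod A) (p : grHom N L) (f : grHom M L),
    (forall i (y : L i), exists x : N i, p i x = y) ->
    exists g : grHom M N, forall i (x : M i), p i (g i x) = f i x.

Record dgRing := DgRing {
  dgr_gr :> grRing;
  dgr_d : forall i j : G, i + gg1 = j -> dgr_gr i -> dgr_gr j;
  dgr_dD : forall i j (e : i + gg1 = j), {morph dgr_d e : x y / x + y};
  dgr_dd : forall i j k (e : i + gg1 = j) (e' : j + gg1 = k) x,
    dgr_d e' (dgr_d e x) = 0;
  dgr_leibniz : forall i j k i' j' k' (e : i + j = k)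
      (ei : i + gg1 = i') (ej : j + gg1 = j') (ek : k + gg1 = k')
      (el : i' + j = k') (er : i + j' = k') x y,
    dgr_d ek (gmul e x y) =
      gmul el (dgr_d ei x) y + koszul (parity i) (gmul er x (dgr_d ej y))
}.

(** Left dg modules. *)
Record dgMod (A : dgRing) := DgMod {
  dgm_gr :> grMod A;
  dgm_d : forall i j : G, i + gg1 = j -> dgm_gr i -> dgm_gr j;
  dgm_dD : forall i j (e : i + gg1 = j), {morph dgm_d e : x y / x + y};
  dgm_dd : forall i j k (e : i + gg1 = j) (e' : j + gg1 = k) x,
    dgm_d e' (dgm_d e x) = 0;
  dgm_leibniz : forall i j k i' j' k' (e : i + j = k)
      (ei : i + gg1 = i') (ej : j + gg1 = j') (ek : k + gg1 = k')
      (el : i' + j = k') (er : i + j' = k') (a : A i) x,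
    dgm_d ek (gact e a x) =
      gact el (dgr_d ei a) x + koszul (parity i) (gact er a (dgm_d ej x))
}.

Record dgHom (A : dgRing) (M N : dgMod A) := DgHom {
  dgh_gr :> grHom M N;
  dgh_d : forall i j (e : i + gg1 = j) (x : M i),
    dgh_gr j (dgm_d e x) = dgm_d e (dgh_gr i x)
}.

(** A homotopy [h] is an [A]-linear map of degree [-1] (linear in the graded
    sense, hence the sign) with [f - g = d h + h d]. *)
Definition homotopic (A : dgRing) (M N : dgMod A) (f g : dgHom M N) : Prop :=
  exists h : forall i j : G, j + gg1 = i -> M i -> N j,
    [/\ forall i j (e : j + gg1 = i), {morph h i j e : x y / x + y},
        forall i j k j' k' (e : i + j = k) (ej : j' + gg1 = j)
            (ek : k' + gg1 = k) (e' : i + j' = k') (a : A i) (x : M j),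
          h k k' ek (gact e a x) =
            koszul (parity i) (gact e' a (h j j' ej x))
      & forall i j j' (e : j + gg1 = i) (e' : i + gg1 = j') (x : M i),
          f i x - g i x = dgm_d e (h i j e x) + h j' i e' (dgm_d e' x)].

Definition cycle (A : dgRing) (M : dgMod A) i (x : M i) : Prop :=
  forall j (e : i + gg1 = j), dgm_d e x = 0.

Definition boundary (A : dgRing) (M : dgMod A) i (x : M i) : Prop :=
  exists j (e : j + gg1 = i) (y : M j), dgm_d e y = x.

Definition acyclic (A : dgRing) (M : dgMod A) : Prop :=
  forall i (x : M i), cycle x -> boundary x.

(** Injectivity and surjectivity of [H^i(M) -> H^i(N)] for all [i], spelled out
    on cycles. *)
Definition quasi_iso (A : dgRing) (M N : dgMod A) (f : dgHom M N) : Prop :=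
  forall i,
    (forall x : M i, cycle x -> boundary (f i x) -> boundary x)
 /\ (forall y : N i, cycle y ->
       exists x : M i, cycle x /\ boundary (y - f i x)).

End Graded.

Section KoszulTheory.
Implicit Types s t : 'Z_2.

Lemma koszulD s (V : zmodType) : {morph @koszul s V : x y / x + y}.
Proof. by move=> x y; rewrite /koszul; case: ifP => // _; rewrite opprD. Qed.

Lemma koszulN s (V : zmodType) : {morph @koszul s V : x / - x}.
Proof. by move=> x; rewrite /koszul; case: ifP. Qed.

Lemma koszul0 (V : zmodType) (x : V) : koszul 0 x = x.
Proof. by []. Qed.

Lemma koszul1 (V : zmodType) (x : V) : koszul 1 x = - x.
Proof. by []. Qed.

Lemma Z2_cases s : s = 0 \/ s = 1.
Proof. by case: s => [[|[|//]] p]; [left | right]; apply: val_inj. Qed.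

Lemma koszul_opp s (V : zmodType) (x : V) : koszul (- s) x = koszul s x.
Proof.
have s1 : - 1 = 1 :> 'Z_2 by apply: val_inj.
by case: (Z2_cases s) => ->; rewrite ?s1 ?oppr0.
Qed.

Lemma koszulM s t (V : zmodType) (x : V) :
  koszul s (koszul t x) = koszul (s + t) x.
Proof.
have s11 : 1 + 1 = 0 :> 'Z_2 by apply: val_inj.
by case: (Z2_cases s) => ->; case: (Z2_cases t) => ->;
  rewrite ?s11 ?addr0 ?add0r ?(koszul0, koszul1) ?opprK.
Qed.

Lemma koszulC s t (V : zmodType) (x : V) :
  koszul s (koszul t x) = koszul t (koszul s x).
Proof. by rewrite !koszulM addrC. Qed.

Lemma koszulK s (V : zmodType) : involutive (@koszul s V).
Proof. by move=> x; rewrite /koszul; case: (s == 0); rewrite ?opprK. Qed.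

Section Morph.
Variables (U V : zmodType) (f : U -> V) (fD : {morph f : x y / x + y}).

Lemma morphD0 : f 0 = 0.
Proof. by apply: (addIr (f 0)); rewrite -fD addr0 add0r. Qed.

Lemma morphDN : {morph f : x / - x}.
Proof.
by move=> x; apply: (addIr (f x)); rewrite -fD !addNr morphD0.
Qed.

Lemma morphD_koszul s x : f (koszul s x) = koszul s (f x).
Proof. by rewrite /koszul; case: ifP => // _; rewrite morphDN. Qed.
End Morph.

End KoszulTheory.

(** * Dg modules up to homotopy *)

Section HomotopyCategory.
Variables (G : gradingGroup) (A : dgRing G).
Implicit Types M N L : dgMod A.

Program Definition grHom_id (R : grRing G) (M : grMod R) : grHom M M :=
  @GrHom G R M M (fun i x => x) _ _.
Next Obligation. by []. Qed.
Next Obligation. by []. Qed.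

Program Definition grHom_comp (R : grRing G) (M N L : grMod R)
    (g : grHom N L) (f : grHom M N) : grHom M L :=
  @GrHom G R M L (fun i x => g i (f i x)) _ _.
Next Obligation. by move=> R M N L g f i x y /=; rewrite !ghD. Qed.
Next Obligation. by move=> R M N L g f i j k e a x /=; rewrite !gh_act. Qed.

Program Definition dgHom_id M : dgHom M M := @DgHom G A M M (grHom_id M) _.
Next Obligation. by []. Qed.

Program Definition dgHom_comp M N L (g : dgHom N L) (f : dgHom M N)
    : dgHom M L :=
  @DgHom G A M L (grHom_comp g f) _.
Next Obligation. by move=> M N L g f i j e x /=; rewrite !dgh_d. Qed.

Lemma homotopic_ext M N (f g : dgHom M N) :
  (forall i x, f i x = g i x) -> homotopic f g.
Proof.
move=> fg; exists (fun i j _ _ => 0); split.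
- by move=> i j e x y /=; rewrite addr0.
- by move=> i j k j' k' e ej ek e' a x; rewrite (morphD0 (gactDr e' a))
    (morphD0 (@koszulD _ _)).
- by move=> i j j' e e' x; rewrite fg subrr (morphD0 (dgm_dD e)) addr0.
Qed.

Lemma homotopic_sym M N (f g : dgHom M N) : homotopic f g -> homotopic g f.
Proof.
case=> h [hD hA hd]; exists (fun i j e x => - h i j e x); split.
- by move=> i j e x y; rewrite hD opprD.
- move=> i j k j' k' e ej ek e' a x.
  by rewrite (hA _ _ _ _ _ _ _ _ e') -koszulN (morphDN (gactDr e' a)).
- move=> i j j' e e' x.
  by rewrite -opprB (hd _ _ _ e e') opprD (morphDN (dgm_dD e)).
Qed.

Lemma homotopic_trans M N (f g k : dgHom M N) :
  homotopic f g -> homotopic g k -> homotopic f k.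
Proof.
case=> h [hD hA hd] [h' [hD' hA' hd']].
exists (fun i j e x => h i j e x + h' i j e x); split.
- by move=> i j e x y; rewrite hD hD' addrACA.
- move=> i j l j' l' e ej el e' a x.
  by rewrite (hA _ _ _ _ _ _ _ _ e') (hA' _ _ _ _ _ _ _ _ e') -koszulD gactDr.
- move=> i j j' e e' x; rewrite (dgm_dD e) addrACA -hd -hd'.
  by rewrite addrA subrK.
Qed.

Lemma homotopic_comp M N L (g g' : dgHom N L) (f f' : dgHom M N) :
  homotopic g g' -> homotopic f f' ->
  homotopic (dgHom_comp g f) (dgHom_comp g' f').
Proof.
case=> h [hD hA hd] [k [kD kA kd]].
exists (fun i j e x => h i j e (f i x) + g' j (k i j e x)); split.
- by move=> i j e x y; rewrite ghD hD kD ghD addrACA.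
- move=> i j l j' l' e ej el e' a x.
  rewrite gh_act (hA _ _ _ _ _ _ _ _ e') (kA _ _ _ _ _ _ _ _ e').
  by rewrite (morphD_koszul (@ghD _ _ _ _ g' l')) gh_act -koszulD gactDr.
- move=> i j j' e e' x /=.
  rewrite (dgm_dD e) addrACA dgh_d -hd -dgh_d -ghD -kd ghD.
  by rewrite (morphDN (@ghD _ _ _ _ g' i)) addrA subrK.
Qed.

Program Definition homotopyCat : category :=
  @Category (dgMod A) (@dgHom G A) (@homotopic G A) dgHom_id dgHom_comp
    _ _ _ _ _ _ _.
Next Obligation. by move=> M N f; apply: homotopic_ext. Qed.
Next Obligation. exact: homotopic_sym. Qed.
Next Obligation. exact: homotopic_trans. Qed.
Next Obligation. by move=> M N L g g' f f'; apply: homotopic_comp. Qed.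
Next Obligation. by move=> M N f; apply: homotopic_ext. Qed.
Next Obligation. by move=> M N f; apply: homotopic_ext. Qed.
Next Obligation. by move=> M N L P h g f; apply: homotopic_ext. Qed.

(** ** Shift and cones *)

Lemma shift_degree (n i j k : G) : i + j = k -> i + (j + n) = k + n.
Proof. by rewrite addrA => ->. Qed.

Lemma shift_degree_d (n i j : G) : i + gg1 = j -> i + n + gg1 = j + n.
Proof. by rewrite addrAC => ->. Qed.

(** [M[n]_i = M_(i+n)], with [a] acting by [(-1)^(|n||a|) a]. *)
Program Definition grShift (R : grRing G) (n : G) (M : grMod R) : grMod R :=
  @GrMod G R (fun i => M (i + n))
    (fun i j k e a x =>
       koszul (parity n * parity i) (gact (shift_degree n e) a x)) _ _ _ _.
Next Obligation. by move=> R n M i j k e x a b; rewrite gactDl koszulD. Qed.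
Next Obligation. by move=> R n M i j k e a x y; rewrite gactDr koszulD. Qed.
Next Obligation.
move=> R n M i j l ij jl m e1 e2 e3 e4 a b x /=.
rewrite (morphD_koszul (gactDr _ a)) koszulM -mulrDr -raddfD /= e1.
by rewrite (gactA _ _ (shift_degree n e3) (shift_degree n e4)).
Qed.
Next Obligation.
by move=> R n M i e x /=; rewrite raddf0 mulr0 koszul0 gact1.
Qed.

Program Definition grHom_shift (R : grRing G) (n : G) (M N : grMod R)
    (f : grHom M N) : grHom (grShift n M) (grShift n N) :=
  @GrHom G R (grShift n M) (grShift n N) (fun i x => f (i + n) x) _ _.
Next Obligation. by move=> R n M N f i x y; rewrite ghD. Qed.
Next Obligation.
move=> R n M N f i j k e a x /=.
by rewrite (morphD_koszul (@ghD _ _ _ _ f _)) gh_act.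
Qed.

(** [M[1] ], with differential [- d]. *)
Program Definition dgShift M : dgMod A :=
  @DgMod G A (grShift gg1 M) (fun i j e x => - dgm_d (shift_degree_d gg1 e) x)
    _ _ _.
Next Obligation. by move=> M i j e x y /=; rewrite dgm_dD opprD. Qed.
Next Obligation.
by move=> M i j k e e' x /=; rewrite (morphDN (dgm_dD _)) dgm_dd !oppr0.
Qed.
Next Obligation.
move=> M i j k i' j' k' e ei ej ek el er a x /=.
rewrite parity_gg1 !mul1r (morphD_koszul (dgm_dD _)).
rewrite (dgm_leibniz _ ei (shift_degree_d gg1 ej) _
  (shift_degree gg1 el) (shift_degree gg1 er)).
rewrite -koszulN opprD koszulD (morphDN (gactDr _ a)) !koszulN.
have -> : parity i' = parity i + 1 by rewrite -ei raddfD /= parity_gg1.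
by rewrite -koszulM koszul1 koszulN.
Qed.

Program Definition dgHom_shift M N (f : dgHom M N)
    : dgHom (dgShift M) (dgShift N) :=
  @DgHom G A (dgShift M) (dgShift N) (grHom_shift gg1 f) _.
Next Obligation.
by move=> M N f i j e x /=; rewrite (morphDN (@ghD _ _ _ _ f _)) dgh_d.
Qed.

Lemma homotopic_shift M N (f g : dgHom M N) :
  homotopic f g -> homotopic (dgHom_shift f) (dgHom_shift g).
Proof.
case=> h [hD hA hd].
exists (fun i j e x => - h (i + gg1) (j + gg1) (shift_degree_d gg1 e) x); split.
- by move=> i j e x y /=; rewrite hD opprD.
- move=> i j k j' k' e ej ek e' a x /=.
  rewrite (morphD_koszul (hD _ _ _)).
  rewrite (hA _ _ _ _ _ _ (shift_degree_d gg1 ej) _ (shift_degree gg1 e')).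
  by rewrite (morphDN (gactDr _ a)) -!koszulN koszulC.
- move=> i j j' e e' x /=.
  rewrite (hd _ _ _ (shift_degree_d gg1 e) (shift_degree_d gg1 e')).
  by rewrite (morphDN (dgm_dD _)) (morphDN (hD _ _ _)) !opprK.
Qed.

Program Definition homotopyShift : functor homotopyCat homotopyCat :=
  @Functor homotopyCat homotopyCat dgShift dgHom_shift _ _ _.
Next Obligation. exact: homotopic_shift. Qed.
Next Obligation. by move=> M; apply: homotopic_ext. Qed.
Next Obligation. by move=> M N L g f; apply: homotopic_ext. Qed.

Program Definition grSum (R : grRing G) (M N : grMod R) : grMod R :=
  @GrMod G R (fun i => (M i * N i)%type)
    (fun i j k e a x => (gact e a x.1, gact e a x.2)) _ _ _ _.
Next Obligation. by move=> R M N i j k e x a b /=; rewrite !gactDl. Qed.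
Next Obligation. by move=> R M N i j k e a x y /=; rewrite !gactDr. Qed.
Next Obligation.
move=> R M N i j l ij jl m e1 e2 e3 e4 a b x /=.
by rewrite !(gactA _ _ e3 e4).
Qed.
Next Obligation. by move=> R M N i e [x y] /=; rewrite !gact1. Qed.

(** The cone [M[1] + N] of [f], with [d (x, y) = (- d x, f x + d y)]. *)
Program Definition cone M N (f : dgHom M N) : dgMod A :=
  @DgMod G A (grSum (dgShift M) N)
    (fun i j (e : i + gg1 = j) (x : dgShift M i * N i) =>
       (dgm_d e x.1,
        f j (ecast z (M z) e x.1) + dgm_d e x.2)) _ _ _.
Next Obligation.
move=> M N f i j e x y /=; rewrite !dgm_dD opprD.
by congr (_, _); case: _ / e; rewrite /= ghD addrACA.
Qed.
Next Obligation.
move=> M N f i j k e e' x; congr (_, _); first exact: (@dgm_dd _ _ (dgShift M)).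
rewrite dgm_dD dgm_dd addr0 /=; case: _ / e' => /=; case: _ / e => /=.
rewrite (morphDN (@ghD _ _ _ _ f _)) -dgh_d.
rewrite (eq_irrelevance (shift_degree_d _ _) (erefl (i + gg1 + gg1))).
by rewrite addNr.
Qed.
Next Obligation.
move=> M N f i j k i' j' k' e ei ej ek el er a x.
have -> (u v : dgShift M k' * N k') s :
  u + koszul s v = (u.1 + koszul s v.1, u.2 + koszul s v.2).
  by case: u v => [u1 u2] [v1 v2]; rewrite /koszul; case: ifP.
congr (_, _) => /=; first exact: (@dgm_leibniz _ _ (dgShift M)).
rewrite (dgm_leibniz e ei ej ek el er) gactDr koszulD addrCA.
congr (_ + (_ + _)); rewrite parity_gg1 mul1r.
have -> : ecast z (M z) ek (koszul (parity i) (gact (shift_degree gg1 e) a x.1))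
  = koszul (parity i) (gact er a (ecast z (M z) ej x.1)).
  case: _ / ej er => er; case: _ / ek er => er /=; congr koszul.
  by rewrite (eq_irrelevance er (shift_degree gg1 e)).
by rewrite (morphD_koszul (@ghD _ _ _ _ f _)) gh_act.
Qed.

Program Definition cone_in M N (f : dgHom M N) : dgHom N (cone f) :=
  @DgHom G A N (cone f)
    (@GrHom G A N (cone f) (fun i y => (0, y) : cone f i) _ _) _.
Next Obligation. by move=> M N f i x y; congr (_, _); rewrite addr0. Qed.
Next Obligation.
move=> M N f i j k e a x; congr (_, _) => /=.
by rewrite (morphD0 (gactDr _ a)) (morphD0 (@koszulD _ _)).
Qed.
Next Obligation.
move=> M N f i j e x; congr (_, _) => /=.
  by rewrite (morphD0 (dgm_dD _)) oppr0.
by case: _ / e => /=; rewrite (morphD0 (@ghD _ _ _ _ f _)) add0r.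
Qed.

Program Definition cone_out M N (f : dgHom M N) : dgHom (cone f) (dgShift M) :=
  @DgHom G A (cone f) (dgShift M)
    (@GrHom G A (cone f) (dgShift M) (fun i (x : cone f i) => x.1) _ _) _.
Next Obligation. by []. Qed.
Next Obligation. by []. Qed.
Next Obligation. by []. Qed.

(** [K(A-Mod)]: a triangle is distinguished when it is isomorphic, in the
    homotopy category, to the triangle of a cone. *)
Definition K_Mod : triData :=
  @TriData homotopyCat homotopyShift (fun X Y Z f g h =>
    exists (M N : dgMod A) (u : dgHom M N),
      @tri_iso homotopyCat homotopyShift
        M N (cone u) u (cone_in u) (cone_out u) X Y Z f g h).

(** ** Stability under the shift *)

Lemma cycle_shift M i (x : dgShift M i) :
  @cycle _ _ (dgShift M) i x <-> @cycle _ _ M (i + gg1) x.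
Proof.
split=> [cx j e|cx j e] /=; last by rewrite cx oppr0.
case: _ / e; have := cx _ erefl; move=> /= /eqP; rewrite oppr_eq0 => /eqP.
by rewrite (eq_irrelevance (shift_degree_d _ _) erefl).
Qed.

Lemma boundary_shift M i (x : dgShift M i) :
  @boundary _ _ (dgShift M) i x <-> @boundary _ _ M (i + gg1) x.
Proof.
split=> [[j [e [y <-]]]|[j [e [y <-]]]].
  exists (j + gg1), (shift_degree_d gg1 e), (- y).
  by rewrite (morphDN (dgm_dD _)).
have ji : j = i by apply: addIr e.
case: _ / ji e => {i x} e; exists (j - gg1), (subrK _ _).
exists (- ecast z (M z) (esym (subrK gg1 j)) y) => /=.
rewrite (morphDN (dgm_dD _)) opprK.
case: _ / (esym (subrK gg1 j)) (shift_degree_d _ _) => e' /=.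
by rewrite (eq_irrelevance e' e).
Qed.

Lemma acyclic_shift M : acyclic M -> acyclic (dgShift M).
Proof. by move=> aM i x /cycle_shift cx; apply/boundary_shift/aM. Qed.

Lemma quasi_iso_shift M N (f : dgHom M N) :
  quasi_iso f -> quasi_iso (dgHom_shift f).
Proof.
move=> qf i; have [qi qs] := qf (i + gg1); split.
  by move=> x /cycle_shift cx /boundary_shift bx; apply/boundary_shift/qi.
move=> y /cycle_shift /qs[x [cx bx]].
by exists x; split; [apply/cycle_shift | apply/boundary_shift].
Qed.

Lemma gact_cast (R : grRing G) (M : grMod R) i j j' k k' (e : i + j = k)
    (ej : j = j') (ek : k = k') (e' : i + j' = k') (a : R i) x :
  ecast z (M z) ek (gact e a x) = gact e' a (ecast z (M z) ej x).
Proof.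
case: _ / ej ek e' => ek; case: _ / ek => e' /=.
by rewrite (eq_irrelevance e e').
Qed.

Lemma castD (M : G -> zmodType) i j (e : i = j) :
  {morph (fun x : M i => ecast z (M z) e x) : x y / x + y}.
Proof. by case: _ / e. Qed.

Lemma gh_cast (R : grRing G) (M N : grMod R) (f : grHom M N) i j (e : i = j) x :
  f j (ecast z (M z) e x) = ecast z (N z) e (f i x).
Proof. by case: _ / e. Qed.

Section Unshift.
Variables (R : grRing G) (n : G).

Program Definition grHom_unshiftl (M L : grMod R) (f : grHom (grShift n M) L)
    : grHom M (grShift (- n) L) :=
  @GrHom G R M (grShift (- n) L)
    (fun i x => f (i - n) (ecast z (M z) (esym (subrK n i)) x)) _ _.
Next Obligation. by move=> M L f i x y; rewrite castD ghD. Qed.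
Next Obligation.
move=> M L f i j k e a x /=.
rewrite (gact_cast e (esym (subrK n j)) _
  (shift_degree n (shift_degree (- n) e))).
rewrite raddfN mulNr koszul_opp -gh_act /=.
by rewrite -(morphD_koszul (@ghD _ _ _ _ f _)) koszulK.
Qed.

Program Definition grHom_unshiftr (M N : grMod R) (g : grHom M (grShift (- n) N))
    : grHom (grShift n M) N :=
  @GrHom G R (grShift n M) N
    (fun i x => ecast z (N z) (addrK n i) (g (i + n) x)) _ _.
Next Obligation. by move=> M N g i x y; rewrite ghD castD. Qed.
Next Obligation.
move=> M N g i j k e a x /=.
rewrite (morphD_koszul (@ghD _ _ _ _ g _)) gh_act /=.
rewrite raddfN mulNr koszul_opp koszulK.
exact: gact_cast.
Qed.

Lemma gr_projective_shift (M : grMod R) :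
  gr_projective M -> gr_projective (grShift n M).
Proof.
move=> pM N L p f p_surj.
have [|g gP] := pM _ _ (grHom_shift (- n) p) (grHom_unshiftl f).
  by move=> i y; apply: p_surj.
exists (grHom_unshiftr g) => i x /=; rewrite gh_cast.
have /= -> := gP (i + n) x.
move: (esym (subrK n (i + n))).
by move: (i + n - n) (addrK n i) => j e; case: _ / e x => x e;
  rewrite (eq_irrelevance e erefl).
Qed.
End Unshift.

Definition K_Modproj : triData :=
  @full_sub_tri K_Mod (fun M : dgMod A => gr_projective M)
    (fun M pM => @gr_projective_shift _ gg1 _ pM).

(** The acyclic objects of [K_Modproj], as a full subcategory of it. *)
Definition Kac_Modproj : triData :=
  @full_sub_tri K_Modproj (fun X => acyclic (sval X))
    (fun X aX => @acyclic_shift (sval X) aX).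

Definition D_Mod : triData :=
  @localization_tri K_Mod (@quasi_iso G A) quasi_iso_shift.

Definition Kac_incl : functor Kac_Modproj K_Modproj :=
  full_incl (C := K_Modproj) (fun X => acyclic (sval X)).

Definition K_to_D : functor K_Modproj D_Mod :=
  functor_comp (loc_functor (C := K_Mod) (@quasi_iso G A))
    (full_incl (C := K_Mod) (fun M : dgMod A => gr_projective M)).

End HomotopyCategory.

(* Main.v *)
From HB Require Import structures.
From mathcomp Require Import all_boot all_algebra boolp classical_sets.
From Stdlib Require Import Setoid Morphisms.
Require Import Defs.

Set Implicit Arguments.
Unset Strict Implicit.
Unset Printing Implicit Defensive.
Import GRing.Theory.
Local Open Scope ring_scope.
Local Open Scope cat_scope.
Local Obligation Tactic := idtac.

(** The theorem is an instance of Bousfield localization.  Let [K] be the homotopy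
    category of all dg modules and [T] its full subcategory of graded projective
    ones.  Everything follows from two kinds of resolutions.

    - Every [M] admits a quasi-isomorphism [S -> M] with [S] graded projective and
      colocal: every morphism from [S] to an acyclic dg module is null-homotopic
      ([semifree_resolution]).
    - Every graded projective [X] admits a quasi-isomorphism [X -> R] with [R]
      graded projective and local: every morphism from an acyclic graded projective
      dg module to [R] is null-homotopic ([acyclic_orthogonal_resolution]).

    Morphisms out of a colocal object, and morphisms from an object of [T] into a
    local one, are the same in [K] and in [D(A)].  Hence [M |-> S] and [M |-> R(S)]
    are the two adjoints of [T -> D(A)], both fully faithful.  The cone of [S -> X]
    and the cocone of [X -> R] are acyclic, and they are the values at [X] of the two
    adjoints of the inclusion of the acyclic objects.  The triangulated structure of
    [D(A)] is the one induced by the embedding [M |-> S] of [D(A)] into [T].  This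
    formal part is [recollement_of_resolutions].

    Both resolutions are built by attaching cells.  Given free dg modules [E_s], one
    adjoins to a base a copy of [E_s] for every attaching map from [E_s] to the shift of
    what has been built so far.  Instead of a transfinite sequence of steps, all cells
    are collected in one inductive type, [cell], whose constructor takes for every
    generator of [E_s] a finite expression in earlier cells.  An attaching map into the
    resulting dg module is again given by such expressions, so it is one along which
    a cell has been attached, whatever the size of [E_s] ([cell_attach]).

    For [S -> M] the [E_s] are free on one closed generator, the base is zero, and each
    cell carries a homotopy in [M]; the cells create all cohomology classes of [M]
    and kill all other ones.  For [X -> R] the base is [X], and the [E_s] are all acyclic
    free dg modules whose generators form a part of the type [tree A].  Attaching
    them does not change the cohomology, and every morphism from [E_s] to [R[1] ]
    is null-homotopic because it is an attaching map.  This is enough, since every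
    acyclic free dg module is exhausted by a chain of dg submodules with successive
    quotients among the [E_s]: starting from one generator and adding the generators that occur in
    differentials and in chosen preimages of cycles reaches only generators which can be
    named by elements of [tree A] ([free_acyclic_null]).

    The last construction needs [X] to be graded free rather than graded
    projective.  By an Eilenberg swindle, adding to [X] infinitely many contractible
    discs makes it graded free, so [X] is a retract of a free dg module with the same
    cohomology ([free_retract]). *)

(** * Equality of morphisms as a setoid relation *)

Global Instance eqh_equivalence (C : category) (X Y : C) :
  Equivalence (@eqh C X Y).
Proof. by split; [exact: eqh_refl | exact: eqh_sym | exact: eqh_trans]. Qed.

#[global] Hint Resolve eqh_refl : core.

Global Instance comp_proper (C : category) (X Y Z : C) :
  Proper (@eqh C Y Z ==> @eqh C X Y ==> @eqh C X Z) comp.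
Proof. by move=> g g' gg f f' ff; apply: comp_eqh. Qed.

Global Instance fmap_proper (C D : category) (F : functor C D) (X Y : C) :
  Proper (@eqh C X Y ==> @eqh D (F X) (F Y)) (fmap F).
Proof. by move=> f g; apply: fmap_eqh. Qed.

Global Instance hadd_proper (C : category) (P : preadditive C) (X Y : C) :
  Proper (@eqh C X Y ==> @eqh C X Y ==> @eqh C X Y) (@hadd C P X Y).
Proof. by move=> f f' ff g g' gg; apply: hadd_eqh. Qed.

Global Instance hopp_proper (C : category) (P : preadditive C) (X Y : C) :
  Proper (@eqh C X Y ==> @eqh C X Y) (@hopp C P X Y).
Proof. by move=> f f' ff; apply: hopp_eqh. Qed.

(** * Isomorphisms and fully faithful functors *)

Section Iso.
Variable C : category.
Implicit Types X Y Z : C.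

Lemma iso_id X : is_iso (idm X).
Proof. by exists (idm X); rewrite comp_idl. Qed.

Lemma iso_comp X Y Z (g : hom Y Z) (f : hom X Y) :
  is_iso g -> is_iso f -> is_iso (g ∘ f).
Proof.
move=> [g' [g'g gg']] [f' [f'f ff']]; exists (f' ∘ g'); split.
  by rewrite -comp_assoc (comp_assoc g') g'g comp_idl.
by rewrite -comp_assoc (comp_assoc f) ff' comp_idl.
Qed.

Lemma iso_eqh X Y (f g : hom X Y) : f ≡ g -> is_iso f -> is_iso g.
Proof. by move=> fg [f' [f'f ff']]; exists f'; rewrite -fg. Qed.

Lemma iso_monic X Y Z (f : hom Y Z) (u v : hom X Y) :
  is_iso f -> f ∘ u ≡ f ∘ v -> u ≡ v.
Proof.
move=> [f' [f'f _]] uv.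
by rewrite -(comp_idl u) -(comp_idl v) -f'f -!comp_assoc uv.
Qed.

Lemma iso_epic X Y Z (f : hom X Y) (u v : hom Y Z) :
  is_iso f -> u ∘ f ≡ v ∘ f -> u ≡ v.
Proof.
move=> [f' [_ ff']] uv.
by rewrite -(comp_idr u) -(comp_idr v) -ff' !comp_assoc uv.
Qed.

(** Bijectivity of [Hom(W, f)], for one test object [W]: colocal objects see
    quasi-isomorphisms as isomorphisms although these need not be invertible. *)
Definition hbij W X Y (f : hom X Y) : Prop :=
  (forall u v : hom W X, f ∘ u ≡ f ∘ v -> u ≡ v)
  /\ (forall w : hom W Y, exists u : hom W X, f ∘ u ≡ w).

Lemma iso_hbij W X Y (f : hom X Y) : is_iso f -> hbij W f.
Proof.
move=> fi; split=> [u v|w]; first exact: iso_monic.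
by case: fi => f' [_ ff']; exists (f' ∘ w); rewrite comp_assoc ff' comp_idl.
Qed.

(** Yoneda, tested on the source and the target only. *)
Lemma hbij_iso X Y (f : hom X Y) : hbij X f -> hbij Y f -> is_iso f.
Proof.
move=> [fX _] [_ fY]; have [g fg] := fY (idm Y); exists g; split=> //.
by apply: fX; rewrite comp_assoc fg comp_idl comp_idr.
Qed.

End Iso.

Lemma fmap_iso (C D : category) (F : functor C D) (X Y : C) (f : hom X Y) :
  is_iso f -> is_iso (fmap F f).
Proof.
by move=> [g [gf fg]]; exists (fmap F g); rewrite -!fmap_comp gf fg !fmap_id.
Qed.

Lemma ff_iso (C D : category) (F : functor C D) (X Y : C) (f : hom X Y) :
  fully_faithful F -> is_iso (fmap F f) -> is_iso f.
Proof.
move=> ffF [g [gf fg]]; have [g0 g0E] := (ffF Y X).2 g; exists g0.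
by split; apply: (ffF _ _).1; rewrite fmap_comp fmap_id g0E.
Qed.

Definition ess_surj (C D : category) (F : functor C D) : Prop :=
  forall Y : D, exists X : C, isomorphic (F X) Y.

Lemma equiv_ff (C D : category) (F : functor C D) :
  is_equivalence F -> fully_faithful F /\ ess_surj F.
Proof.
move=> [G [[phi phi_iso] [psi psi_iso]]].
have faithF X Y (f g : hom X Y) : fmap F f ≡ fmap F g -> f ≡ g.
  move=> fg; apply: (iso_epic (phi_iso X)).
  by rewrite -[f ∘ _](nt_nat phi) -[g ∘ _](nt_nat phi) /= fg.
have faithG X Y (f g : hom X Y) : fmap G f ≡ fmap G g -> f ≡ g.
  move=> fg; apply: (iso_epic (psi_iso X)).
  by rewrite -[f ∘ _](nt_nat psi) -[g ∘ _](nt_nat psi) /= fg.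
split; last by move=> Y; exists (G Y), (psi Y); apply: psi_iso.
move=> X Y; split=> [|h]; first exact: faithF.
have [phi' [phi'K Kphi']] := phi_iso X.
exists (phi Y ∘ (fmap G h ∘ phi')); apply: faithG.
apply: (iso_monic (phi_iso Y)).
rewrite -[fmap G (fmap F _)]/(fmap (functor_comp G F) _) (nt_nat phi) /=.
by rewrite -!comp_assoc phi'K comp_idr.
Qed.

Lemma ff_equiv (C D : category) (F : functor C D) :
  fully_faithful F -> ess_surj F -> is_equivalence F.
Proof.
move=> ffF esF.
pose G Y := sval (cid (esF Y)).
pose e Y : hom (F (G Y)) Y := sval (cid (svalP (cid (esF Y)))).
have eI Y : is_iso (e Y) := svalP (cid (svalP (cid (esF Y)))).
pose e' Y := sval (cid (eI Y)).
have e'e Y : e' Y ∘ e Y ≡ idm _ := (svalP (cid (eI Y))).1.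
have ee' Y : e Y ∘ e' Y ≡ idm _ := (svalP (cid (eI Y))).2.
pose g Y Y' (f : hom Y Y') : hom (G Y) (G Y') :=
  sval (cid ((ffF _ _).2 (e' Y' ∘ (f ∘ e Y)))).
have gE Y Y' (f : hom Y Y') : fmap F (g Y Y' f) ≡ e' Y' ∘ (f ∘ e Y) :=
  svalP (cid ((ffF _ _).2 (e' Y' ∘ (f ∘ e Y)))).
have g1 Y Y' (f f' : hom Y Y') : f ≡ f' -> g _ _ f ≡ g _ _ f'.
  by move=> ff; apply: (ffF _ _).1; rewrite !gE ff.
have g2 Y : g _ _ (idm Y) ≡ idm _.
  by apply: (ffF _ _).1; rewrite gE comp_idl fmap_id e'e.
have g3 X Y Z (v : hom Y Z) (u : hom X Y) : g _ _ (v ∘ u) ≡ g _ _ v ∘ g _ _ u.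
  apply: (ffF _ _).1; rewrite fmap_comp !gE -!comp_assoc.
  by rewrite (comp_assoc (e Y)) ee' comp_idl.
exists (Functor g1 g2 g3); split; last first.
  have nt X Y (f : hom X Y) : e Y ∘ fmap F (g _ _ f) ≡ f ∘ e X.
    by rewrite gE comp_assoc ee' comp_idl.
  by exists (@NatTrans _ _ (functor_comp F (Functor g1 g2 g3)) (functor_id D)
    e nt) => X; apply: eI.
pose t X : hom (G (F X)) X := sval (cid ((ffF _ _).2 (e (F X)))).
have tE X : fmap F (t X) ≡ e (F X) := svalP (cid ((ffF _ _).2 (e (F X)))).
have nt X Y (f : hom X Y) : t Y ∘ g _ _ (fmap F f) ≡ f ∘ t X.
  apply: (ffF _ _).1; rewrite !fmap_comp gE !tE.
  by rewrite comp_assoc ee' comp_idl.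
exists (@NatTrans _ _ (functor_comp (Functor g1 g2 g3) F) (functor_id C) t nt) => X.
by apply: (ff_iso ffF); apply: iso_eqh (eI _); rewrite tE.
Qed.

(** * Adjoints from universal arrows *)

(** An adjoint is determined by a universal arrow at each object; the unit is then
    that arrow, which is why its invertibility makes the adjoint fully faithful. *)
Lemma left_adjoint_of_universal (C D : category) (R : functor D C)
    (l : C -> D) (eta : forall X, hom X (R (l X))) :
  (forall X (Y : D) (f : hom X (R Y)), exists2 g : hom (l X) Y,
     fmap R g ∘ eta X ≡ f & forall g', fmap R g' ∘ eta X ≡ f -> g' ≡ g) ->
  exists2 L : functor C D, adjoint L R
    & (forall X, is_iso (eta X)) -> fully_faithful L.
Proof.
move=> univ.
pose lift X Y f : hom (l X) Y := s2val (cid2 (univ X Y f)).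
have liftE X Y f : fmap R (lift X Y f) ∘ eta X ≡ f := s2valP (cid2 (univ X Y f)).
have lift_uniq X Y f g : fmap R g ∘ eta X ≡ f -> g ≡ lift X Y f :=
  s2valP' (cid2 (univ X Y f)) g.
have uniq X Y (g g' : hom (l X) Y) :
    fmap R g ∘ eta X ≡ fmap R g' ∘ eta X -> g ≡ g'.
  by move=> gg; rewrite (lift_uniq _ _ _ _ gg); symmetry; apply: lift_uniq.
pose m X Y (f : hom X Y) : hom (l X) (l Y) := lift _ _ (eta Y ∘ f).
have m1 X Y (f g : hom X Y) : f ≡ g -> m _ _ f ≡ m _ _ g.
  by move=> fg; apply: uniq; rewrite !liftE fg.
have m2 X : m _ _ (idm X) ≡ idm _.
  by apply: uniq; rewrite liftE fmap_id comp_idl comp_idr.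
have m3 X Y Z (g : hom Y Z) (f : hom X Y) : m _ _ (g ∘ f) ≡ m _ _ g ∘ m _ _ f.
  by apply: uniq; rewrite fmap_comp -comp_assoc !liftE !comp_assoc liftE.
pose L := Functor m1 m2 m3.
have nt1 X Y (f : hom X Y) : eta Y ∘ f ≡ fmap R (m _ _ f) ∘ eta X.
  by rewrite liftE.
have nt2 X Y (f : hom X Y) :
    lift _ _ (idm (R Y)) ∘ m _ _ (fmap R f) ≡ f ∘ lift _ _ (idm (R X)).
  apply: uniq; rewrite !fmap_comp -!comp_assoc !liftE comp_assoc liftE.
  by rewrite comp_idl comp_idr.
exists L.
  exists (@NatTrans _ _ (functor_id C) (functor_comp R L) eta nt1).
  exists (@NatTrans _ _ (functor_comp L R) (functor_id D)
    (fun Y => lift _ _ (idm (R Y))) nt2).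
  split=> X /=; last exact: liftE.
  apply: uniq; rewrite fmap_comp -comp_assoc liftE comp_assoc liftE.
  by rewrite fmap_id.
move=> etaI X Y; split=> [f g fg|h].
  by apply: (iso_monic (etaI Y)); rewrite !nt1 -[m _ _ f]/(fmap L f) fg.
have [e' [e'e ee']] := etaI Y.
exists (e' ∘ (fmap R h ∘ eta X)); apply: uniq.
by rewrite -nt1 comp_assoc ee' comp_idl.
Qed.

Lemma right_adjoint_of_universal (C D : category) (L : functor C D)
    (r : D -> C) (eps : forall Y, hom (L (r Y)) Y) :
  (forall Y (X : C) (f : hom (L X) Y), exists2 g : hom X (r Y),
     eps Y ∘ fmap L g ≡ f & forall g', eps Y ∘ fmap L g' ≡ f -> g' ≡ g) ->
  exists2 R : functor D C, adjoint L R
    & (forall Y, is_iso (eps Y)) -> fully_faithful R.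
Proof.
move=> univ.
pose lift Y X f : hom X (r Y) := s2val (cid2 (univ Y X f)).
have liftE Y X f : eps Y ∘ fmap L (lift Y X f) ≡ f := s2valP (cid2 (univ Y X f)).
have lift_uniq Y X f g : eps Y ∘ fmap L g ≡ f -> g ≡ lift Y X f :=
  s2valP' (cid2 (univ Y X f)) g.
have uniq Y X (g g' : hom X (r Y)) :
    eps Y ∘ fmap L g ≡ eps Y ∘ fmap L g' -> g ≡ g'.
  by move=> gg; rewrite (lift_uniq _ _ _ _ gg); symmetry; apply: lift_uniq.
pose m X Y (f : hom X Y) : hom (r X) (r Y) := lift _ _ (f ∘ eps X).
have m1 X Y (f g : hom X Y) : f ≡ g -> m _ _ f ≡ m _ _ g.
  by move=> fg; apply: uniq; rewrite !liftE fg.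
have m2 X : m _ _ (idm X) ≡ idm _.
  by apply: uniq; rewrite liftE fmap_id comp_idl comp_idr.
have m3 X Y Z (g : hom Y Z) (f : hom X Y) : m _ _ (g ∘ f) ≡ m _ _ g ∘ m _ _ f.
  by apply: uniq; rewrite fmap_comp comp_assoc !liftE -!comp_assoc liftE.
pose R := Functor m1 m2 m3.
have nt1 X Y (f : hom X Y) : eps Y ∘ fmap L (m _ _ f) ≡ f ∘ eps X.
  by rewrite liftE.
have nt2 X Y (f : hom X Y) :
    lift _ _ (idm (L Y)) ∘ f ≡ m _ _ (fmap L f) ∘ lift _ _ (idm (L X)).
  apply: uniq; rewrite !fmap_comp !comp_assoc !liftE -comp_assoc liftE.
  by rewrite comp_idl comp_idr.
exists R.
  exists (@NatTrans _ _ (functor_id C) (functor_comp R L)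
    (fun X => lift _ _ (idm (L X))) nt2).
  exists (@NatTrans _ _ (functor_comp L R) (functor_id D) eps nt1).
  split=> X /=; first exact: liftE.
  apply: uniq; rewrite fmap_comp comp_assoc liftE -comp_assoc liftE.
  by rewrite fmap_id.
move=> epsI X Y; split=> [f g fg|h].
  by apply: (iso_epic (epsI X)); rewrite -!nt1 -[m _ _ f]/(fmap R f) fg.
have [e' [e'e ee']] := epsI X.
exists (eps Y ∘ (fmap L h ∘ e')); apply: uniq.
by rewrite nt1 -!comp_assoc e'e comp_idr.
Qed.

(** * Preadditive categories *)

Section Preadditive.
Variables (C : category) (P : preadditive C).
Local Notation "f ⊕ g" := (hadd P f g) (at level 50, left associativity).
Local Notation "⊖ f" := (hopp P f) (at level 35, right associativity).
Local Notation "'O'" := (hzero P _ _).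
Implicit Types X Y Z : C.

Lemma hadd0r X Y (f : hom X Y) : f ⊕ O ≡ f.
Proof. by rewrite haddC hadd0. Qed.

Lemma haddNr X Y (f : hom X Y) : f ⊕ ⊖ f ≡ O.
Proof. by rewrite haddC haddN. Qed.

Lemma hadd_injr X Y (f g h : hom X Y) : f ⊕ h ≡ g ⊕ h -> f ≡ g.
Proof. by move=> fg; rewrite -(hadd0r f) -(hadd0r g) -(haddNr h) !haddA fg. Qed.

Lemma haddNK X Y (f g : hom X Y) : f ⊕ ⊖ g ⊕ g ≡ f.
Proof. by rewrite -haddA haddN hadd0r. Qed.

Lemma hopp_uniq X Y (f g : hom X Y) : f ⊕ g ≡ O -> f ≡ ⊖ g.
Proof. by move=> fg; apply: (@hadd_injr _ _ _ _ g); rewrite fg haddN. Qed.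

Lemma hoppK X Y (f : hom X Y) : ⊖ ⊖ f ≡ f.
Proof. by symmetry; apply: hopp_uniq; rewrite haddNr. Qed.

Lemma hopp0 X Y : ⊖ hzero P X Y ≡ O.
Proof. by symmetry; apply: hopp_uniq; rewrite hadd0. Qed.

Lemma hsub_eq0 X Y (f g : hom X Y) : f ⊕ ⊖ g ≡ O -> f ≡ g.
Proof. by move=> fg; rewrite -(haddNK f g) fg hadd0. Qed.

Lemma comp0h X Y Z (f : hom X Y) : hzero P Y Z ∘ f ≡ O.
Proof.
apply: (@hadd_injr _ _ _ _ (hzero P Y Z ∘ f)).
by rewrite -comp_haddl !hadd0.
Qed.

Lemma comph0 X Y Z (g : hom Y Z) : g ∘ hzero P X Y ≡ O.
Proof.
apply: (@hadd_injr _ _ _ _ (g ∘ hzero P X Y)).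
by rewrite -comp_haddr !hadd0.
Qed.

Lemma compNh X Y Z (g : hom Y Z) (f : hom X Y) : ⊖ g ∘ f ≡ ⊖ (g ∘ f).
Proof. by apply: hopp_uniq; rewrite -comp_haddl haddN comp0h. Qed.

Lemma comphN X Y Z (g : hom Y Z) (f : hom X Y) : g ∘ ⊖ f ≡ ⊖ (g ∘ f).
Proof. by apply: hopp_uniq; rewrite -comp_haddr haddN comph0. Qed.

Lemma is_zeroP Z : is_zero Z <-> idm Z ≡ O.
Proof.
split=> [[iZ _]|Z0]; first by have [f uf] := iZ Z; rewrite (uf (idm Z)) -(uf O).
split=> X; exists O => g.
  by rewrite -(comp_idr g) Z0 comph0.
by rewrite -(comp_idl g) Z0 comp0h.
Qed.

Lemma zero_source Z X (f g : hom Z X) : is_zero Z -> f ≡ g.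
Proof. by move=> [iZ _]; have [h uh] := iZ X; rewrite (uh f) (uh g). Qed.

Lemma zero_target Z X (f g : hom X Z) : is_zero Z -> f ≡ g.
Proof. by move=> [_ tZ]; have [h uh] := tZ X; rewrite (uh f) (uh g). Qed.

(** Hom-sets are groups, so injectivity is a matter of the kernel. *)
Lemma hbij_of_kernel W X Y (f : hom X Y) :
  (forall u : hom W X, f ∘ u ≡ O -> u ≡ O) ->
  (forall w : hom W Y, exists u, f ∘ u ≡ w) -> hbij W f.
Proof.
move=> ker epi; split=> // u v uv; apply: hsub_eq0; apply: ker.
by rewrite comp_haddr comphN uv haddNr.
Qed.
End Preadditive.

Section AdditiveFunctor.
Variables (C D : category) (P : preadditive C) (Q : preadditive D).
Variables (F : functor C D) (FD : additive_functor P Q F).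

Lemma fmap0 X Y : fmap F (hzero P X Y) ≡ hzero Q _ _.
Proof.
apply: (@hadd_injr _ Q _ _ _ _ (fmap F (hzero P X Y))).
by rewrite -FD !hadd0.
Qed.

Lemma fmapN X Y (f : hom X Y) : fmap F (hopp P f) ≡ hopp Q (fmap F f).
Proof. by apply: hopp_uniq; rewrite -FD haddN fmap0. Qed.

Lemma fmap_zero (Z : C) : is_zero Z -> is_zero (F Z).
Proof. by move=> /(is_zeroP P) Z0; apply/(is_zeroP Q); rewrite -fmap_id Z0 fmap0. Qed.
End AdditiveFunctor.

(** * Triangulated categories *)

(** The axioms from which the exactness of [Hom(W, -)] and [Hom(-, W)] on
    distinguished triangles follows.  They are kept apart because they are what can be
    checked by hand for cones: only one direction of the rotation axiom appears, and
    [rot_converse] gives the other one. *)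
Record pretriangulated (T : triData) (P : preadditive T) : Prop := {
  pt_zero : exists Z : T, is_zero Z;
  pt_shift_additive : additive_functor P P (@shift T);
  pt_shift_ff : fully_faithful (@shift T);
  pt_id : forall X Z : T, is_zero Z ->
    distinguished (idm X) (hzero P X Z) (hzero P Z (shift X));
  pt_rot : forall (X Y Z : T)
      (f : hom X Y) (g : hom Y Z) (h : hom Z (shift X)),
    distinguished f g h -> distinguished g h (hopp P (fmap shift f));
  pt_map : forall (X Y Z X' Y' Z' : T)
      (f : hom X Y) (g : hom Y Z) (h : hom Z (shift X))
      (f' : hom X' Y') (g' : hom Y' Z') (h' : hom Z' (shift X'))
      (a : hom X X') (b : hom Y Y'),
    distinguished f g h -> distinguished f' g' h' -> b ∘ f ≡ f' ∘ a ->
    exists c : hom Z Z', c ∘ g ≡ g' ∘ b /\ fmap shift a ∘ h ≡ h' ∘ c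
}.

Lemma triangulated_pre (T : triData) (P : preadditive T) :
  triangulated P -> pretriangulated P.
Proof.
move=> tT; split; first exact: (tri_additive tT).1.
- exact: tri_shift_additive tT.
- exact: (equiv_ff (tri_shift_equiv tT)).1.
- exact: tri_dist_id tT.
- by move=> X Y Z f g h; case: (tri_dist_rot tT f g h).
- exact: tri_dist_map tT.
Qed.

Section Pretriangulated.
Variables (T : triData) (P : preadditive T) (pT : pretriangulated P).
Local Notation "f ⊕ g" := (hadd P f g) (at level 50, left associativity).
Local Notation "⊖ f" := (hopp P f) (at level 35, right associativity).
Local Notation "'O'" := (hzero P _ _).
Implicit Types X Y Z W : T.

Lemma shift_faithful X Y (f g : hom X Y) : fmap shift f ≡ fmap shift g -> f ≡ g.
Proof. exact: (pt_shift_ff pT X Y).1. Qed.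

Lemma shift_full X Y (h : hom (shift X) (shift Y)) : exists f, fmap shift f ≡ h.
Proof. exact: (pt_shift_ff pT X Y).2. Qed.

Let shiftN X Y (f : hom X Y) : fmap shift (⊖ f) ≡ ⊖ fmap shift f.
Proof. exact: fmapN (pt_shift_additive pT) _ _ _. Qed.

Let shift0 X Y : fmap shift (hzero P X Y) ≡ O.
Proof. exact: fmap0 (pt_shift_additive pT) _ _. Qed.

Section Triangle.
Variables (X Y Z : T) (f : hom X Y) (g : hom Y Z) (h : hom Z (shift X)).
Hypothesis fgh : distinguished f g h.

Lemma dist_gf : g ∘ f ≡ O.
Proof.
have [Z0 zZ0] := pt_zero pT.
have [|c [<- _]] := pt_map pT (a := idm X) (b := f) (pt_id pT X zZ0) fgh => //.
by rewrite comph0.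
Qed.

(** Compare with the rotated triangle of the identity of [W]. *)
Lemma dist_lift W (u : hom W Y) : g ∘ u ≡ O -> exists v, f ∘ v ≡ u.
Proof.
move=> gu; have [Z0 zZ0] := pt_zero pT.
have [|c [_]] := pt_map pT (a := u) (b := hzero P Z0 Z)
  (pt_rot pT (pt_id pT W zZ0)) (pt_rot pT fgh).
  by rewrite gu comp0h.
have [v vE] := shift_full c; rewrite -vE comphN compNh fmap_id comp_idr => uv.
exists v; apply: shift_faithful; rewrite fmap_comp.
by rewrite -(hoppK P (_ ∘ _)) -uv hoppK.
Qed.

Lemma dist_extend W (u : hom Y W) : u ∘ f ≡ O -> exists v, v ∘ g ≡ u.
Proof.
move=> uf; have [Z0 zZ0] := pt_zero pT.
have [|c [cE _]] := pt_map pT (a := hzero P (shift X) Z0) (b := fmap shift u)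
  (pt_rot pT (pt_rot pT (pt_rot pT fgh)))
  (pt_rot pT (pt_rot pT (pt_id pT W zZ0))).
  by rewrite comph0 comphN -fmap_comp uf shift0 hopp0.
have [v vE] := shift_full c; exists v; apply: shift_faithful.
move: cE; rewrite -vE comphN compNh fmap_id comp_idl -fmap_comp => cE.
by rewrite -(hoppK P (fmap shift _)) cE hoppK.
Qed.
End Triangle.

Section Exactness.
Variables (X Y Z : T) (f : hom X Y) (g : hom Y Z) (h : hom Z (shift X)).
Hypothesis fgh : distinguished f g h.

Lemma dist_fh : fmap shift f ∘ h ≡ O.
Proof.
have := dist_gf (pt_rot pT (pt_rot pT fgh)); rewrite compNh => fh.
by rewrite -(hoppK P (_ ∘ _)) fh hopp0.
Qed.

Lemma dist_lift_g W (u : hom W Z) : h ∘ u ≡ O -> exists v, g ∘ v ≡ u.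
Proof. exact: (dist_lift (pt_rot pT fgh)). Qed.

Lemma dist_lift_h W (u : hom W (shift X)) :
  fmap shift f ∘ u ≡ O -> exists v, h ∘ v ≡ u.
Proof.
move=> fu; apply: (dist_lift (pt_rot pT (pt_rot pT fgh))).
by rewrite compNh fu hopp0.
Qed.

Lemma dist_extend_h W (u : hom Z W) : u ∘ g ≡ O -> exists v, v ∘ h ≡ u.
Proof. exact: (dist_extend (pt_rot pT fgh)). Qed.
End Exactness.

(** The five lemma, for the exact sequences obtained by applying [Hom(W, -)].  These
    sequences have five terms [X], [Y], [Z], [X[1] ], [Y[1] ], whence the hypotheses on
    the shifts of [a] and [b]. *)
Lemma five_hbij W (X Y Z X' Y' Z' : T)
    (f : hom X Y) (g : hom Y Z) (h : hom Z (shift X))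
    (f' : hom X' Y') (g' : hom Y' Z') (h' : hom Z' (shift X'))
    (a : hom X X') (b : hom Y Y') (c : hom Z Z') :
  distinguished f g h -> distinguished f' g' h' ->
  b ∘ f ≡ f' ∘ a -> c ∘ g ≡ g' ∘ b -> fmap shift a ∘ h ≡ h' ∘ c ->
  hbij W a -> hbij W b -> hbij W (fmap shift a) -> hbij W (fmap shift b) ->
  hbij W c.
Proof.
move=> fgh fgh' bf cg ah [_ a_epi] [b_mono b_epi] [sa_mono sa_epi] [sb_mono _].
apply: hbij_of_kernel P _ _ _ _ _ _ => [u cu|w].
  have hu : h ∘ u ≡ O.
    by apply: sa_mono; rewrite comp_assoc ah -comp_assoc cu !comph0.
  have [v vE] := dist_lift_g fgh hu.
  have [|w wE] := dist_lift fgh' (u := b ∘ v).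
    by rewrite comp_assoc -cg -comp_assoc vE cu.
  have [w' w'E] := a_epi w.
  have fw' : f ∘ w' ≡ v.
    by apply: b_mono; rewrite comp_assoc bf -comp_assoc w'E.
  by rewrite -vE -fw' comp_assoc (dist_gf fgh) comp0h.
have [t tE] := sa_epi (h' ∘ w).
have [|v vE] := dist_lift_h fgh (u := t).
  apply: sb_mono; rewrite comph0 comp_assoc -fmap_comp bf fmap_comp.
  by rewrite -comp_assoc tE comp_assoc (dist_fh fgh') comp0h.
have [|y yE] := dist_lift_g fgh' (u := w ⊕ ⊖ (c ∘ v)).
  by rewrite comp_haddr comphN comp_assoc -ah -comp_assoc vE tE haddNr.
have [x xE] := b_epi y; exists (g ∘ x ⊕ v).
by rewrite comp_haddr comp_assoc cg -comp_assoc xE yE haddNK.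
Qed.

Lemma five_iso (X Y Z X' Y' Z' : T)
    (f : hom X Y) (g : hom Y Z) (h : hom Z (shift X))
    (f' : hom X' Y') (g' : hom Y' Z') (h' : hom Z' (shift X'))
    (a : hom X X') (b : hom Y Y') (c : hom Z Z') :
  distinguished f g h -> distinguished f' g' h' ->
  b ∘ f ≡ f' ∘ a -> c ∘ g ≡ g' ∘ b -> fmap shift a ∘ h ≡ h' ∘ c ->
  is_iso a -> is_iso b -> is_iso c.
Proof.
move=> fgh fgh' bf cg ah ai bi.
by apply: hbij_iso; apply: five_hbij fgh fgh' bf cg ah _ _ _ _;
  apply: iso_hbij => //; apply: fmap_iso.
Qed.

Lemma dist_iso_cone (X Y Z X' Y' Z' : T)
    (f : hom X Y) (g : hom Y Z) (h : hom Z (shift X))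
    (f' : hom X' Y') (g' : hom Y' Z') (h' : hom Z' (shift X'))
    (a : hom X X') (b : hom Y Y') :
  distinguished f g h -> distinguished f' g' h' -> b ∘ f ≡ f' ∘ a ->
  is_iso a -> is_iso b ->
  exists2 c : hom Z Z', is_iso c & c ∘ g ≡ g' ∘ b /\ fmap shift a ∘ h ≡ h' ∘ c.
Proof.
move=> fgh fgh' bf ai bi; have [c [cg ah]] := pt_map pT fgh fgh' bf.
by exists c => //; apply: five_iso fgh fgh' bf cg ah ai bi.
Qed.

Lemma cone_uniq (X Y Z Z' : T) (f : hom X Y) (g : hom Y Z) (h : hom Z (shift X))
    (g' : hom Y Z') (h' : hom Z' (shift X)) :
  distinguished f g h -> distinguished f g' h' ->
  exists2 c : hom Z Z', is_iso c & c ∘ g ≡ g' /\ h' ∘ c ≡ h.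
Proof.
move=> fgh fgh'.
have [|c ci [cg ch]] := dist_iso_cone fgh fgh' _ (iso_id X) (iso_id Y).
  by rewrite comp_idl comp_idr.
exists c => //; rewrite cg comp_idr; split=> //.
by rewrite -ch fmap_id comp_idl.
Qed.

(** Rotating three times gives back the triangle up to a shift, so the converse
    of the rotation axiom follows from the existence of cones. *)
Lemma rot_converse :
  (forall (X Y Z X' Y' Z' : T)
      (f : hom X Y) (g : hom Y Z) (h : hom Z (shift X))
      (f' : hom X' Y') (g' : hom Y' Z') (h' : hom Z' (shift X')),
    tri_iso f g h f' g' h' -> distinguished f g h -> distinguished f' g' h') ->
  (forall (X Y : T) (f : hom X Y),
    exists (Z : T) (g : hom Y Z) (h : hom Z (shift X)), distinguished f g h) ->
  forall (X Y Z : T) (f : hom X Y) (g : hom Y Z) (h : hom Z (shift X)),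
    distinguished g h (⊖ fmap shift f) -> distinguished f g h.
Proof.
move=> dist_iso dist_cone X Y Z f g h ghf.
have [Z' [g' [h' fgh']]] := dist_cone _ _ f.
have d := pt_rot pT (pt_rot pT ghf).
have d' := pt_rot pT (pt_rot pT (pt_rot pT fgh')).
have [c ci [cg hc]] := cone_uniq d' d.
have [c0 c0E] := shift_full c.
have c0i : is_iso c0.
  by apply: (ff_iso (pt_shift_ff pT)); apply: iso_eqh ci; symmetry.
apply: dist_iso _ fgh'; exists (idm X), (idm Y), c0; split.
  by split=> //; apply: iso_id.
split; first by rewrite comp_idl comp_idr.
  rewrite comp_idr; apply: shift_faithful; rewrite fmap_comp c0E.
  by rewrite -(hoppK P (c ∘ _)) -comphN cg hoppK.
rewrite fmap_id comp_idl; apply: shift_faithful; rewrite fmap_comp c0E.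
by symmetry; rewrite -(hoppK P (_ ∘ _)) -compNh hc hoppK.
Qed.
End Pretriangulated.

(** * Pulling back a triangulated structure along a fully faithful functor *)

Lemma dist_eqh (T : triData) (P : preadditive T) (X Y Z : T)
    (f f' : hom X Y) (g g' : hom Y Z) (h h' : hom Z (shift X)) :
  triangulated P -> f ≡ f' -> g ≡ g' -> h ≡ h' ->
  distinguished f g h -> distinguished f' g' h'.
Proof.
move=> tT ff gg hh; apply: (tri_dist_iso tT); exists (idm X), (idm Y), (idm Z).
split; first by split; apply: iso_id.
by split; rewrite ?fmap_id !comp_idl !comp_idr.
Qed.

Section PullPreadditive.
Variables (C D : category) (P : preadditive D) (F : functor C D).
Hypothesis ffF : fully_faithful F.

Definition ff_lift (X Y : C) (h : hom (F X) (F Y)) : hom X Y :=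
  sval (cid ((ffF X Y).2 h)).

Lemma ff_liftE X Y (h : hom (F X) (F Y)) : fmap F (ff_lift h) ≡ h.
Proof. exact: svalP (cid ((ffF X Y).2 h)). Qed.

Lemma ff_inj X Y (f g : hom X Y) : fmap F f ≡ fmap F g -> f ≡ g.
Proof. exact: (ffF X Y).1. Qed.

Program Definition pull_preadditive : preadditive C :=
  @Preadditive C (fun X Y f g => ff_lift (hadd P (fmap F f) (fmap F g)))
    (fun X Y => ff_lift (hzero P _ _)) (fun X Y f => ff_lift (hopp P (fmap F f)))
    _ _ _ _ _ _ _ _.
Next Obligation. by move=> X Y f f' g g' ff gg; apply: ff_inj; rewrite !ff_liftE ff gg. Qed.
Next Obligation. by move=> X Y f f' ff; apply: ff_inj; rewrite !ff_liftE ff. Qed.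
Next Obligation. by move=> X Y f g h; apply: ff_inj; rewrite !ff_liftE haddA. Qed.
Next Obligation. by move=> X Y f g; apply: ff_inj; rewrite !ff_liftE haddC. Qed.
Next Obligation. by move=> X Y f; apply: ff_inj; rewrite !ff_liftE hadd0. Qed.
Next Obligation. by move=> X Y f; apply: ff_inj; rewrite !ff_liftE haddN. Qed.
Next Obligation.
move=> X Y Z g g' f; apply: ff_inj.
by rewrite !(fmap_comp, ff_liftE) comp_haddl.
Qed.
Next Obligation.
move=> X Y Z g f f'; apply: ff_inj.
by rewrite !(fmap_comp, ff_liftE) comp_haddr.
Qed.

Lemma pull_additive : additive_functor pull_preadditive P F.
Proof. by move=> X Y f g; rewrite ff_liftE. Qed.
End PullPreadditive.

(** When [L] is fully faithful and reflects distinguished triangles, the axioms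
    for [U] only require that the image of [L] be closed, up to isomorphism, under the
    constructions whose existence they assert. *)
Section PullTriangulated.
Variables (T U : triData) (P : preadditive T) (tT : triangulated P).
Variables (L : functor U T) (ffL : fully_faithful L).
Variables (psi : nat_trans (functor_comp L shift) (functor_comp shift L)).
Hypothesis psiI : is_nat_iso psi.
Hypothesis distL : forall (X Y Z : U)
  (f : hom X Y) (g : hom Y Z) (h : hom Z (shift X)),
  distinguished f g h <-> distinguished (fmap L f) (fmap L g) (psi X ∘ fmap L h).
Hypothesis zeroL : exists Z : U, is_zero (L Z).
Hypothesis sumL : forall X Y : U, exists S : U, is_biproduct P (L X) (L Y) (L S).
Hypothesis unshiftL : forall X : U, exists Y : U, isomorphic (shift (L Y)) (L X).
Hypothesis coneL : forall (X Y : U) (f : hom X Y), exists (Z : U)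
  (g : hom (L Y) (L Z)) (h : hom (L Z) (shift (L X))),
  distinguished (fmap L f) g h.

Local Notation Q := (pull_preadditive P ffL).
Let LD : additive_functor Q P L := pull_additive P ffL.
Local Notation lift := (ff_lift ffL).
Let liftE := ff_liftE ffL.
Let injL := ff_inj ffL.
Let psiN X Y (f : hom X Y) :
  psi Y ∘ fmap L (fmap shift f) ≡ fmap shift (fmap L f) ∘ psi X := nt_nat psi f.

Let pshift_additive : additive_functor Q Q (@shift U).
Proof.
move=> X Y f g; apply: injL; apply: (iso_monic (psiI Y)).
rewrite psiN !LD comp_haddr !psiN (tri_shift_additive tT).
by rewrite comp_haddl.
Qed.

Let pshift_equiv : is_equivalence (@shift U).
Proof.
have [ffS _] := equiv_ff (tri_shift_equiv tT).
apply: ff_equiv => [X Y|X].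
  split=> [f g fg|h].
    apply: injL; apply: (ff_inj ffS); apply: (iso_epic (psiI X)).
    by rewrite -[_ ∘ psi X]psiN -[_ ∘ psi X]psiN fg.
  have [t [tpsi psit]] := psiI X.
  exists (lift (ff_lift ffS (psi Y ∘ (fmap L h ∘ t)))); apply: injL.
  apply: (iso_monic (psiI Y)); rewrite psiN liftE ff_liftE -!comp_assoc.
  by rewrite tpsi comp_idr.
have [Y [i iI]] := unshiftL X; exists Y, (lift (i ∘ psi Y)).
by apply: (ff_iso ffL); apply: iso_eqh (iso_comp iI (psiI Y)); rewrite liftE.
Qed.

Let padditive : additive_category Q.
Proof.
split.
  have [Z /(is_zeroP P) Z0] := zeroL; exists Z; apply/(is_zeroP Q); apply: injL.
  by rewrite fmap_id Z0 (fmap0 LD).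
move=> X Y; have [S [i [j [p [q [pi qj pj qi ipjq]]]]]] := sumL X Y.
exists S, (lift i), (lift j), (lift p), (lift q).
by split; apply: injL; rewrite ?LD ?(fmap0 LD) ?fmap_comp ?fmap_id !liftE.
Qed.

Let pdist_iso (X Y Z X' Y' Z' : U)
    (f : hom X Y) (g : hom Y Z) (h : hom Z (shift X))
    (f' : hom X' Y') (g' : hom Y' Z') (h' : hom Z' (shift X')) :
  tri_iso f g h f' g' h' -> distinguished f g h -> distinguished f' g' h'.
Proof.
move=> [a [b [c [[ai bi ci] [bf cg ah]]]]] /distL fgh; apply/distL.
apply: (tri_dist_iso tT) fgh; exists (fmap L a), (fmap L b), (fmap L c).
split; first by split; apply: fmap_iso.
split; rewrite -?fmap_comp ?bf ?cg //.
by rewrite comp_assoc -psiN -!comp_assoc -!fmap_comp ah.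
Qed.

Let pdist_rot (X Y Z : U) (f : hom X Y) (g : hom Y Z) (h : hom Z (shift X)) :
  distinguished f g h <-> distinguished g h (hopp Q (fmap shift f)).
Proof.
have E : psi Y ∘ fmap L (hopp Q (fmap shift f)) ≡
    hopp P (fmap shift (fmap L f)) ∘ psi X.
  by rewrite (fmapN LD) comphN psiN compNh.
have [t [tpsi psit]] := psiI X.
split=> [/distL/(tri_dist_rot tT) d|/distL d]; apply/distL.
  apply: (tri_dist_iso tT) d; exists (idm _), (idm _), t; split.
    by split; [apply: iso_id|apply: iso_id|exists (psi X)].
  split; first by rewrite comp_idl comp_idr.
    by rewrite comp_assoc tpsi comp_idl comp_idr.
  by rewrite fmap_id comp_idl E -comp_assoc psit comp_idr.
apply/(tri_dist_rot tT).
apply: (tri_dist_iso tT) d; exists (idm _), (idm _), (psi X); split.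
  by split; [apply: iso_id|apply: iso_id|apply: psiI].
by split; rewrite ?fmap_id ?E ?comp_idl ?comp_idr.
Qed.

Lemma pull_triangulated : triangulated Q.
Proof.
split; [exact: padditive | exact: pshift_additive | exact: pshift_equiv
  | exact: pdist_iso | | | exact: pdist_rot | |].
- move=> X Z Z0; apply/distL.
  apply: dist_eqh tT _ _ _ (tri_dist_id tT (L X) (fmap_zero LD Z0)).
  + by rewrite fmap_id.
  + by rewrite (fmap0 LD).
  + by rewrite (fmap0 LD) comph0.
- move=> X Y f; have [Z [g [h fgh]]] := coneL f.
  have [t [tpsi psit]] := psiI X.
  exists Z, (lift g), (lift (t ∘ h)); apply/distL.
  by apply: dist_eqh tT _ _ _ fgh; rewrite ?liftE // comp_assoc psit comp_idl.
- move=> X Y Z X' Y' Z' f g h f' g' h' a b /distL d /distL d' bf.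
  have [|c [cg ah]] := tri_dist_map tT (a := fmap L a) (b := fmap L b) d d'.
    by rewrite -!fmap_comp bf.
  exists (lift c); split; apply: injL; rewrite ?fmap_comp liftE //.
  apply: (iso_monic (psiI X')); rewrite comp_assoc psiN -comp_assoc ah.
  by rewrite comp_assoc.
move=> X Y Z X' Y' Z' f g i j k l m n /distL d1 /distL d2 /distL d3.
have d2' : distinguished (fmap L g ∘ fmap L f) (fmap L k) (psi X ∘ fmap L l).
  exact: dist_eqh tT (fmap_comp L _ _) (eqh_refl _) (eqh_refl _) d2.
have [u [v [d4 [ui lu vk nv]]]] := tri_dist_octa tT d1 d2' d3.
exists (lift u), (lift v); split.
  apply/distL; apply: dist_eqh tT _ _ _ d4; rewrite ?liftE //.
  by rewrite fmap_comp !comp_assoc psiN.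
split; apply: injL; rewrite ?fmap_comp ?liftE //.
  apply: (iso_monic (psiI X)); by rewrite comp_assoc lu.
apply: (iso_monic (psiI Y)); by rewrite comp_assoc nv !comp_assoc psiN.
Qed.

Lemma pull_exact : exact_functor Q P L.
Proof. by split; [exact: LD | exists psi; split=> // *; apply/distL]. Qed.
End PullTriangulated.

(** * Full triangulated subcategories *)

Lemma full_incl_ff (C : category) (Q : C -> Prop) : fully_faithful (full_incl Q).
Proof. by move=> X Y; split=> // h; exists h. Qed.

Section FullSubTriangulated.
Variables (T : triData) (P : preadditive T) (tT : triangulated P).
Variables (Q : T -> Prop) (shiftQ : forall X : T, Q X -> Q (shift X)).
Hypothesis zeroQ : exists2 Z : T, Q Z & is_zero Z.
Hypothesis sumQ : forall X Y : T, Q X -> Q Y ->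
  exists2 S : T, Q S & is_biproduct P X Y S.
Hypothesis unshiftQ : forall X : T, Q X ->
  exists2 Y : T, Q Y & isomorphic (shift Y) X.
Hypothesis coneQ : forall (X Y : T) (f : hom X Y), Q X -> Q Y ->
  exists (Z : T) (g : hom Y Z) (h : hom Z (shift X)),
    Q Z /\ distinguished f g h.

Local Notation U := (full_sub_tri shiftQ).
Local Notation I := (full_incl Q : functor U T).

Let psi_nat (X Y : U) (f : hom X Y) :
  idm (shift (sval Y)) ∘ fmap shift (fmap I f)
    ≡ fmap shift (fmap I f) ∘ idm (shift (sval X)).
Proof. by rewrite comp_idl comp_idr. Qed.

Let psi : nat_trans (functor_comp I shift) (functor_comp shift I) :=
  @NatTrans U T (functor_comp I shift) (functor_comp shift I)
    (fun X : U => idm (shift (sval X))) psi_nat.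

Lemma full_sub_triangulated :
  triangulated (pull_preadditive P (@full_incl_ff T Q) : preadditive U)
  /\ exact_functor (pull_preadditive P (@full_incl_ff T Q) : preadditive U) P I.
Proof.
have psiI : is_nat_iso psi by move=> X; apply: iso_id.
have distI (X Y Z : U) (f : hom X Y) (g : hom Y Z) (h : hom Z (shift X)) :
    distinguished f g h <-> distinguished (fmap I f) (fmap I g) (psi X ∘ fmap I h).
  split; first by apply: dist_eqh tT _ _ _; rewrite /= ?comp_idl.
  by apply: (@dist_eqh T P (sval X) (sval Y) (sval Z)) => //; rewrite /= comp_idl.
split; last exact: (@pull_exact T U P I (@full_incl_ff T Q) psi psiI distI).
apply: (@pull_triangulated T U P tT I (@full_incl_ff T Q) psi psiI distI).
- by have [Z QZ Z0] := zeroQ; exists (exist _ Z QZ).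
- move=> [X QX] [Y QY]; have [S QS XYS] := sumQ QX QY.
  by exists (exist _ S QS).
- move=> [X QX]; have [Y QY YX] := unshiftQ QX.
  by exists (exist _ Y QY).
move=> [X QX] [Y QY] f; have [Z [g [h [QZ fgh]]]] := coneQ f QX QY.
by exists (exist _ Z QZ), g, h.
Qed.
End FullSubTriangulated.

(** * The universal property of a localization *)

Section LocExtend.
Variables (C D : category) (W : forall X Y : C, hom X Y -> Prop).
Variables (F : functor C D).
Hypothesis FW : forall (X Y : C) (s : hom X Y), W s -> is_iso (fmap F s).

Let inv X Y (s : hom X Y) (Ws : W s) : hom (F Y) (F X) := sval (cid (FW Ws)).

Let invl X Y (s : hom X Y) (Ws : W s) : inv Ws ∘ fmap F s ≡ idm _.
Proof. exact: (svalP (cid (FW Ws))).1. Qed.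

Let invr X Y (s : hom X Y) (Ws : W s) : fmap F s ∘ inv Ws ≡ idm _.
Proof. exact: (svalP (cid (FW Ws))).2. Qed.

Fixpoint loc_map X Y (p : zpath W X Y) : hom (F X) (F Y) :=
  match p in zpath _ X Y return hom (F X) (F Y) with
  | pnil X => idm (F X)
  | pfwd _ _ _ f p' => loc_map p' ∘ fmap F f
  | pbwd _ _ _ _ Ws p' => loc_map p' ∘ inv Ws
  end.

Lemma loc_map_eq X Y (p q : zpath W X Y) : zpath_eq p q -> loc_map p ≡ loc_map q.
Proof.
elim=> {X Y p q} /=.
- by [].
- by move=> X Y p q _ ->.
- by move=> X Y p q r _ -> _ ->.
- by move=> X Y Z f g p q -> _ ->.
- by move=> X Y Z s Ws p q _ ->.
- by move=> X Y p; rewrite fmap_id comp_idr.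
- by move=> X Y Z V f g p; rewrite fmap_comp comp_assoc.
- by move=> X Y Z s Ws p; rewrite -comp_assoc invl comp_idr.
by move=> X Y Z s Ws p; rewrite -comp_assoc invr comp_idr.
Qed.

Lemma loc_map_cat X Y Z (p : zpath W X Y) (q : zpath W Y Z) :
  loc_map (zcat p q) ≡ loc_map q ∘ loc_map p.
Proof.
elim: p q => /= [X' q|X' Y' Z' f p IH q|X' Y' Z' s Ws p IH q].
- by rewrite comp_idr.
- by rewrite IH comp_assoc.
by rewrite IH comp_assoc.
Qed.

Program Definition loc_extend : functor (localization W) D :=
  @Functor (localization W) D F loc_map _ _ _.
Next Obligation. exact: loc_map_eq. Qed.
Next Obligation. by move=> X; apply: eqh_refl. Qed.
Next Obligation. by move=> X Y Z g f; apply: loc_map_cat. Qed.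
End LocExtend.

Section LocPaths.
Variables (C : category) (W : forall X Y : C, hom X Y -> Prop).
Local Notation D := (localization W).
Local Notation Q := (loc_functor W).

Definition loc_inv X Y (s : hom X Y) (Ws : W s) : hom (Y : D) (X : D) :=
  pbwd Ws (pnil _ X).

Lemma loc_invl X Y (s : hom X Y) (Ws : W s) : loc_inv Ws ∘ fmap Q s ≡ idm (X : D).
Proof. exact: peq_fwdbwd. Qed.

Lemma loc_invr X Y (s : hom X Y) (Ws : W s) : fmap Q s ∘ loc_inv Ws ≡ idm (Y : D).
Proof. exact: peq_bwdfwd. Qed.

Lemma loc_iso X Y (s : hom X Y) : W s -> is_iso (fmap Q s).
Proof. by move=> Ws; exists (loc_inv Ws); split; [apply: loc_invl | apply: loc_invr]. Qed.

(** Every morphism of the localization is a composite of morphisms of [C] and of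
    inverses, and a naturality square can be inverted. *)
Lemma loc_natural (E : category) (F G : functor D E)
    (t : forall X : C, hom (F X) (G X)) :
  (forall (X Y : C) (f : hom X Y),
     t Y ∘ fmap F (fmap Q f) ≡ fmap G (fmap Q f) ∘ t X) ->
  forall (X Y : D) (d : hom X Y), t Y ∘ fmap F d ≡ fmap G d ∘ t X.
Proof.
move=> tQ X Y; elim=> {X Y} [X|X Y Z f p IH|X Y Z s Ws p IH].
- by rewrite -[pnil _ X]/(idm (X : D)) !fmap_id comp_idl comp_idr.
- rewrite -[pfwd f p]/((p : hom (Y : D) Z) ∘ fmap Q f) !fmap_comp comp_assoc IH.
  by rewrite -!comp_assoc tQ.
rewrite -[pbwd Ws p]/((p : hom (Y : D) Z) ∘ loc_inv Ws) !fmap_comp comp_assoc IH.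
rewrite -!comp_assoc; apply: comp_eqh => //.
apply: (iso_monic (fmap_iso G (loc_iso Ws))).
rewrite !comp_assoc -tQ -fmap_comp loc_invr fmap_id comp_idl -comp_assoc.
by rewrite -fmap_comp loc_invr fmap_id comp_idr.
Qed.
End LocPaths.

(** * Recollements from resolutions *)

Lemma biproduct_iso (C : category) (P : preadditive C) (X Y S S' : C) :
  isomorphic S S' -> is_biproduct P X Y S -> is_biproduct P X Y S'.
Proof.
move=> [e [e' [e'e ee']]] [i [j [p [q [pi qj pj qi ipjq]]]]].
exists (e ∘ i), (e ∘ j), (p ∘ e'), (q ∘ e').
split; rewrite -?comp_assoc ?(comp_assoc e') ?e'e ?comp_idl //.
by rewrite (comp_assoc i) (comp_assoc j) -comp_haddr -comp_haddl ipjq comp_idl ee'.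
Qed.

(** The acyclic objects are an abstract class [N], the quasi-isomorphisms the class [W]
    of morphisms whose cone lies in [N]. *)
Section Bousfield.
Variables (K : triData) (P : preadditive K) (tK : triangulated P).
Variable N : K -> Prop.
Hypothesis shiftN : forall X : K, N X -> N (shift X).
Hypothesis unshiftN : forall X : K, N (shift X) -> N X.
Variable W : forall X Y : K, hom X Y -> Prop.
Hypothesis shiftW : forall (X Y : K) (s : hom X Y), W s -> W (fmap shift s).
Hypothesis coneW : forall (X Y Z : K) (f : hom X Y) (g : hom Y Z)
  (h : hom Z (shift X)), distinguished f g h -> (W f <-> N Z).
Implicit Types X Y Z S : K.

Let pK := triangulated_pre tK.
Let shift_ff : fully_faithful (@shift K) := (equiv_ff (tri_shift_equiv tK)).1.
Let shift_es : ess_surj (@shift K) := (equiv_ff (tri_shift_equiv tK)).2.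

Lemma dist_of_zero Z X Y (i : hom X Y) :
  is_zero Z -> is_iso i -> distinguished (hzero P Z X) i (hzero P Y (shift Z)).
Proof.
move=> Z0 iI; have sZ0 := fmap_zero (tri_shift_additive tK) Z0.
apply/(tri_dist_rot tK); apply: (tri_dist_iso tK) (tri_dist_id tK X sZ0).
exists (idm X), i, (idm _); split; first by split=> //; apply: iso_id.
split; rewrite ?comp_idl //; first exact: zero_target sZ0.
apply: zero_source sZ0.
Qed.

Lemma N_iso X Y : isomorphic X Y -> N X -> N Y.
Proof.
move=> [i iI] NX; have [Z Z0] := pt_zero pK.
apply/(coneW (dist_of_zero Z0 iI)).
exact/(coneW (dist_of_zero Z0 (iso_id X))).
Qed.

(** For dg modules these are the K-projective ones. *)
Definition colocal S : Prop := forall M, N M -> forall f : hom S M, f ≡ hzero P S M.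

Lemma colocal_shift S : colocal S -> colocal (shift S).
Proof.
move=> cS M NM f; have [M' [j [j' [j'j jj']]]] := shift_es M.
have NM' : N M' by apply: unshiftN; apply: N_iso NM; exists j', j.
have [g gE] := (shift_ff _ _).2 (j' ∘ f).
rewrite -(comp_idl f) -jj' -comp_assoc -gE (cS _ NM' g).
by rewrite (fmap0 (tri_shift_additive tK)) comph0.
Qed.

Lemma colocal_unshift S S' : isomorphic (shift S') S -> colocal S -> colocal S'.
Proof.
move=> [i [i' [i'i _]]] cS M NM f; apply: (ff_inj shift_ff).
rewrite (fmap0 (tri_shift_additive tK)) -(comp_idr (fmap _ _)) -i'i comp_assoc.
by rewrite (cS _ (shiftN NM) (_ ∘ i')) comp0h.
Qed.

Lemma colocal_cone X Y Z (f : hom X Y) (g : hom Y Z) (h : hom Z (shift X)) :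
  distinguished f g h -> colocal X -> colocal Y -> colocal Z.
Proof.
move=> fgh cX cY M NM u; have [|v vE] := dist_extend_h pK fgh (u := u).
  exact: cY.
by rewrite -vE (colocal_shift cX NM v) comp0h.
Qed.

Lemma colocal_sum X Y S : is_biproduct P X Y S -> colocal X -> colocal Y -> colocal S.
Proof.
move=> [i [j [p [q [_ _ _ _ ipjq]]]]] cX cY M NM f.
rewrite -(comp_idr f) -ipjq comp_haddr !comp_assoc.
by rewrite (cX _ NM (f ∘ i)) (cY _ NM (f ∘ j)) !comp0h hadd0.
Qed.

(** The cone of [w] lies in [N], hence is invisible to [S]. *)
Lemma W_hbij S X Y (w : hom X Y) : colocal S -> W w -> hbij S w.
Proof.
move=> cS Ww; have [Z [g [h wgh]]] := tri_dist_cone tK w.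
have NZ : N Z by apply/(coneW wgh).
apply: hbij_of_kernel P _ _ _ _ _ _ => [u wu|u]; last first.
  by apply: dist_lift pK _ _ _ _ _ _ wgh _ _ _; apply: cS.
have [|v vE] := dist_lift_h pK wgh (u := fmap shift u).
  by rewrite -fmap_comp wu (fmap0 (tri_shift_additive tK)).
apply: (ff_inj shift_ff); rewrite -vE (colocal_shift cS NZ v).
by rewrite comph0 (fmap0 (tri_shift_additive tK)).
Qed.

(** A colocal object is determined by its image in the localization; every
    comparison of resolutions below is inverted in this way. *)
Lemma colocal_iso S S' X Y (u : hom S S') (w : hom S X) (w' : hom S' Y)
    (v : hom X Y) : colocal S -> colocal S' -> W w -> W w' -> W v ->
  w' ∘ u ≡ v ∘ w -> is_iso u.
Proof.
move=> cS cS' Ww Ww' Wv E.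
have H V : colocal V -> hbij V u.
  move=> cV; have [w'inj _] := W_hbij cV Ww'.
  have [winj wsurj] := W_hbij cV Ww; have [vinj vsurj] := W_hbij cV Wv.
  split=> [a b ab|b].
    by apply: winj; apply: vinj; rewrite !comp_assoc -E -!comp_assoc ab.
  have [x xE] := vsurj (w' ∘ b); have [a aE] := wsurj x.
  exists a; apply: w'inj.
  by rewrite comp_assoc E -comp_assoc aE xE.
by apply: hbij_iso; apply: H.
Qed.

Section Resolutions.
Variable Pr : K -> Prop.
Hypothesis shiftPr : forall X : K, Pr X -> Pr (shift X).
Hypothesis zeroPr : exists2 Z : K, Pr Z & is_zero Z.
Hypothesis sumPr : forall X Y : K, Pr X -> Pr Y ->
  exists2 S : K, Pr S & is_biproduct P X Y S.
Hypothesis unshiftPr : forall X : K, Pr X ->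
  exists2 Y : K, Pr Y & isomorphic (shift Y) X.
Hypothesis conePr : forall (X Y : K) (f : hom X Y), Pr X -> Pr Y ->
  exists (Z : K) (g : hom Y Z) (h : hom Z (shift X)),
    Pr Z /\ distinguished f g h.

(** Only the objects of [N] in [Pr] are tested; the other objects of [N] may have
    nonzero morphisms to a local object. *)
Definition local (R : K) : Prop :=
  forall X, Pr X -> N X -> forall f : hom X R, f ≡ hzero P X R.

Hypothesis resolution : forall M : K,
  exists (S : K) (p : hom S M), [/\ Pr S, colocal S & W p].
Hypothesis localization_of : forall X : K, Pr X ->
  exists (R : K) (r : hom X R), [/\ Pr R, local R & W r].

Local Notation T := (full_sub_tri shiftPr).
Local Notation D := (localization W).
Local Notation DT := (localization_tri shiftW).
Local Notation Q := (loc_functor W).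

Let res M : K := sval (cid (resolution M)).
Let resp M : hom (res M) M := sval (cid (svalP (cid (resolution M)))).
Let resP M : [/\ Pr (res M), colocal (res M) & W (resp M)] :=
  svalP (cid (svalP (cid (resolution M)))).
Let resPr M : Pr (res M). Proof. by have [] := resP M. Qed.
Let resC M : colocal (res M). Proof. by have [] := resP M. Qed.
Let resW M : W (resp M). Proof. by have [] := resP M. Qed.

Let N_of_res_zero M : is_zero (res M) -> N M.
Proof.
move=> S0; rewrite -(coneW (f := resp M) (g := idm M) (h := hzero P _ _)) //.
apply: dist_eqh tK _ _ _ (dist_of_zero S0 (iso_id M)) => //.
exact: zero_source S0.
Qed.

Let res_zero M : N M -> is_zero (res M).
Proof.
move=> NM; apply/(is_zeroP P); apply: (W_hbij (@resC M) (resW M)).1.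
by rewrite (resC NM (_ ∘ idm _)) (resC NM (_ ∘ _)).
Qed.

(** Since resolutions exist, [N] is the right orthogonal of the colocal
    objects, and this gives all closure properties of [N]. *)
Lemma N_of_colocal M : (forall S, colocal S -> forall f : hom S M, f ≡ hzero P S M) -> N M.
Proof.
move=> H; apply: N_of_res_zero; apply/(is_zeroP P).
apply: (W_hbij (@resC M) (resW M)).1.
by rewrite (H _ (@resC M) (_ ∘ idm _)) comph0.
Qed.

Lemma N_zero Z : is_zero Z -> N Z.
Proof. by move=> Z0; apply: N_of_colocal => S _ f; apply: zero_target Z0. Qed.

Lemma N_sum X Y S : is_biproduct P X Y S -> N X -> N Y -> N S.
Proof.
move=> [i [j [p [q [_ _ _ _ ipjq]]]]] NX NY; apply: N_of_colocal => V cV f.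
rewrite -(comp_idl f) -ipjq comp_haddl -!comp_assoc.
by rewrite (cV _ NX (p ∘ f)) (cV _ NY (q ∘ f)) !comph0 hadd0.
Qed.

Lemma N_cone X Y Z (f : hom X Y) (g : hom Y Z) (h : hom Z (shift X)) :
  distinguished f g h -> N X -> N Y -> N Z.
Proof.
move=> fgh NX NY; apply: N_of_colocal => V cV u.
have [|v vE] := dist_lift_g pK fgh (u := u).
  exact: (cV _ (shiftN NX)).
by rewrite -vE (cV _ NY v) comph0.
Qed.

(** ** The colocalization functor *)

Let res_lift X Y (f : hom X Y) : {k : hom (res X) (res Y) | resp Y ∘ k ≡ f ∘ resp X}.
Proof. by apply: cid; apply: (W_hbij (@resC X) (resW Y)).2. Qed.

Let res_inj X Y (k k' : hom (res X) (res Y)) : resp Y ∘ k ≡ resp Y ∘ k' -> k ≡ k'.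
Proof. exact: (W_hbij (@resC X) (resW Y)).1. Qed.

Let rmap X Y (f : hom X Y) : hom (res X) (res Y) := sval (res_lift f).
Let rmapE X Y (f : hom X Y) : resp Y ∘ rmap f ≡ f ∘ resp X := svalP (res_lift f).

Let rmap_eqh X Y (f g : hom X Y) : f ≡ g -> rmap f ≡ rmap g.
Proof. by move=> fg; apply: res_inj; rewrite !rmapE fg. Qed.

Let rmap_id X : rmap (idm X) ≡ idm (res X).
Proof. by apply: res_inj; rewrite rmapE comp_idl comp_idr. Qed.

Let rmap_comp X Y Z (g : hom Y Z) (f : hom X Y) : rmap (g ∘ f) ≡ rmap g ∘ rmap f.
Proof.
by apply: res_inj; rewrite rmapE comp_assoc rmapE -!comp_assoc rmapE.
Qed.

Let rmap_iso X Y (f : hom X Y) : W f -> is_iso (rmap f).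
Proof. by move=> Wf; apply: colocal_iso (rmapE f). Qed.

Let resT X : T := exist Pr (res X) (@resPr X).

Let resF : functor K T := @Functor K T resT rmap rmap_eqh rmap_id rmap_comp.

Let L : functor D T := @loc_extend K T W resF rmap_iso.

Let Lk (X Y : D) (d : hom X Y) : hom (res X) (res Y) := fmap L d.

Let Lk_eqh (X Y : D) (d d' : hom X Y) : d ≡ d' -> Lk d ≡ Lk d'.
Proof. exact: (@fmap_eqh D T L X Y). Qed.

Let Lk_comp (X Y Z : D) (d' : hom Y Z) (d : hom X Y) : Lk (d' ∘ d) ≡ Lk d' ∘ Lk d.
Proof. exact: (@fmap_comp D T L X Y Z). Qed.

Let LkQ X Y (f : hom X Y) : Lk (fmap Q f) ≡ rmap f.
Proof. exact: (comp_idl (rmap f)). Qed.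

Let Lk_iso (X Y : D) (d : hom X Y) : is_iso d -> is_iso (Lk d).
Proof. exact: (@fmap_iso D T L X Y). Qed.

Let IQ : functor T D := functor_comp Q (full_incl Pr).

(* [resp] is natural for the morphisms of the localization as well. *)
Let LkN (X Y : D) (d : hom X Y) :
  fmap Q (resp Y) ∘ fmap Q (Lk d) ≡ d ∘ fmap Q (resp X).
Proof.
apply: (@loc_natural K W D (functor_comp IQ L) (functor_id D)
  (fun X => fmap Q (resp X)) _ X Y d) => X0 Y0 f.
change (fmap Q (resp Y0) ∘ fmap Q (Lk (fmap Q f))
  ≡ fmap Q f ∘ fmap Q (resp X0)).
by rewrite LkQ -!fmap_comp rmapE.
Qed.

Let respQ X : is_iso (fmap Q (resp X)). Proof. exact: loc_iso (resW X). Qed.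

Let resp_iso S : colocal S -> is_iso (resp S).
Proof. by move=> cS; apply: hbij_iso; apply: W_hbij. Qed.

(** [resp S] is invertible when [S] is colocal, so that the morphisms out of [S] can be
    read off from the functor [L]. *)
Lemma colocal_faithful S M (f g : hom S M) :
  colocal S -> fmap Q f ≡ fmap Q g -> f ≡ g.
Proof.
move=> cS fg; apply: (iso_epic (resp_iso cS)).
by rewrite -!rmapE -!LkQ; apply: comp_eqh => //; apply: Lk_eqh.
Qed.

Lemma colocal_full S M (d : hom (S : D) (M : D)) :
  colocal S -> exists f : hom S M, fmap Q f ≡ d.
Proof.
move=> cS; have [i [ip pi]] := resp_iso cS.
exists (resp M ∘ Lk d ∘ i); apply: (iso_epic (respQ S)).
by rewrite -fmap_comp -comp_assoc ip comp_idr fmap_comp LkN.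
Qed.

Let L_ff : fully_faithful L.
Proof.
move=> X Y; split=> [d d' dd|k].
  apply: (iso_epic (respQ X)); rewrite -!LkN.
  by apply: comp_eqh => //; apply: fmap_eqh.
have [i [ip pi]] := respQ X.
exists (fmap Q (resp Y) ∘ (fmap Q k ∘ i)).
apply: (@colocal_faithful (res X) (res Y)) => //.
apply: (iso_monic (respQ Y)).
apply: eqh_trans (LkN _) _.
by rewrite -!comp_assoc ip comp_idr.
Qed.

Let psik X : {k : hom (res (shift X)) (shift (res X)) |
  fmap shift (resp X) ∘ k ≡ resp (shift X)}.
Proof. apply: cid; exact: (W_hbij (@resC _) (shiftW (resW X))).2. Qed.

(* The comparison of the resolution of [X[1] ] with the shifted resolution of [X]. *)
Let psi0 X : hom (res (shift X)) (shift (res X)) := sval (psik X).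
Let psiE X : fmap shift (resp X) ∘ psi0 X ≡ resp (shift X) := svalP (psik X).

Let shD : functor D D := loc_endofunctor shiftW.
Let shd (X Y : D) (d : hom X Y) : hom (shift X : D) (shift Y : D) := fmap shD d.

Let resp_shiftN (X Y : D) (d : hom X Y) :
  fmap Q (fmap shift (resp Y)) ∘ fmap Q (fmap shift (Lk d))
    ≡ shd d ∘ fmap Q (fmap shift (resp X)).
Proof.
apply: eqh_trans (eqh_sym (fmap_comp shD (fmap Q (resp Y)) (fmap Q (Lk d)))) _.
apply: eqh_trans _ (fmap_comp shD d (fmap Q (resp X))).
exact: (fmap_eqh shD (LkN d)).
Qed.

Let psiN (X Y : D) (d : hom X Y) :
  psi0 Y ∘ Lk (shd d) ≡ fmap shift (Lk d) ∘ psi0 X.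
Proof.
apply: colocal_faithful; first exact: resC.
apply: (iso_monic (loc_iso (shiftW (resW Y)))).
rewrite !(fmap_comp Q) !comp_assoc resp_shiftN -(fmap_comp Q) psiE.
apply: eqh_trans (LkN _) _; rewrite -comp_assoc; apply: comp_eqh => //.
by apply: eqh_trans _ (fmap_comp Q _ _); apply: fmap_eqh; rewrite psiE.
Qed.

Let psi0_iso X : is_iso (psi0 X).
Proof.
apply: (colocal_iso (v := idm _) _ _ (resW _) (shiftW (resW X))).
- exact: resC.
- exact/colocal_shift/resC.
- by apply/coneW; [apply: tri_dist_id tK _ _ (svalP (cid (pt_zero pK))) | apply: N_zero; exact: svalP (cid (pt_zero pK))].
by rewrite psiE comp_idl.
Qed.

Let psi : nat_trans (functor_comp (L : functor DT T) shift) (functor_comp shift (L : functor DT T)) :=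
  @NatTrans DT T (functor_comp (L : functor DT T) shift) (functor_comp shift (L : functor DT T)) psi0 psiN.

Let psiI : is_nat_iso psi.
Proof. by move=> X; apply: (ff_iso (@full_incl_ff K Pr)); apply: psi0_iso. Qed.

(* The cone of [rmap f] is colocal, and by the five lemma it maps to [Z] by a
   morphism which the colocal objects see as invertible; so it is the resolution
   of [Z]. *)
Let res_dist X Y Z (f : hom X Y) (g : hom Y Z) (h : hom Z (shift X)) :
  distinguished f g h ->
  distinguished (rmap f) (rmap g) (psi0 X ∘ rmap h).
Proof.
move=> fgh; have [Z' [g' [h' fgh']]] := tri_dist_cone tK (rmap f).
have [|c [cg ch]] := tri_dist_map tK (a := resp X) (b := resp Y) fgh' fgh.
  by rewrite rmapE.
have cZ' : colocal Z' by apply: colocal_cone fgh' _ _; apply: resC.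
have c_hbij S : colocal S -> hbij S c.
  move=> cS; apply: (five_hbij pK fgh' fgh _ cg ch); rewrite ?rmapE //;
    by apply: W_hbij => //; try apply: shiftW; apply: resW.
have [e eE] := (W_hbij cZ' (resW Z)).2 c.
have e_hbij S : colocal S -> hbij S e.
  move=> cS; have [ci cs] := c_hbij _ cS; have [ri rs] := W_hbij cS (resW Z).
  split=> [u v uv|w]; first by apply: ci; rewrite -eE -!comp_assoc uv.
  have [u uE] := cs (resp Z ∘ w); exists u; apply: ri.
  by rewrite comp_assoc eE.
have eI : is_iso e by apply: hbij_iso; apply: e_hbij => //; apply: resC.
apply: (tri_dist_iso tK) fgh'; exists (idm _), (idm _), e; split.
  by split=> //; apply: iso_id.
split; first by rewrite comp_idl comp_idr.
  by rewrite comp_idr; apply: res_inj; rewrite comp_assoc eE cg rmapE.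
rewrite fmap_id comp_idl.
apply: (W_hbij cZ' (shiftW (resW X))).1.
by rewrite !comp_assoc psiE rmapE -comp_assoc eE.
Qed.

Let distL (X Y Z : DT) (f : hom X Y) (g : hom Y Z) (h : hom Z (shift X)) :
  distinguished f g h <->
  distinguished (fmap (L : functor DT T) f) (fmap (L : functor DT T) g)
    (psi X ∘ fmap (L : functor DT T) h).
Proof.
split=> [[X0 [Y0 [Z0 [f0 [g0 [h0 [fgh0]]]]]]]|fgh].
  move=> [a [b [c [[ai bi ci] [bf cg ah]]]]].
  apply: (@tri_dist_iso _ _ tK (res X0) (res Y0) (res Z0) (res X) (res Y) (res Z)
    (rmap f0) (rmap g0) (psi0 X0 ∘ rmap h0) (Lk f) (Lk g) (psi0 X ∘ Lk h));
    last exact: res_dist.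
  exists (Lk a), (Lk b), (Lk c); split; first by split; apply: Lk_iso.
  split; rewrite -?LkQ -?Lk_comp; try exact: Lk_eqh.
  rewrite comp_assoc -psiN -!comp_assoc -!Lk_comp; apply: comp_eqh => //.
  exact: Lk_eqh.
exists (res X), (res Y), (res Z), (Lk f), (Lk g), (psi0 X ∘ Lk h); split=> //.
exists (fmap Q (resp X)), (fmap Q (resp Y)), (fmap Q (resp Z)).
split; first by split; apply: respQ.
split; [exact: LkN | exact: LkN |].
apply: eqh_trans (eqh_sym (fmap_comp Q (fmap shift (resp X)) (psi0 X ∘ Lk h))) _.
apply: eqh_trans _ (LkN h); rewrite -(fmap_comp Q); apply: fmap_eqh.
by rewrite comp_assoc psiE.
Qed.

Let PT : preadditive T := pull_preadditive P (@full_incl_ff K Pr).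

Let tT : triangulated PT.
Proof. exact: (full_sub_triangulated tK shiftPr zeroPr sumPr unshiftPr conePr).1. Qed.

Let haddT (X Y : T) (f g : hom X Y) : hadd PT f g ≡ hadd P (f : hom (sval X) (sval Y)) g.
Proof. exact: (pull_additive P (@full_incl_ff K Pr) f g). Qed.

Let hzeroT (X Y : T) : (hzero PT X Y : hom (sval X) (sval Y)) ≡ hzero P _ _.
Proof. exact: (fmap0 (pull_additive P (@full_incl_ff K Pr))). Qed.

Let biproductT (X Y S : T) : is_biproduct PT X Y S <-> is_biproduct P (sval X) (sval Y) (sval S).
Proof.
split=> [[i [j [p [q [pi qj pj qi ipjq]]]]]|[i [j [p [q [pi qj pj qi ipjq]]]]]];
  exists i, j, p, q; split=> //.
- exact: eqh_trans pj (hzeroT _ _).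
- exact: eqh_trans qi (hzeroT _ _).
- by apply: eqh_trans ipjq; symmetry; apply: (@haddT S S).
- exact: eqh_trans pj (eqh_sym (hzeroT _ _)).
- exact: eqh_trans qi (eqh_sym (hzeroT _ _)).
- by apply: eqh_trans ipjq; apply: (@haddT S S).
Qed.

Let L_colocal (S : T) : colocal (sval S) -> isomorphic S (L (sval S : D)).
Proof.
move=> cS; have [i [ip pi]] := resp_iso cS.
by exists i, (resp (sval S)).
Qed.

Let PD : preadditive DT := pull_preadditive PT L_ff.

Let tD : triangulated PD.
Proof.
apply: (@pull_triangulated T DT PT tT L L_ff psi psiI distL).
- have [Z Z0] := pt_zero pK; exists Z; apply/(is_zeroP PT).
  apply: (@res_inj Z Z); exact: zero_target Z0.
- move=> X Y; have [S XYS] := (tri_additive tT).2 (L X) (L Y).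
  exists (sval S); apply: (biproduct_iso _ XYS); apply: L_colocal.
  by apply: colocal_sum ((biproductT _ _ _).1 XYS) _ _; apply: resC.
- move=> X; have [Y PrY YX] := unshiftPr (resPr X).
  have cY : colocal Y by apply: colocal_unshift YX _; apply: resC.
  have [i [ip pi]] := resp_iso cY; have [k kI] := YX.
  exists Y, (k ∘ fmap shift (resp Y)).
  apply: (ff_iso (@full_incl_ff K Pr)); apply: (iso_comp kI).
  by apply: fmap_iso; exists i.
move=> X Y f; have [Z [g [h [PrZ fgh]]]] := conePr (Lk f) (resPr X) (resPr Y).
have cZ : colocal Z by apply: colocal_cone fgh _ _; apply: resC.
have [i [ip pi]] := resp_iso cZ.
exists Z, (i ∘ g), (h ∘ resp Z).
apply: (tri_dist_iso tK) fgh; exists (idm _), (idm _), i.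
split; first by split; [apply: iso_id | apply: iso_id | exists (resp Z)].
split; rewrite ?comp_idl ?comp_idr //.
by rewrite fmap_id comp_idl -comp_assoc pi comp_idr.
Qed.

Let IQ_exact : exact_functor PT PD (IQ : functor T DT).
Proof.
split.
  move=> X Y f g; apply: (ff_inj L_ff).
  apply: eqh_trans (eqh_sym (pull_additive PT L_ff _ _)).
  apply: eqh_trans (eqh_sym (haddT _ _)).
  apply: eqh_trans (LkQ _) _.
  apply: eqh_trans (rmap_eqh (haddT _ _)) _.
  apply: eqh_trans _ (hadd_eqh P (eqh_sym (LkQ _)) (eqh_sym (LkQ _))).
  by apply: res_inj; rewrite rmapE comp_haddl comp_haddr !rmapE.
have nt (X Y : T) (f : hom X Y) :
    idm (shift (sval Y) : D) ∘ fmap IQ (fmap shift f)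
      ≡ fmap (@shift DT) (fmap (IQ : functor T DT) f) ∘ idm (shift (sval X) : D).
  by apply: eqh_trans (comp_idl _) (eqh_sym (comp_idr _)).
exists (@NatTrans T DT (functor_comp (IQ : functor T DT) shift)
  (functor_comp shift (IQ : functor T DT)) (fun X : T => idm (shift (sval X) : D)) nt).
split; first by move=> X; apply: iso_id.
move=> X Y Z f g h fgh; exists (sval X), (sval Y), (sval Z).
exists (f : @hom K (sval X) (sval Y)), (g : @hom K (sval Y) (sval Z)).
exists (h : @hom K (sval Z) (shift (sval X))).
split=> //; exists (idm _), (idm _), (idm _); split; first by split; apply: iso_id.
by split; exact: eqh_trans (comp_idl _) (eqh_sym (comp_idr _)).
Qed.

Let NT (X : T) : Prop := N (sval X).
Let shiftNT (X : T) (NX : NT X) : NT (shift X) := shiftN NX.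
Local Notation T' := (full_sub_tri shiftNT).
Local Notation F := (full_incl (C := T) NT : functor T' T).

Let tT' : triangulated (pull_preadditive PT (@full_incl_ff T NT) : preadditive T')
  /\ exact_functor (pull_preadditive PT (@full_incl_ff T NT) : preadditive T') PT F.
Proof.
apply: (@full_sub_triangulated T PT tT NT shiftNT).
- have [Z PrZ Z0] := zeroPr; exists (exist _ Z PrZ); first exact: N_zero.
  by split=> X; [case: (Z0.1 (sval X)) | case: (Z0.2 (sval X))] => f fE; exists f.
- move=> X Y NX NY; have [S PrS XYS] := sumPr (svalP X) (svalP Y).
  exists (exist _ S PrS); first exact: N_sum XYS NX NY.
  exact/biproductT.
- move=> X NX; have [Y PrY YX] := unshiftPr (svalP X).
  exists (exist _ Y PrY) => //; apply: unshiftN; apply: N_iso NX.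
  by have [i [i' [ii' i'i]]] := YX; exists i', i.
move=> X Y f NX NY; have [Z [g [h [PrZ fgh]]]] := conePr f (svalP X) (svalP Y).
by exists (exist _ Z PrZ), g, h; split=> //; apply: N_cone fgh NX NY.
Qed.

Let IQ_left : exists L' : functor DT T, adjoint L' (IQ : functor T DT) /\ fully_faithful L'.
Proof.
have [|L' adjL ffL'] := @left_adjoint_of_universal DT T IQ resT
  (fun M => loc_inv (resW M)).
  move=> X Y d.
  have [g gE] := colocal_full (d ∘ fmap Q (resp X)) (@resC X).
  exists g.
    apply: eqh_trans (comp_eqh gE (eqh_refl _)) _.
    by rewrite -comp_assoc loc_invr comp_idr.
  move=> g' g'E; apply: colocal_faithful; first exact: resC.
  rewrite gE; apply: (iso_epic (f := loc_inv (resW X))).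
    by exists (fmap Q (resp X)); split; [apply: loc_invr | apply: loc_invl].
  apply: eqh_trans g'E _.
  by rewrite -comp_assoc loc_invr comp_idr.
exists L'; split=> //; apply: ffL' => X.
by exists (fmap Q (resp X)); split; [apply: loc_invr | apply: loc_invl].
Qed.

(* The cone of [w] has both properties required of [E], and both are stable under
   desuspension. *)
Let fiber X Y (w : hom X Y) : Pr X -> Pr Y -> W w ->
  exists (E : K) (t : hom E X) (x : hom Y (shift E)),
    [/\ Pr E, N E & distinguished t w x].
Proof.
move=> PrX PrY Ww; have [Z [g [h [PrZ wgh]]]] := conePr w PrX PrY.
have NZ : N Z by apply/(coneW wgh).
have [E PrE [j jI]] := unshiftPr PrZ; have [j' [j'j jj']] := jI.
have [t tE] := (shift_ff _ _).2 (h ∘ j).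
exists E, (hopp P t), (j' ∘ g); split=> //.
  by apply: unshiftN; apply: N_iso NZ; exists j', j.
apply/(tri_dist_rot tK); apply: (tri_dist_iso tK) wgh.
exists (idm _), (idm _), j'; split.
  by split; [apply: iso_id | apply: iso_id | exists j].
split; rewrite ?comp_idl ?comp_idr //.
rewrite fmap_id comp_idl (fmapN (tri_shift_additive tK)) hoppK tE.
by rewrite -comp_assoc jj' comp_idr.
Qed.

(* The fiber and the cone of [resp X] are in [N] and in [Pr], hence invisible to
   [R]; so the morphisms from [X] to [R] are those from [res X], which is colocal. *)
Let local_faithful X R (f g : hom X R) :
  Pr X -> local R -> fmap Q f ≡ fmap Q g -> f ≡ g.
Proof.
move=> PrX lR fg; apply: hsub_eq0 P _ _ _ _ _.
have [Z [q [h [PrZ pqh]]]] := conePr (resp X) (@resPr X) PrX.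
have NZ : N Z by apply/(coneW pqh).
have [|v <-] := dist_extend pK pqh (u := hadd P f (hopp P g)).
  suff E : f ∘ resp X ≡ g ∘ resp X by rewrite comp_haddl compNh E haddNr.
  by apply: colocal_faithful; rewrite ?fmap_comp ?fg //; apply: resC.
by rewrite (lR _ PrZ NZ v) comp0h.
Qed.

Let local_full X R (d : hom (X : D) (R : D)) :
  Pr X -> local R -> exists f : hom X R, fmap Q f ≡ d.
Proof.
move=> PrX lR.
have [k kE] := colocal_full (d ∘ fmap Q (resp X)) (@resC X).
have [E [t [x [PrE NE tpx]]]] := fiber (@resPr X) PrX (resW X).
have [f fE] := dist_extend pK tpx (lR _ PrE NE (k ∘ t)).
exists f; apply: (iso_epic (respQ X)).
by rewrite -fmap_comp fE.
Qed.

Let IQ_right : exists R' : functor DT T, adjoint (IQ : functor T DT) R' /\ fully_faithful R'.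
Proof.
pose RP M := localization_of (@resPr M).
pose R M := sval (cid (RP M)).
pose r M : hom (res M) (R M) := sval (cid (svalP (cid (RP M)))).
have RrP M : [/\ Pr (R M), local (R M) & W (r M)] := svalP (cid (svalP (cid (RP M)))).
have PrR M : Pr (R M) by have [] := RrP M.
have lR M : local (R M) by have [] := RrP M.
have Wr M : W (r M) by have [] := RrP M.
pose eps M : hom (R M : D) (M : D) := fmap Q (resp M) ∘ loc_inv (Wr M).
have epsI M : is_iso (eps M).
  apply: iso_comp (respQ M) _.
  by exists (fmap Q (r M)); split; [apply: loc_invr | apply: loc_invl].
have [|R' adjR ffR'] := @right_adjoint_of_universal T DT (IQ : functor T DT)
    (fun M => exist Pr (R M) (PrR M) : T) eps.
  move=> Y X d; have [e' [e'e ee']] := epsI Y.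
  have [g gE] := local_full (e' ∘ d) (svalP X) (@lR Y).
  exists g.
    apply: eqh_trans (comp_eqh (eqh_refl _) gE) _.
    by rewrite comp_assoc ee' comp_idl.
  move=> g' g'E; apply: (local_faithful (svalP X) (@lR Y)).
  rewrite gE; apply: (iso_monic (epsI Y)).
  by rewrite [eps Y ∘ (e' ∘ d)]comp_assoc ee' comp_idl; apply: g'E.
by exists R'; split=> //; apply: ffR'.
Qed.

(* The reflection of [X] is the cone of its resolution. *)
Let F_left : has_left_adjoint F.
Proof.
have H (X : T) := conePr (resp (sval X)) (@resPr _) (svalP X).
pose Z (X : T) := sval (cid (H X)).
pose g (X : T) : hom (sval X) (Z X) := sval (cid (svalP (cid (H X)))).
pose h (X : T) := sval (cid (svalP (cid (svalP (cid (H X)))))).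
have ZP (X : T) : Pr (Z X) /\ distinguished (resp (sval X)) (g X) (h X) :=
  svalP (cid (svalP (cid (svalP (cid (H X)))))).
have NZ (X : T) : N (Z X) by apply/(coneW (ZP X).2); apply: resW.
have [|L' adjL _] := @left_adjoint_of_universal T T' F
    (fun X : T => exist NT (exist Pr (Z X) (ZP X).1) (NZ X)) g; last by exists L'.
move=> X Y f.
pose fk : @hom K (sval X) (sval (sval Y)) := f.
have [v vE] := dist_extend pK (ZP X).2
  (@resC (sval X) _ (svalP Y) (fk ∘ resp (sval X))).
exists v => // v' v'E; apply: hsub_eq0 P _ _ _ _ _.
pose vk : @hom K (Z X) (sval (sval Y)) := v'.
have vkE : vk ∘ g X ≡ fk := v'E.
have [|w <-] := dist_extend_h pK (ZP X).2 (u := hadd P vk (hopp P v)).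
  by rewrite comp_haddl compNh vE vkE haddNr.
by rewrite (colocal_shift (@resC (sval X)) (svalP Y) w) comp0h.
Qed.

(* The coreflection of [X] is the fiber of its local resolution. *)
Let F_right : has_right_adjoint F.
Proof.
pose RP (X : T) := localization_of (svalP X).
pose R (X : T) := sval (cid (RP X)).
pose r (X : T) : hom (sval X) (R X) := sval (cid (svalP (cid (RP X)))).
have RrP (X : T) : [/\ Pr (R X), local (R X) & W (r X)] := svalP (cid (svalP (cid (RP X)))).
have H (X : T) : exists (E : K) (t : hom E (sval X)) (x : hom (R X) (shift E)),
    [/\ Pr E, N E & distinguished t (r X) x].
  by have [PrR _ Wr] := RrP X; apply: fiber => //; apply: (svalP X).
pose E (X : T) := sval (cid (H X)).
pose t (X : T) : hom (E X) (sval X) := sval (cid (svalP (cid (H X)))).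
pose x (X : T) := sval (cid (svalP (cid (svalP (cid (H X)))))).
have EP (X : T) : [/\ Pr (E X), N (E X) & distinguished (t X) (r X) (x X)] :=
  svalP (cid (svalP (cid (svalP (cid (H X)))))).
have PrE (X : T) : Pr (E X) by have [] := EP X.
have NE (X : T) : N (E X) by have [] := EP X.
have [|R' adjR _] := @right_adjoint_of_universal T' T F
    (fun X : T => exist NT (exist Pr (E X) (PrE X)) (NE X)) t; last by exists R'.
move=> Y X f0; have [_ _ trx] := EP Y; have [_ lR _] := RrP Y.
pose f : @hom K (sval (sval X)) (sval Y) := f0.
have [|v vE] := dist_lift pK trx (u := f).
  exact: lR (svalP (sval X)) (svalP X) _.
exists v => // v' v'E; apply: (ff_inj shift_ff); apply: hsub_eq0 P _ _ _ _ _.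
pose vk : @hom K (sval (sval X)) (E Y) := v'.
have vkE : t Y ∘ vk ≡ f := v'E.
have [|w wE] := dist_lift_h pK trx (u := fmap shift (hadd P vk (hopp P v))).
  rewrite -fmap_comp comp_haddr comphN vE vkE haddNr.
  by rewrite (fmap0 (tri_shift_additive tK)).
rewrite -(fmapN (tri_shift_additive tK)) -(tri_shift_additive tK) -wE.
rewrite (lR _ _ _ w) ?comph0 //; first exact: shiftPr (svalP (sval X)).
exact: shiftN (svalP X).
Qed.

Let kernel (X : T) : (exists Y : T', isomorphic (F Y) X) <-> is_zero (IQ X : DT).
Proof.
split=> [[Y YX]|/(is_zeroP PD) Z0].
  have NX : N (sval X) by apply: N_iso (svalP Y); apply: YX.
  apply/(is_zeroP PD); apply: (ff_inj L_ff).
  exact: (zero_source _ _ (res_zero NX)).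
suff NX : N (sval X) by exists (exist NT X NX), (idm (sval X)); apply: iso_id.
apply: N_of_res_zero; apply/(is_zeroP P).
have E := Lk_eqh Z0; apply: eqh_trans E _.
exact: eqh_trans (fmap0 (pull_additive PT L_ff) _ _) (hzeroT (resT (sval X)) _).
Qed.

Theorem recollement_of_resolutions : recollement F (IQ : functor T DT).
Proof.
split.
  exists (pull_preadditive PT (@full_incl_ff T NT)), PT, PD.
  by split; [split; [exact: tT'.1 | |] | split; [exact: tT'.2 |]].
split; first by split; [apply: full_incl_ff | |].
by split=> //; split=> //; apply: kernel.
Qed.

End Resolutions.
End Bousfield.

(** * Triangulated structures given by cones *)

(** When distinguished triangles are by definition the triangles isomorphic to standard ones,
    each axiom has to be checked only for the standard triangles. *)
Section ConesTriangulated.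
Variables (T : triData) (P : preadditive T).
Variables (cn : forall X Y : T, hom X Y -> T)
  (cin : forall (X Y : T) (u : hom X Y), hom Y (cn u))
  (cout : forall (X Y : T) (u : hom X Y), hom (cn u) (shift X)).
Hypothesis distT : forall (X Y Z : T) (f : hom X Y) (g : hom Y Z) (h : hom Z (shift X)),
  distinguished f g h <-> exists (X0 Y0 : T) (u : hom X0 Y0),
    tri_iso u (cin u) (cout u) f g h.
Hypothesis addT : additive_category P.
Hypothesis shiftD : additive_functor P P (@shift T).
Hypothesis shift_eq : is_equivalence (@shift T).
Hypothesis cn_id : forall X : T, is_zero (cn (idm X)).
Hypothesis cn_map : forall (X Y X' Y' : T) (u : hom X Y) (u' : hom X' Y')
  (a : hom X X') (b : hom Y Y'), b ∘ u ≡ u' ∘ a ->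
  exists c : hom (cn u) (cn u'),
    c ∘ cin u ≡ cin u' ∘ b /\ fmap shift a ∘ cout u ≡ cout u' ∘ c.
Hypothesis cn_rot : forall (X Y : T) (u : hom X Y),
  tri_iso (cin u) (cin (cin u)) (cout (cin u))
    (cin u) (cout u) (hopp P (fmap shift u)).
Hypothesis cn_octa : forall (X Y Z : T) (f : hom X Y) (g : hom Y Z),
  exists (u : hom (cn f) (cn (g ∘ f))) (v : hom (cn (g ∘ f)) (cn g)),
    tri_iso u (cin u) (cout u) u v (fmap shift (cin f) ∘ cout g) /\
    [/\ u ∘ cin f ≡ cin (g ∘ f) ∘ g, cout (g ∘ f) ∘ u ≡ cout f,
        v ∘ cin (g ∘ f) ≡ cin g & cout g ∘ v ≡ fmap shift f ∘ cout (g ∘ f)].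

Let std X Y (u : hom X Y) : distinguished u (cin u) (cout u).
Proof.
apply/distT; exists X, Y, u, (idm _), (idm _), (idm _).
split; first by split; apply: iso_id.
by split; rewrite ?fmap_id !comp_idl !comp_idr.
Qed.

Let dist_iso (X Y Z X' Y' Z' : T)
    (f : hom X Y) (g : hom Y Z) (h : hom Z (shift X))
    (f' : hom X' Y') (g' : hom Y' Z') (h' : hom Z' (shift X')) :
  tri_iso f g h f' g' h' -> distinguished f g h -> distinguished f' g' h'.
Proof.
move=> [a [b [c [[ai bi ci] [bf cg ah]]]]].
move=> /distT[X0 [Y0 [u [a0 [b0 [c0 [[ai0 bi0 ci0] [bf0 cg0 ah0]]]]]]]].
apply/distT; exists X0, Y0, u, (a ∘ a0), (b ∘ b0), (c ∘ c0).
split; first by split; apply: iso_comp.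
split; first by rewrite -comp_assoc bf0 !comp_assoc bf.
  by rewrite -comp_assoc cg0 !comp_assoc cg.
by rewrite fmap_comp -comp_assoc ah0 !comp_assoc ah.
Qed.

Let dist_rot (X Y Z : T) (f : hom X Y) (g : hom Y Z) (h : hom Z (shift X)) :
  distinguished f g h -> distinguished g h (hopp P (fmap shift f)).
Proof.
move=> /distT[X0 [Y0 [u [a [b [c [[ai bi ci] [bf cg ah]]]]]]]].
apply: dist_iso (dist_iso (cn_rot u) (std (cin u))).
exists b, c, (fmap shift a); split; first by split=> //; apply: fmap_iso.
by split=> //; rewrite comphN compNh -!fmap_comp bf.
Qed.

Let pre : pretriangulated P.
Proof.
split=> //; first exact: addT.1.
- exact: (equiv_ff shift_eq).1.
- move=> X Z Z0; apply: dist_iso (std (idm X)).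
  exists (idm _), (idm _), (hzero P _ _); split.
    split; [exact: iso_id | exact: iso_id |].
    by exists (hzero P _ _); split; apply: zero_source.
  split; first by [].
    exact: zero_target Z0.
  apply: zero_source; exact: cn_id.
move=> X Y Z X' Y' Z' f g h f' g' h' a b.
move=> /distT[X0 [Y0 [u [a0 [b0 [c0 [[ai0 bi0 ci0] [bf0 cg0 ah0]]]]]]]].
move=> /distT[X1 [Y1 [v [a1 [b1 [c1 [[ai1 bi1 ci1] [bf1 cg1 ah1]]]]]]]] bf.
have [a1' [a1'K Ka1']] := ai1; have [b1' [b1'K Kb1']] := bi1.
have [|c [cg ah]] := @cn_map _ _ _ _ u v (a1' ∘ (a ∘ a0)) (b1' ∘ (b ∘ b0)).
  apply: (iso_monic bi1); rewrite !comp_assoc Kb1' comp_idl -comp_assoc bf0.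
  by rewrite bf1 comp_assoc bf -(comp_assoc f' a1) Ka1' comp_idr.
have [c0' [c0'K Kc0']] := ci0.
exists (c1 ∘ (c ∘ c0')); split.
  apply: (iso_epic bi0); rewrite -!comp_assoc -cg0 (comp_assoc c0') c0'K comp_idl.
  by rewrite cg comp_assoc cg1 -!comp_assoc (comp_assoc b1) Kb1' comp_idl.
apply: (iso_epic ci0); rewrite -!comp_assoc c0'K comp_idr -ah0.
rewrite (comp_assoc h') -ah1 -comp_assoc -ah !comp_assoc -!fmap_comp.
by rewrite !comp_assoc Ka1' comp_idl.
Qed.

Lemma cones_triangulated : triangulated P.
Proof.
split=> //.
- exact: pt_id pre.
- by move=> X Y f; exists (cn f), (cin f), (cout f).
- move=> X Y Z f g h; split; first exact: dist_rot.
  apply: (rot_converse pre dist_iso) => X1 Y1 u.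
  by exists (cn u), (cin u), (cout u).
- exact: pt_map pre.
move=> X Y Z X' Y' Z' f g i j k l m n d1 d2 d3.
have [u [v [duv [ui lu vk nv]]]] := cn_octa f g.
have [a aI [ai ja]] := cone_uniq pre (std f) d1.
have [b bI [bk lb]] := cone_uniq pre (std (g ∘ f)) d2.
have [c cI [cm nc]] := cone_uniq pre (std g) d3.
have [a' [a'a aa']] := aI; have [b' [b'b bb']] := bI.
exists (b ∘ (u ∘ a')), (c ∘ (v ∘ b')); split.
  apply: dist_iso (dist_iso duv (std u)); exists a, b, c; split=> //.
  split.
  - by rewrite -!comp_assoc a'a comp_idr.
  - by rewrite -!comp_assoc b'b comp_idr.
  by rewrite comp_assoc -fmap_comp ai -comp_assoc nc.
split.
- by rewrite -ai -!comp_assoc (comp_assoc a') a'a comp_idl ui comp_assoc bk.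
- rewrite comp_assoc lb comp_assoc lu -ja -comp_assoc aa'.
  by rewrite comp_idr.
- by rewrite -bk -!comp_assoc (comp_assoc b') b'b comp_idl vk.
rewrite comp_assoc nc comp_assoc nv -comp_assoc; apply: comp_eqh => //.
by rewrite -lb -comp_assoc bb' comp_idr.
Qed.
End ConesTriangulated.

(** * Deciding identities in abelian groups *)

Inductive abexp := AbVar of nat | AbZero | AbAdd of abexp & abexp | AbOpp of abexp.

Section Abel.
Variable V : zmodType.

Fixpoint ab_eval (env : seq V) (e : abexp) : V :=
  match e with
  | AbVar n => env`_n
  | AbZero => 0
  | AbAdd e1 e2 => ab_eval env e1 + ab_eval env e2
  | AbOpp e1 => - ab_eval env e1
  end.

Fixpoint ab_coef (e : abexp) (i : nat) : int :=
  match e with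
  | AbVar n => (i == n)%:Z
  | AbZero => 0
  | AbAdd e1 e2 => ab_coef e1 i + ab_coef e2 i
  | AbOpp e1 => - ab_coef e1 i
  end.

Lemma ab_evalE env e : ab_eval env e = \sum_(i < size env) env`_i *~ ab_coef e i.
Proof.
elim: e => [n| |e1 IH1 e2 IH2|e1 IH1] /=.
- have [lt_n|le_n] := ltnP n (size env); last first.
    rewrite nth_default // big1 // => i _.
    by rewrite ltn_eqF ?mulr0z //; apply: leq_trans le_n.
  rewrite (bigD1 (Ordinal lt_n)) //= eqxx mulr1z big1 ?addr0 // => i ne_i.
  by rewrite -val_eqE /= in ne_i; rewrite (negPf ne_i) mulr0z.
- by rewrite big1 // => i _; rewrite mulr0z.
- by rewrite IH1 IH2 -big_split; apply: eq_bigr => i _; rewrite mulrzDr.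
by rewrite IH1 -sumrN; apply: eq_bigr => i _; rewrite mulrNz.
Qed.

Lemma abP env e1 e2 :
  all (fun i => ab_coef e1 i == ab_coef e2 i) (iota 0 (size env)) ->
  ab_eval env e1 = ab_eval env e2.
Proof.
move=> /allP H; rewrite !ab_evalE; apply: eq_bigr => i _.
by rewrite (eqP (H _ _)) // mem_iota /= add0n.
Qed.

(* Exposes the structure of the group on which the equation is stated. *)
Lemma ab_start (x y : V) : x = y -> x = y. Proof. by []. Qed.
End Abel.

(* Atoms are compared up to conversion, since the same group may be presented by
   different canonical expressions. *)
Ltac ab_index x env :=
  lazymatch env with
  | ?y :: ?env' =>
    match goal with
    | _ => let _ := match goal with _ => unify x y end in constr:(0%N)
    | _ => let n := ab_index x env' in constr:(S n)
    end
  end.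

Ltac ab_add x env :=
  match goal with
  | _ => let _ := ab_index x env in env
  | _ => constr:(x :: env)
  end.

Ltac ab_atoms t env :=
  lazymatch t with
  | (?a + ?b)%R => let env1 := ab_atoms a env in ab_atoms b env1
  | (- ?a)%R => ab_atoms a env
  | 0%R => env
  | _ => ab_add t env
  end.

Ltac ab_reify t env :=
  lazymatch t with
  | (?a + ?b)%R =>
      let ea := ab_reify a env in let eb := ab_reify b env in
      constr:(AbAdd ea eb)
  | (- ?a)%R => let ea := ab_reify a env in constr:(AbOpp ea)
  | 0%R => constr:(AbZero)
  | _ => let n := ab_index t env in constr:(AbVar n)
  end.

(** Both sides are reified and compared by their coefficients at each atom. *)
Ltac abel :=
  refine (@ab_start _ _ _ _);
  match goal with
  | |- @eq (GRing.Zmodule.sort ?V) ?x ?y =>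
      let env0 := constr:(@nil (GRing.Zmodule.sort V)) in
      let env1 := ab_atoms x env0 in
      let env := ab_atoms y env1 in
      let ex := ab_reify x env in
      let ey := ab_reify y env in
      apply: (@abP V env ex ey); vm_compute; reflexivity
  end.

(** * The homotopy category of dg modules is triangulated *)

Section HomotopyCategory.
Variables (G : gradingGroup) (A : dgRing G).
Implicit Types M N L : dgMod A.
Local Notation K := (homotopyCat A).

Lemma gh0 (R : grRing G) (M N : grMod R) (f : grHom M N) i : f i 0 = 0.
Proof. exact: morphD0 (@ghD _ _ _ _ f i). Qed.

Lemma ghN (R : grRing G) (M N : grMod R) (f : grHom M N) i x : f i (- x) = - f i x.
Proof. exact: (morphDN (@ghD _ _ _ _ f i)). Qed.

Lemma dgm_d0 M i j (e : i + gg1 = j) : dgm_d e (0 : M i) = 0.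
Proof. exact: morphD0 (dgm_dD e). Qed.

Lemma dgm_dN M i j (e : i + gg1 = j) (x : M i) : dgm_d e (- x) = - dgm_d e x.
Proof. exact: (morphDN (dgm_dD e)). Qed.

Lemma gact0r (R : grRing G) (M : grMod R) i j k (e : i + j = k) (a : R i) :
  gact e a (0 : M j) = 0.
Proof. exact: morphD0 (gactDr e a). Qed.

Lemma gactNr (R : grRing G) (M : grMod R) i j k (e : i + j = k) (a : R i) (x : M j) :
  gact e a (- x) = - gact e a x.
Proof. exact: (morphDN (gactDr e a)). Qed.

Lemma gact0l (R : grRing G) (M : grMod R) i j k (e : i + j = k) (x : M j) :
  gact e (0 : R i) x = 0.
Proof. exact: morphD0 (gactDl e x). Qed.

Lemma koszul_0 s (V : zmodType) : koszul s (0 : V) = 0.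
Proof. exact: morphD0 (@koszulD s V). Qed.

(** ** The preadditive structure *)

Program Definition dgHom_add M N (f g : dgHom M N) : dgHom M N :=
  @DgHom G A M N (@GrHom G A M N (fun i x => f i x + g i x) _ _) _.
Next Obligation. by move=> M N f g i x y /=; rewrite !ghD addrACA. Qed.
Next Obligation. by move=> M N f g i j k e a x /=; rewrite !gh_act gactDr. Qed.
Next Obligation. by move=> M N f g i j e x /=; rewrite !dgh_d dgm_dD. Qed.

Program Definition dgHom_zero M N : dgHom M N :=
  @DgHom G A M N (@GrHom G A M N (fun i x => 0) _ _) _.
Next Obligation. by move=> M N i x y; rewrite addr0. Qed.
Next Obligation. by move=> M N i j k e a x /=; rewrite gact0r. Qed.
Next Obligation. by move=> M N i j e x /=; rewrite dgm_d0. Qed.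

Program Definition dgHom_opp M N (f : dgHom M N) : dgHom M N :=
  @DgHom G A M N (@GrHom G A M N (fun i x => - f i x) _ _) _.
Next Obligation. by move=> M N f i x y /=; rewrite ghD opprD. Qed.
Next Obligation. by move=> M N f i j k e a x /=; rewrite gh_act gactNr. Qed.
Next Obligation. by move=> M N f i j e x /=; rewrite dgh_d dgm_dN. Qed.

Program Definition K_preadditive : preadditive K :=
  @Preadditive K dgHom_add dgHom_zero dgHom_opp _ _ _ _ _ _ _ _.
Next Obligation.
move=> M N f f' g g' [h [hD hA hd]] [k [kD kA kd]].
exists (fun i j e x => h i j e x + k i j e x); split.
- by move=> i j e x y; rewrite hD kD addrACA.
- move=> i j l j' l' e ej el e' a x.
  by rewrite (hA _ _ _ _ _ _ _ _ e') (kA _ _ _ _ _ _ _ _ e') gactDr koszulD.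
move=> i j j' e e' x /=.
by rewrite dgm_dD opprD addrACA (hd _ _ _ e e') (kd _ _ _ e e') addrACA.
Qed.
Next Obligation.
move=> M N f g [h [hD hA hd]]; exists (fun i j e x => - h i j e x); split.
- by move=> i j e x y; rewrite hD opprD.
- move=> i j l j' l' e ej el e' a x.
  by rewrite (hA _ _ _ _ _ _ _ _ e') gactNr koszulN.
by move=> i j j' e e' x /=; rewrite dgm_dN -!opprD (hd _ _ _ e e').
Qed.
Next Obligation. by move=> M N f g h; apply: homotopic_ext => i x /=; rewrite addrA. Qed.
Next Obligation. by move=> M N f g; apply: homotopic_ext => i x /=; rewrite addrC. Qed.
Next Obligation. by move=> M N f; apply: homotopic_ext => i x /=; rewrite add0r. Qed.
Next Obligation. by move=> M N f; apply: homotopic_ext => i x /=; rewrite addNr. Qed.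
Next Obligation. by move=> M N L g g' f; apply: homotopic_ext. Qed.
Next Obligation. by move=> M N L g f f'; apply: homotopic_ext => i x /=; rewrite ghD. Qed.

Program Definition dgSum M N : dgMod A :=
  @DgMod G A (grSum M N) (fun i j e x => (dgm_d e x.1, dgm_d e x.2)) _ _ _.
Next Obligation. by move=> M N i j e x y /=; rewrite !dgm_dD. Qed.
Next Obligation. by move=> M N i j k e e' x /=; rewrite !dgm_dd. Qed.
Next Obligation.
move=> M N i j k i' j' k' e ei ej ek el er a x /=.
rewrite !(dgm_leibniz e ei ej ek el er).
by rewrite /koszul; case: ifP.
Qed.

Program Definition dgSum_inl M N : dgHom M (dgSum M N) :=
  @DgHom G A M (dgSum M N) (@GrHom G A M (dgSum M N) (fun i x => (x, 0) : dgSum M N i) _ _) _.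
Next Obligation. by move=> M N i x y; congr (_, _); rewrite addr0. Qed.
Next Obligation. by move=> M N i j k e a x; congr (_, _); rewrite /= gact0r. Qed.
Next Obligation. by move=> M N i j e x; congr (_, _); rewrite /= dgm_d0. Qed.

Program Definition dgSum_inr M N : dgHom N (dgSum M N) :=
  @DgHom G A N (dgSum M N) (@GrHom G A N (dgSum M N) (fun i x => (0, x) : dgSum M N i) _ _) _.
Next Obligation. by move=> M N i x y; congr (_, _); rewrite addr0. Qed.
Next Obligation. by move=> M N i j k e a x; congr (_, _); rewrite /= gact0r. Qed.
Next Obligation. by move=> M N i j e x; congr (_, _); rewrite /= dgm_d0. Qed.

Program Definition dgSum_fst M N : dgHom (dgSum M N) M :=
  @DgHom G A (dgSum M N) M (@GrHom G A (dgSum M N) M (fun i (x : dgSum M N i) => x.1) _ _) _.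
Next Obligation. by []. Qed.
Next Obligation. by []. Qed.
Next Obligation. by []. Qed.

Program Definition dgSum_snd M N : dgHom (dgSum M N) N :=
  @DgHom G A (dgSum M N) N (@GrHom G A (dgSum M N) N (fun i (x : dgSum M N i) => x.2) _ _) _.
Next Obligation. by []. Qed.
Next Obligation. by []. Qed.
Next Obligation. by []. Qed.

Lemma dgSum_biproduct M N : is_biproduct K_preadditive (M : K) (N : K) (dgSum M N : K).
Proof.
exists (dgSum_inl M N), (dgSum_inr M N), (dgSum_fst M N), (dgSum_snd M N).
split; apply: homotopic_ext => i x //=.
by case: x => x y; congr (_, _); rewrite /= ?addr0 ?add0r.
Qed.

Program Definition dgZero : dgMod A :=
  @DgMod G A (@GrMod G A (fun=> 'rV[int]_0) (fun i j k e a x => 0) _ _ _ _)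
    (fun i j e x => 0) _ _ _.
Next Obligation. by move=> * x y; rewrite addr0. Qed.
Next Obligation. by move=> * x y; rewrite addr0. Qed.
Next Obligation. by []. Qed.
Next Obligation. by move=> i e x; rewrite [x]thinmx0. Qed.
Next Obligation. by move=> * x y; rewrite addr0. Qed.
Next Obligation. by []. Qed.
Next Obligation. by move=> * /=; rewrite koszul_0 addr0. Qed.

Lemma dgZero_zero : is_zero (dgZero : K).
Proof.
by apply/(is_zeroP K_preadditive)/homotopic_ext => i x /=; rewrite [x]thinmx0.
Qed.

(** ** The shift is an equivalence *)

(** Replacing every degree by one of the form [i + gg1] makes the transports along
    [i - gg1 + gg1 = i] in the constructions below disappear. *)
Lemma grading_shift (Q : G -> Prop) : (forall i, Q (i + gg1)) -> forall i, Q i.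
Proof. by move=> H i; rewrite -(subrK gg1 i). Qed.

Section Unshift.
Variables (V V' : G -> zmodType) (F : forall i, V (i + gg1) -> V' (i + gg1)).

Definition unshift_fun i (x : V i) : V' i :=
  ecast z (V' z) (subrK gg1 i) (F (ecast z (V z) (esym (subrK gg1 i)) x)).

Lemma unshift_funE i x : @unshift_fun (i + gg1) x = F x.
Proof.
rewrite /unshift_fun; move: (subrK _ _); move: (i + gg1 - gg1) (addrK gg1 i) => j ji.
by case: _ / (esym ji) => e; rewrite (eq_irrelevance e erefl).
Qed.
End Unshift.

Section ShiftFull.
Variables (M N : dgMod A) (h : dgHom (dgShift M) (dgShift N)).

Let k := @unshift_fun M N (fun i => h i).
Let kE i (x : M (i + gg1)) : k x = h i x.
Proof. exact: (@unshift_funE M N (fun i => h i)). Qed.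

Let kD i : {morph @k i : x y / x + y}.
Proof.
move: i; apply: grading_shift => i x y; rewrite !kE.
exact: (@ghD _ _ _ _ h i x y).
Qed.

Let kA i j l (e : i + j = l) (a : A i) (x : M j) : k (gact e a x) = gact e a (k x).
Proof.
move: j l e x; apply: grading_shift => j; apply: grading_shift => l e x.
have e' : i + j = l by move: e; rewrite addrA; apply: addIr.
rewrite !kE -(eq_irrelevance (shift_degree gg1 e') e).
have /= := @gh_act _ _ _ _ h _ _ _ e' a x.
rewrite (morphD_koszul (@ghD _ _ _ _ h l)) => E.
exact: (inv_inj (@koszulK _ _) E).
Qed.

Let kd i j (e : i + gg1 = j) (x : M i) : k (dgm_d e x) = dgm_d e (k x).
Proof.
move: i j e x; apply: grading_shift => i; apply: grading_shift => j e x.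
have e' : i + gg1 = j by apply: addIr e.
rewrite !kE -(eq_irrelevance (shift_degree_d gg1 e') e).
have /= := @dgh_d _ _ _ _ h _ _ e' x.
rewrite (ghN (M := dgShift M) (N := dgShift N)) => E.
exact: (inv_inj (@opprK _) E).
Qed.

Definition dgHom_unshift : dgHom M N := DgHom (dgh_gr := GrHom kD kA) kd.

Lemma dgHom_unshiftE i x : dgHom_shift dgHom_unshift i x = h i x.
Proof. exact: kE. Qed.
End ShiftFull.

(** The homotopy [h] of the shifted morphisms is a homotopy of the morphisms
    themselves, up to the sign of the differential of a shift. *)
Section ShiftFaithful.
Variables (M N : dgMod A) (f g : dgHom M N).
Variable h : forall i j : G, j + gg1 = i -> dgShift M i -> dgShift N j.
Hypothesis hD : forall i j (e : j + gg1 = i), {morph h e : x y / x + y}.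
Hypothesis hA : forall i j k j' k' (e : i + j = k) (ej : j' + gg1 = j)
  (ek : k' + gg1 = k) (e' : i + j' = k') (a : A i) (x : dgShift M j),
  h ek (gact e a x) = koszul (parity i) (gact e' a (h ej x)).
Hypothesis hd : forall i j j' (e : j + gg1 = i) (e' : i + gg1 = j') (x : dgShift M i),
  dgHom_shift f i x - dgHom_shift g i x = dgm_d e (h e x) + h e' (dgm_d e' x).

Let lower (i j : G) (e : j + gg1 = i) : j - gg1 + gg1 = i - gg1.
Proof. by rewrite -e addrAC. Qed.

Let k (i j : G) (e : j + gg1 = i) (x : M i) : N j :=
  - ecast z (N z) (subrK gg1 j)
      (h (lower e) (ecast z (M z) (esym (subrK gg1 i)) x)).

Let kE (i j : G) (e : j + gg1 = i) (e' : j + gg1 + gg1 = i + gg1) (x : M (i + gg1)) :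
  k e' x = - h e x.
Proof.
rewrite /k; congr (- _); move: (lower e') (subrK _ _) (subrK _ _).
move: (i + gg1 - gg1) (j + gg1 - gg1) (addrK gg1 i) (addrK gg1 j) => i' j' ei ej.
subst i' j' => e1 e2 e3.
by rewrite (eq_irrelevance e2 erefl) (eq_irrelevance e3 erefl) (eq_irrelevance e1 e).
Qed.

Lemma homotopic_unshift : homotopic f g.
Proof.
exists (fun i j e => @k i j e); split.
- apply: grading_shift => i; apply: grading_shift => j e x y.
  have e' : j + gg1 = i by apply: addIr e.
  by rewrite !(kE e') hD opprD.
- move=> i j l j' l' e ej el e' a x.
  move: j l j' l' e ej el e' a x; apply: grading_shift => j.
  apply: grading_shift => l; apply: grading_shift => j'; apply: grading_shift => l'.
  move=> e ej el e' a x.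
  have ej0 : j' + gg1 = j by apply: addIr ej.
  have el0 : l' + gg1 = l by apply: addIr el.
  have e0 : i + j = l by move: e; rewrite addrA; apply: addIr.
  have e0' : i + j' = l' by move: e'; rewrite addrA; apply: addIr.
  rewrite (kE el0) (kE ej0) gactNr koszulN; congr (- _).
  have hK s : h ej0 (koszul s (x : dgShift M j)) = koszul s (h ej0 x).
    exact: (morphD_koszul (hD ej0)).
  have := hA e0 ej0 el0 e0' a (koszul (parity (@gg1 G) * parity i) (x : dgShift M j)).
  rewrite hK /= !(morphD_koszul (gactDr _ a)) !koszulK.
  rewrite (eq_irrelevance (shift_degree gg1 e0) e).
  rewrite (eq_irrelevance (shift_degree gg1 e0') e').
  by [].
move=> i j j' e e' x; move: i j j' e e' x.
apply: grading_shift => i; apply: grading_shift => j; apply: grading_shift => j'.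
move=> e e' x.
have e0 : j + gg1 = i by apply: addIr e.
have e0' : i + gg1 = j' by apply: addIr e'.
have /= := hd e0 e0' x; rewrite (kE e0) (kE e0').
rewrite (eq_irrelevance (shift_degree_d gg1 e0) e).
rewrite (eq_irrelevance (shift_degree_d gg1 e0') e') => ->.
by rewrite dgm_dN (morphDN (hD e0')).
Qed.
End ShiftFaithful.

Lemma ecast_id1 (V : G -> zmodType) i j (e : i = j) (x : V i) :
  ecast z (V z) (esym e) (ecast z (V z) e x) = x.
Proof. by case: _ / e. Qed.

Lemma ecast_id2 (V : G -> zmodType) i j (e : i = j) (x : V j) :
  ecast z (V z) e (ecast z (V z) (esym e) x) = x.
Proof. by case: _ / e x. Qed.

Lemma dgm_d_cast M i i' j j' (e : i + gg1 = j) (ei : i = i') (ej : j = j')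
    (e' : i' + gg1 = j') (x : M i) :
  ecast z (M z) ej (dgm_d e x) = dgm_d e' (ecast z (M z) ei x).
Proof.
by case: _ / ei e' => e'; case: _ / ej e' => e'; rewrite (eq_irrelevance e' e).
Qed.

Program Definition dgUnshift M : dgMod A :=
  @DgMod G A (grShift (- gg1) M)
    (fun i j e x => - dgm_d (shift_degree_d (- gg1) e) x) _ _ _.
Next Obligation. by move=> M i j e x y /=; rewrite dgm_dD opprD. Qed.
Next Obligation. by move=> M i j k e e' x /=; rewrite dgm_dN dgm_dd !oppr0. Qed.
Next Obligation.
move=> M i j k i' j' k' e ei ej ek el er a x /=.
rewrite raddfN /= parity_gg1 !mulNr !mul1r !koszul_opp (morphD_koszul (dgm_dD _)).
rewrite (dgm_leibniz _ ei (shift_degree_d (- gg1) ej) _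
  (shift_degree (- gg1) el) (shift_degree (- gg1) er)).
rewrite -koszulN opprD koszulD gactNr !koszulN.
have -> : parity i' = parity i + 1 by rewrite -ei raddfD /= parity_gg1.
by rewrite -koszulM koszul1 koszulN.
Qed.

Program Definition dgUnshift_counit M : dgHom (dgShift (dgUnshift M)) M :=
  @DgHom G A (dgShift (dgUnshift M)) M
    (@GrHom G A (dgShift (dgUnshift M)) M
      (fun i x => ecast z (M z) (addrK gg1 i) x) _ _) _.
Next Obligation. by move=> M i x y /=; rewrite castD. Qed.
Next Obligation.
move=> M i j k e a x /=.
rewrite koszulM raddfN /= mulNr -koszulM koszul_opp koszulK.
exact: gact_cast.
Qed.
Next Obligation. by move=> M i j e x /=; rewrite opprK; apply: dgm_d_cast. Qed.

Program Definition dgUnshift_unit M : dgHom M (dgShift (dgUnshift M)) :=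
  @DgHom G A M (dgShift (dgUnshift M))
    (@GrHom G A M (dgShift (dgUnshift M))
      (fun i x => ecast z (M z) (esym (addrK gg1 i)) x) _ _) _.
Next Obligation. by move=> M i x y /=; rewrite castD. Qed.
Next Obligation.
move=> M i j k e a x /=.
rewrite koszulM raddfN /= mulNr -koszulM koszul_opp koszulK.
exact: gact_cast.
Qed.
Next Obligation. by move=> M i j e x /=; rewrite opprK; apply: dgm_d_cast. Qed.

Lemma unshift_isomorphic M : isomorphic (dgShift (dgUnshift M) : K) (M : K).
Proof.
exists (dgUnshift_counit M), (dgUnshift_unit M).
by split; apply: homotopic_ext => i x /=; rewrite ?ecast_id1 ?ecast_id2.
Qed.

Lemma shift_equivalence : is_equivalence (@homotopyShift G A).
Proof.
apply: ff_equiv => [M N|M]; last by exists (dgUnshift M); apply: unshift_isomorphic.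
split=> [f g [h [hD hA hd]]|h]; first exact: (homotopic_unshift (h := h)).
exists (dgHom_unshift h); apply: homotopic_ext => i x; exact: dgHom_unshiftE.
Qed.

End HomotopyCategory.

(** ** Cones *)

Lemma koszul_pair (U V : zmodType) s (p : U * V) :
  koszul s p = (koszul s p.1, koszul s p.2).
Proof. by rewrite /koszul; case: ifP; case: p. Qed.

(** A homotopy maps degree [i] to every [j] with [j + gg1 = i]; eliminating that
    equation leaves no transport in the conditions to be checked. *)
Lemma homotopicI (G : gradingGroup) (A : dgRing G) (M N : dgMod A) (f g : dgHom M N)
    (h : forall i, M (i + gg1) -> N i) :
  (forall i, {morph h i : x y / x + y}) ->
  (forall (i j k : G) (e : i + j = k) (e' : i + (j + gg1) = k + gg1) (a : A i) x,
     h k (gact e' a x) = koszul (parity i) (gact e a (h j x))) ->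
  (forall i (x : M (i + gg1)), f _ x - g _ x =
     dgm_d (erefl (i + gg1)) (h i x) + h (i + gg1) (dgm_d (erefl (i + gg1 + gg1)) x)) ->
  homotopic f g.
Proof.
move=> hD hA hd.
exists (fun i j (e : j + gg1 = i) =>
  match e in _ = i return M i -> N j with erefl => h j end); split.
- by move=> i j e; case: _ / e.
- move=> i j k j' k' e ej ek e' a x.
  by case: _ / ej e x => e x; case: _ / ek e => e; apply: hA.
by move=> i j j' e e' x; case: _ / e' => {j'}; case: _ / e x.
Qed.

Section Cones.
Variables (G : gradingGroup) (A : dgRing G).
Implicit Types M N L : dgMod A.
Local Notation K := (homotopyCat A).

(** A homotopy-commutative square induces a morphism of cones, which depends on
    the homotopy. *)
Section ConeMap.
Variables (M N M' N' : dgMod A) (u : dgHom M N) (u' : dgHom M' N').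
Variables (a : dgHom M M') (b : dgHom N N').
Variable h : forall i j : G, j + gg1 = i -> M i -> N' j.
Hypothesis hD : forall (i j : G) (e : j + gg1 = i), {morph h e : x y / x + y}.
Hypothesis hA : forall (i j k j' k' : G) (e : i + j = k) (ej : j' + gg1 = j)
  (ek : k' + gg1 = k) (e' : i + j' = k') (c : A i) (x : M j),
  h ek (gact e c x) = koszul (parity i) (gact e' c (h ej x)).
Hypothesis hd : forall (i j j' : G) (e : j + gg1 = i) (e' : i + gg1 = j') (x : M i),
  b i (u i x) - u' i (a i x) = dgm_d e (h e x) + h e' (dgm_d e' x).

Program Definition cone_map : dgHom (cone u) (cone u') :=
  @DgHom G A (cone u) (cone u') (@GrHom G A (cone u) (cone u')
    (fun i (x : cone u i) =>
       (a (i + gg1) x.1, b i x.2 + h (erefl (i + gg1)) x.1) : cone u' i) _ _) _.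
Next Obligation. by move=> i x y; congr (_, _); rewrite /= ?ghD ?hD // addrACA. Qed.
Next Obligation.
move=> i j k e c x; congr (_, _) => /=.
  by rewrite (morphD_koszul (@ghD _ _ _ _ a _)) gh_act.
rewrite gh_act gactDr (morphD_koszul (hD (erefl (k + gg1)))).
rewrite (hA (shift_degree gg1 e) (erefl _) (erefl _) e).
by rewrite parity_gg1 mul1r koszulK.
Qed.
Next Obligation.
move=> i j e x; congr (_, _) => /=; first by rewrite ghN dgh_d.
case: _ / e => /=; rewrite ghD dgm_dD dgh_d (morphDN (hD _)).
rewrite !(eq_irrelevance (shift_degree_d gg1 erefl) erefl).
have E := hd (erefl (i + gg1)) (erefl (i + gg1 + gg1)) x.1.
rewrite -[b _ (u _ x.1)](subrK (u' _ (a _ x.1))) E.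
abel.
Qed.

Lemma cone_map_in : homotopic (dgHom_comp cone_map (cone_in u)) (dgHom_comp (cone_in u') b).
Proof.
apply: homotopic_ext => i x; congr (_, _); rewrite /= ?gh0 //.
by rewrite (morphD0 (hD _)) addr0.
Qed.

Lemma cone_map_out :
  homotopic (dgHom_comp (dgHom_shift a) (cone_out u)) (dgHom_comp (cone_out u') cone_map).
Proof. exact: homotopic_ext. Qed.
End ConeMap.

Lemma cone_idm_zero M : is_zero (cone (dgHom_id M) : K).
Proof.
apply/(is_zeroP (K_preadditive A)).
apply: (homotopicI (h := fun i (x : cone (dgHom_id M) (i + gg1)) =>
  (x.2, 0) : cone (dgHom_id M) i)).
- by move=> i x y; congr (_, _); rewrite addr0.
- move=> i j k e e' a x.
  have -> (p : cone (dgHom_id M) k) s : koszul s p = (koszul s p.1, koszul s p.2).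
    by rewrite /koszul; case: ifP; case: p.
  congr (_, _); rewrite /= ?gact0r ?koszul_0 // parity_gg1 mul1r koszulK.
  by rewrite (eq_irrelevance e' (shift_degree gg1 e)).
move=> i x; rewrite [LHS]subr0 [LHS]surjective_pairing.
by congr (_, _); rewrite /= ?dgm_d0 ?(eq_irrelevance (shift_degree_d _ _) erefl); abel.
Qed.

(** The cone of [N -> cone u] is [M[1] ], up to a contractible summand with underlying
    graded module [N[1] + N]. *)
Program Definition rot_to M N (u : dgHom M N) : dgHom (cone (cone_in u)) (dgShift M) :=
  @DgHom G A (cone (cone_in u)) (dgShift M)
    (@GrHom G A (cone (cone_in u)) (dgShift M) (fun i (x : cone (cone_in u) i) => x.2.1) _ _) _.
Next Obligation. by []. Qed.
Next Obligation. by []. Qed.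
Next Obligation. by move=> M N u i j e x /=; rewrite add0r. Qed.

Program Definition rot_from M N (u : dgHom M N) : dgHom (dgShift M) (cone (cone_in u)) :=
  @DgHom G A (dgShift M) (cone (cone_in u))
    (@GrHom G A (dgShift M) (cone (cone_in u))
       (fun i (x : dgShift M i) => (- u (i + gg1) x, (x, 0)) : cone (cone_in u) i) _ _) _.
Next Obligation.
by move=> M N u i x y; congr (_, (_, _)); rewrite /= ?ghD ?addr0 // opprD.
Qed.
Next Obligation.
move=> M N u i j k e a x; congr (_, (_, _)); rewrite /= ?gact0r //.
by rewrite (morphD_koszul (@ghD _ _ _ _ u _)) gh_act gactNr koszulN.
Qed.
Next Obligation.
move=> M N u i j e x; congr (_, (_, _)); rewrite /= ?dgm_d0 ?add0r ?addr0 //.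
  by rewrite ghN dgh_d dgm_dN.
by case: _ / e => /=; rewrite addNr.
Qed.

Lemma rot_toK M N (u : dgHom M N) :
  homotopic (dgHom_comp (rot_to u) (rot_from u)) (dgHom_id _).
Proof. exact: homotopic_ext. Qed.

Lemma rot_fromK M N (u : dgHom M N) :
  homotopic (dgHom_comp (rot_from u) (rot_to u)) (dgHom_id _).
Proof.
apply: (homotopicI (h := fun i (x : cone (cone_in u) (i + gg1)) =>
  (- x.2.2, (0, 0)) : cone (cone_in u) i)).
- by move=> i x y; congr (_, (_, _)); rewrite /= ?addr0 // opprD.
- move=> i j k e e' a x.
  have -> (p : cone (cone_in u) k) s :
      koszul s p = (koszul s p.1, (koszul s p.2.1, koszul s p.2.2)).
    by rewrite /koszul; case: ifP; case: p => [? []].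
  congr (_, (_, _)); rewrite /= ?gact0r ?koszul_0 // parity_gg1 mul1r koszulK.
  by rewrite gactNr (eq_irrelevance e' (shift_degree gg1 e)).
move=> i [n [m n']]; congr (_, (_, _)) => /=.
- by rewrite dgm_dN (eq_irrelevance (shift_degree_d _ _) erefl); abel.
- by rewrite dgm_d0; abel.
by rewrite dgm_d0 gh0; abel.
Qed.

Lemma cone_rot M N (u : dgHom M N) :
  @tri_iso K (@homotopyShift G A) N (cone u) (cone (cone_in u))
    (cone_in u) (cone_in (cone_in u)) (cone_out (cone_in u))
    N (cone u) (dgShift M) (cone_in u) (cone_out u)
    (hopp (K_preadditive A) (dgHom_shift u : hom (dgShift M : K) (dgShift N))).
Proof.
exists (dgHom_id N), (dgHom_id (cone u)), (rot_to u); split.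
  split; [exact: (@iso_id K) | exact: (@iso_id K) |].
  by exists (rot_from u); split; [apply: rot_fromK | apply: rot_toK].
split; try exact: homotopic_ext.
apply: (@iso_epic K _ _ _ (rot_from u)); last exact: homotopic_ext.
by exists (rot_to u); split; [apply: rot_toK | apply: rot_fromK].
Qed.

(** ** The octahedron of cones *)

Section Octahedron.
Variables (X Y Z : dgMod A) (f : dgHom X Y) (g : dgHom Y Z).
Local Notation gf := (dgHom_comp g f).

Program Definition octa_u : dgHom (cone f) (cone gf) :=
  @DgHom G A (cone f) (cone gf) (@GrHom G A (cone f) (cone gf)
    (fun i (x : cone f i) => (x.1, g i x.2) : cone gf i) _ _) _.
Next Obligation. by move=> i x y; congr (_, _); rewrite /= ghD. Qed.
Next Obligation. by move=> i j k e a x; congr (_, _); rewrite /= gh_act. Qed.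
Next Obligation. by move=> i j e x; congr (_, _); rewrite /= ghD dgh_d. Qed.

Program Definition octa_v : dgHom (cone gf) (cone g) :=
  @DgHom G A (cone gf) (cone g) (@GrHom G A (cone gf) (cone g)
    (fun i (x : cone gf i) => (f (i + gg1) x.1, x.2) : cone g i) _ _) _.
Next Obligation. by move=> i x y; congr (_, _); rewrite /= ghD. Qed.
Next Obligation.
move=> i j k e a x; congr (_, _) => /=.
by rewrite (morphD_koszul (@ghD _ _ _ _ f _)) gh_act.
Qed.
Next Obligation.
move=> i j e x; congr (_, _) => /=; first by rewrite ghN dgh_d.
by rewrite gh_cast.
Qed.

(** The cone of [cone f -> cone gf] is [cone g], up to a contractible summand with
    underlying graded module [X[1][1] + X[1] ]. *)
Program Definition octa_to : dgHom (cone octa_u) (cone g) :=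
  @DgHom G A (cone octa_u) (cone g) (@GrHom G A (cone octa_u) (cone g)
    (fun i (x : cone octa_u i) => (x.1.2 + f (i + gg1) x.2.1, x.2.2) : cone g i) _ _) _.
Next Obligation.
by move=> i x y; congr (_, _); rewrite /= ?ghD // addrACA.
Qed.
Next Obligation.
move=> i j k e a x; congr (_, _) => /=.
rewrite (morphD_koszul (@ghD _ _ _ _ f _)) gh_act gactDr koszulD; congr (_ + _).
by rewrite /koszul; case: ifP.
Qed.
Next Obligation.
move=> i j e x; case: _ / e; congr (_, _) => /=; last by rewrite ghD addrA.
rewrite dgm_dD !ghD !ghN !dgh_d !(eq_irrelevance (shift_degree_d _ _) erefl).
abel.
Qed.

Program Definition octa_from : dgHom (cone g) (cone octa_u) :=
  @DgHom G A (cone g) (cone octa_u) (@GrHom G A (cone g) (cone octa_u)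
    (fun i (x : cone g i) => ((0, x.1), (0, x.2)) : cone octa_u i) _ _) _.
Next Obligation.
by move=> i x y; congr ((_, _), (_, _)); rewrite /= ?addr0.
Qed.
Next Obligation.
move=> i j k e a x; congr (_, _) => /=; last by rewrite gact0r koszul_0.
by rewrite koszul_pair /= gact0r !koszul_0.
Qed.
Next Obligation.
move=> i j e x; case: _ / e; congr ((_, _), (_, _)) => /=.
- by rewrite dgm_d0 !oppr0.
- by rewrite !(eq_irrelevance (shift_degree_d _ _) erefl) /= gh0; abel.
- by rewrite dgm_d0; abel.
by rewrite !gh0; abel.
Qed.

Lemma octa_toK : homotopic (dgHom_comp octa_to octa_from) (dgHom_id _).
Proof. by apply: homotopic_ext => i x /=; rewrite gh0 addr0; case: x. Qed.

Lemma octa_fromK : homotopic (dgHom_comp octa_from octa_to) (dgHom_id _).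
Proof.
apply: (homotopicI (h := fun i (x : cone octa_u (i + gg1)) =>
  ((- x.2.1, 0), (0, 0)) : cone octa_u i)).
- by move=> i x y; congr ((_, _), (_, _)); rewrite /= ?addr0 // opprD.
- move=> i j k e e' a x.
  have -> (p : cone octa_u k) s : koszul s p =
      ((koszul s p.1.1, koszul s p.1.2), (koszul s p.2.1, koszul s p.2.2)).
    by rewrite /koszul; case: ifP; case: p => [[? ?] [? ?]].
  congr ((_, _), (_, _)); rewrite /= ?koszul_pair /= ?gact0r ?koszul_0 //.
  rewrite parity_gg1 !mul1r koszulK gactNr koszulN; congr (- koszul _ _).
  by congr gact; apply: eq_irrelevance.
move=> i [[x y] [x' z]]; congr ((_, _), (_, _)) => /=.
- by rewrite !(eq_irrelevance (shift_degree_d _ _) erefl) dgm_dN; abel.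
- by rewrite !(eq_irrelevance (shift_degree_d _ _) erefl) /= dgm_d0 ghN; abel.
- by rewrite dgm_d0; abel.
by rewrite dgm_d0 !gh0; abel.
Qed.

Lemma cone_octa :
  @tri_iso K (@homotopyShift G A) (cone f) (cone gf) (cone octa_u)
    octa_u (cone_in octa_u) (cone_out octa_u) (cone f) (cone gf) (cone g)
    octa_u octa_v (dgHom_comp (dgHom_shift (cone_in f)) (cone_out g)).
Proof.
have toI : @is_iso K _ _ octa_to.
  by exists octa_from; split; [apply: octa_fromK | apply: octa_toK].
exists (dgHom_id _), (dgHom_id _), octa_to; split.
  by split=> //; apply: (@iso_id K).
split; try exact: homotopic_ext.
  by apply: homotopic_ext => i x; congr (_, _); rewrite /= add0r.
apply: (@iso_epic K _ _ _ octa_from).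
  by exists octa_to; split; [apply: octa_toK | apply: octa_fromK].
by apply: homotopic_ext => i x; congr (_, _); rewrite /= gh0 addr0.
Qed.
End Octahedron.

Lemma K_triangulated : @triangulated (K_Mod A) (K_preadditive A).
Proof.
apply: (@cones_triangulated (K_Mod A) (K_preadditive A)
  (fun M N u => cone u) (fun M N u => cone_in u) (fun M N u => cone_out u)).
- by [].
- split; first by exists (dgZero A); apply: dgZero_zero.
  by move=> M N; exists (dgSum M N); apply: dgSum_biproduct.
- by move=> M N f g; apply: homotopic_ext.
- exact: shift_equivalence.
- exact: cone_idm_zero.
- move=> X Y X' Y' u u' a b [h [hD hA hd]].
  by exists (cone_map hD hA hd); split; [apply: cone_map_in | apply: cone_map_out].
- exact: cone_rot.
move=> X Y Z f g; exists (octa_u f g), (octa_v f g); split; first exact: cone_octa.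
split; apply: homotopic_ext => i x //.
by congr (_, _); rewrite /= gh0.
Qed.
End Cones.

(** * Acyclicity and graded projectivity *)

Section Acyclic.
Variables (G : gradingGroup) (A : dgRing G).
Implicit Types M N L : dgMod A.
Local Notation K := (homotopyCat A).

Lemma cycle_d M i j (e : i + gg1 = j) (x : M i) : cycle x -> dgm_d e x = 0.
Proof. by move=> cx; apply: cx. Qed.

Lemma cycleI M i (x : M i) : dgm_d (erefl (i + gg1)) x = 0 -> cycle x.
Proof. by move=> cx j e; case: _ / e. Qed.

Lemma acyclic_iso M N : isomorphic (M : K) (N : K) -> acyclic M -> acyclic N.
Proof.
move=> [f [g [_ [h [hD hA hd]]]]] aM i y cy.
have [|j [e [x xE]]] := aM i (g i y); first by move=> j e; rewrite -dgh_d cy // gh0.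
exists j, e, (f j x - h i j e y).
rewrite dgm_dD dgm_dN -dgh_d xE.
have := hd i j _ e erefl y; rewrite /= cy (morphD0 (hD _ _ _)) addr0 => <-.
by abel.
Qed.

(** Both directions are the exactness of the cohomology sequence of a cone, unwound
    to elements. *)
Lemma quasi_iso_cone M N (f : dgHom M N) : quasi_iso f <-> acyclic (cone f).
Proof.
split=> [qf i [x y] cxy|aC].
  have [/= dx fx] : dgm_d (erefl (i + gg1)) ((x, y) : cone f i) = 0 :> cone f _ by apply: cxy.
  have cx : @cycle _ _ M _ x.
    apply: cycleI; apply: (inv_inj (@opprK _)); rewrite oppr0 -dx.
    by rewrite (eq_irrelevance (shift_degree_d _ _) erefl).
  have [|j [e [x1 x1E]]] := (qf (i + gg1)).1 x cx.
    exists i, erefl, (- y); rewrite dgm_dN; apply/eqP; rewrite eq_sym -subr_eq0 opprK.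
    exact/eqP.
  have ji : j = i by apply: addIr e.
  subst j; rewrite (eq_irrelevance e erefl) {e} in x1E.
  have [|x2 [cx2 [j [e [y1 y1E]]]]] := (qf i).2 (y + f i x1).
    by apply: cycleI; rewrite dgm_dD -dgh_d x1E (addrC (dgm_d _ _)).
  exists j, e, (ecast z (M z) (esym e) (x2 - x1), y1).
  subst i => /=; congr (_, _) => /=.
    rewrite (eq_irrelevance (shift_degree_d _ _) erefl) dgm_dD dgm_dN x1E cycle_d //.
    by abel.
  by rewrite y1E ghD ghN; abel.
move=> i; split=> [x cx [j [e [y dy]]]|y cy].
  subst i; have [|j' [e' [[u v] [/= du fuv]]]] := aC j (x, - y).
    apply: cycleI; congr (_, _) => /=.
      by rewrite (eq_irrelevance (shift_degree_d _ _) erefl) cycle_d // oppr0.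
    by rewrite dgm_dN dy subrr.
  exists (j' + gg1), (shift_degree_d gg1 e'), (- u).
  by rewrite dgm_dN.
have [|j [e [[u v] [/= du fuv]]]] := aC i (0, y).
  by apply: cycleI; congr (_, _); rewrite /= ?dgm_d0 ?oppr0 // gh0 cycle_d // addr0.
subst i; exists u; split.
  apply: cycleI; apply: (inv_inj (@opprK _)); rewrite oppr0 -du.
  by rewrite (eq_irrelevance (shift_degree_d _ _) erefl).
by exists j, erefl, v; rewrite -fuv; abel.
Qed.

Lemma acyclic_unshift M : acyclic (dgShift M) -> acyclic M.
Proof.
move=> aM; apply: grading_shift => i x cx.
by apply/boundary_shift/aM/cycle_shift.
Qed.

Lemma quasi_iso_comp M N L (g : dgHom N L) (f : dgHom M N) :
  quasi_iso g -> quasi_iso f -> quasi_iso (dgHom_comp g f).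
Proof.
move=> qg qf i; have [gi gs] := qg i; have [fi fs] := qf i; split.
  move=> x cx bx; apply: fi => //; apply: gi => // j e.
  by rewrite -dgh_d cx // gh0.
move=> z cz; have [y [cy [j [e [w wE]]]]] := gs z cz.
have [x [cx [j' [e' [w' w'E]]]]] := fs y cy.
have jj : j' = j by apply: (addIr gg1); rewrite e e'.
subst j'; rewrite (eq_irrelevance e' e) {e'} in w'E.
exists x; split=> //; exists j, e, (w + g j w').
by rewrite dgm_dD wE -dgh_d w'E ghD ghN /=; abel.
Qed.

Lemma quasi_iso_dist (X Y Z : K_Mod A) (f : hom X Y) (g : hom Y Z) (h : hom Z (shift X)) :
  distinguished f g h -> (quasi_iso f <-> acyclic (Z : dgMod A)).
Proof.
move=> fgh; have pK := triangulated_pre (K_triangulated A).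
have d : @distinguished (K_Mod A) _ _ _ f (cone_in f) (cone_out f).
  exists X, Y, f, (idm (X : K)), (idm (Y : K)), (idm (cone f : K)).
  by split; [split; apply: iso_id | split; apply: homotopic_ext].
have [c cI _] := cone_uniq pK d fgh; have [c' [c'c cc']] := cI.
split=> [/quasi_iso_cone|aZ]; first by apply: acyclic_iso; exists c.
by apply/quasi_iso_cone; apply: acyclic_iso aZ; exists c', c.
Qed.

(** ** Graded projective modules *)

Lemma gr_projective_sum (M N : grMod A) :
  gr_projective M -> gr_projective N -> gr_projective (grSum M N).
Proof.
move=> pM pN U L p f p_surj.
have inlD i : {morph (fun x : M i => f i (x, 0)) : x y / x + y}.
  by move=> x y; rewrite -ghD; congr (f i (_, _)); rewrite addr0.
have inlA i j k (e : i + j = k) (a : A i) (x : M j) :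
    f k (gact e a x, 0) = gact e a (f j (x, 0)).
  by rewrite -gh_act; congr (f k (_, _)); rewrite gact0r.
have inrD i : {morph (fun x : N i => f i (0, x)) : x y / x + y}.
  by move=> x y; rewrite -ghD; congr (f i (_, _)); rewrite addr0.
have inrA i j k (e : i + j = k) (a : A i) (x : N j) :
    f k (0, gact e a x) = gact e a (f j (0, x)).
  by rewrite -gh_act; congr (f k (_, _)); rewrite gact0r.
have [g1 g1E] := pM U L p (GrHom inlD inlA) p_surj.
have [g2 g2E] := pN U L p (GrHom inrD inrA) p_surj.
have gD i : {morph (fun x : grSum M N i => g1 i x.1 + g2 i x.2) : x y / x + y}.
  by move=> x y; rewrite !ghD addrACA.
have gA i j k (e : i + j = k) (a : A i) (x : grSum M N j) :
    g1 k (gact e a x).1 + g2 k (gact e a x).2 = gact e a (g1 j x.1 + g2 j x.2).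
  by rewrite !gh_act gactDr.
exists (GrHom gD gA) => i [x y] /=; rewrite ghD g1E g2E /= -ghD.
by congr (f i (_, _)); rewrite ?addr0 ?add0r.
Qed.

Lemma gr_projective_zero : gr_projective (dgZero A).
Proof.
move=> U L p f p_surj; have z i (x : dgZero A i) : x = 0 by rewrite [x]thinmx0.
have gD i : {morph (fun x : dgZero A i => 0 : U i) : x y / x + y}.
  by move=> x y; rewrite addr0.
have gA i j k (e : i + j = k) (a : A i) (x : dgZero A j) : 0 = gact e a (0 : U j).
  by rewrite gact0r.
by exists (GrHom gD gA) => i x; rewrite (z i x) !gh0.
Qed.

(** In [recollement_of_resolutions], [W] is taken to be the class of
    quasi-isomorphisms, [N] that of acyclic dg modules and [Pr] that of graded projective
    ones. *)
Theorem recollement_of_dg_resolutions :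
  (forall M, exists (S : dgMod A) (p : dgHom S M), [/\ gr_projective S,
     forall N, acyclic N -> forall f : dgHom S N, homotopic f (dgHom_zero S N)
     & quasi_iso p]) ->
  (forall X : dgMod A, gr_projective X -> exists (R : dgMod A) (r : dgHom X R), [/\ gr_projective R,
     forall Y : dgMod A, gr_projective Y -> acyclic Y ->
       forall f : dgHom Y R, homotopic f (dgHom_zero Y R)
     & quasi_iso r]) ->
  recollement (Kac_incl A) (K_to_D A).
Proof.
move=> H1 H2.
apply: (@recollement_of_resolutions (K_Mod A) (K_preadditive A) (K_triangulated A)
  (@acyclic G A) (@acyclic_shift G A) (@acyclic_unshift)
  (@quasi_iso G A) (@quasi_iso_shift G A) quasi_iso_dist
  (fun M : dgMod A => gr_projective M)
  (fun M pM => @gr_projective_shift _ _ gg1 _ pM)).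
- by exists (dgZero A); [apply: gr_projective_zero | apply: dgZero_zero].
- move=> M N pM pN; exists (dgSum M N); last exact: dgSum_biproduct.
  exact: gr_projective_sum.
- move=> M pM; exists (dgUnshift M); last exact: unshift_isomorphic.
  exact: gr_projective_shift.
- move=> M N f pM pN; exists (cone f), (cone_in f), (cone_out f); split.
    by apply: gr_projective_sum => //; apply: gr_projective_shift.
  exists M, N, f, (idm (M : K)), (idm (N : K)), (idm (cone f : K)).
  by split; [split; apply: iso_id | split; apply: homotopic_ext].
- exact: H1.
exact: H2.
Qed.
End Acyclic.

(** * Free graded modules *)

Section Free.
Variables (G : gradingGroup) (A : grRing G) (B : Type) (deg : B -> G).
Implicit Types (b : B) (k : G).

(** The generators form an arbitrary type, without decidable equality; finiteness of
    the support is stated through a list in the classical copy of that type. *)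
Definition free_carrier k : Type :=
  {v : forall b, A (k - deg b) |
   exists s : seq {classic B}, forall b, (b : {classic B}) \notin s -> v b = 0}.

Definition coef k (v : free_carrier k) b : A (k - deg b) := sval v b.
Arguments coef : simpl never.

Lemma free_eq k (u v : free_carrier k) : (forall b, coef u b = coef v b) -> u = v.
Proof.
case: u v => [u pu] [v pv] uv; apply: eq_exist.
exact: functional_extensionality_dep.
Qed.

Program Definition free_zero k : free_carrier k := exist _ (fun=> 0) _.
Next Obligation. by move=> k; exists [::]. Qed.

Program Definition free_add k (u v : free_carrier k) : free_carrier k :=
  exist _ (fun b => coef u b + coef v b) _.
Next Obligation.
move=> k [u [s us]] [v [t vt]]; exists (s ++ t) => b; rewrite mem_cat negb_or.
by case/andP => bs bt; rewrite /coef /= us // vt // addr0.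
Qed.

Program Definition free_opp k (u : free_carrier k) : free_carrier k :=
  exist _ (fun b => - coef u b) _.
Next Obligation. by move=> k [u [s us]]; exists s => b bs; rewrite /coef /= us // oppr0. Qed.

Lemma free_addA k : associative (@free_add k).
Proof. by move=> u v w; apply: free_eq => b; apply: addrA. Qed.
Lemma free_addC k : commutative (@free_add k).
Proof. by move=> u v; apply: free_eq => b; apply: addrC. Qed.
Lemma free_add0 k : left_id (free_zero k) (@free_add k).
Proof. by move=> u; apply: free_eq => b; apply: add0r. Qed.
Lemma free_addN k : left_inverse (free_zero k) (@free_opp k) (@free_add k).
Proof. by move=> u; apply: free_eq => b; apply: addNr. Qed.

HB.instance Definition _ k := gen_eqMixin (free_carrier k).
HB.instance Definition _ k := gen_choiceMixin (free_carrier k).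
HB.instance Definition _ k := GRing.isZmodule.Build (free_carrier k)
  (@free_addA k) (@free_addC k) (@free_add0 k) (@free_addN k).

Definition free_grp k : zmodType := free_carrier k.

Lemma coefD k (u v : free_grp k) b : coef (u + v) b = coef u b + coef v b.
Proof. by []. Qed.
Lemma coefN k (u : free_grp k) b : coef (- u) b = - coef u b.
Proof. by []. Qed.
Lemma coef0 k b : coef (0 : free_grp k) b = 0.
Proof. by []. Qed.

Definition supp k (v : free_grp k) : seq {classic B} := undup (sval (cid (svalP v))).

Lemma supp_uniq k (v : free_grp k) : uniq (supp v).
Proof. exact: undup_uniq. Qed.

Lemma coef_supp k (v : free_grp k) b : (b : {classic B}) \notin supp v -> coef v b = 0.
Proof. by rewrite mem_undup => bs; apply: (svalP (cid (svalP v))). Qed.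

(** Membership in the submodule spanned by [T].  Such submodules are handled
    as predicates on elements rather than as modules of their own. *)
Definition within (T : set B) k (v : free_grp k) : Prop :=
  forall b, ~ T b -> coef v b = 0.

(** ** Monomials *)

Definition mono_fun k b (a : A (k - deg b)) b' : A (k - deg b') :=
  match pselect (b = b') with
  | left e => match e in _ = b' return A (k - deg b') with erefl => a end
  | right _ => 0
  end.

Lemma mono_fun_eq k b (a : A (k - deg b)) : mono_fun a b = a.
Proof.
rewrite /mono_fun; case: pselect => // e.
by rewrite (Prop_irrelevance e erefl).
Qed.

Lemma mono_fun_ne k b b' (a : A (k - deg b)) : b <> b' -> mono_fun a b' = 0.
Proof. by rewrite /mono_fun; case: pselect. Qed.

Program Definition mono k b (a : A (k - deg b)) : free_grp k :=
  exist _ (mono_fun a) _.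
Next Obligation.
move=> k b a; exists [:: b : {classic B}] => b'; rewrite inE => /eqP bb.
by apply: mono_fun_ne => e; apply: bb.
Qed.

Lemma coef_mono k b (a : A (k - deg b)) : coef (mono a) b = a.
Proof. exact: mono_fun_eq. Qed.

Lemma coef_mono_ne k b b' (a : A (k - deg b)) : b <> b' -> coef (mono a) b' = 0.
Proof. exact: mono_fun_ne. Qed.

Lemma monoD k b : {morph @mono k b : a c / a + c}.
Proof.
move=> a c; apply: free_eq => b'; rewrite coefD.
have [<-|ne] := pselect (b = b'); first by rewrite !coef_mono.
by rewrite !coef_mono_ne ?addr0.
Qed.

(** ** Additive maps out of a free module *)

Section Extension.
Variables (k : G) (V : zmodType) (theta : forall b, A (k - deg b) -> V).
Arguments theta : clear implicits.
Hypothesis thetaD : forall b, {morph theta b : a c / a + c}.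

(** The sum runs over a list chosen for [v], on which it does not depend. *)
Definition fext (v : free_grp k) : V := \sum_(b <- supp v) theta b (coef v b).

Let theta0 b : theta b 0 = 0. Proof. exact: morphD0 (@thetaD b). Qed.

Lemma fextE (s : seq {classic B}) (v : free_grp k) :
  uniq s -> (forall b : {classic B}, b \notin s -> coef v b = 0) ->
  fext v = \sum_(b <- s) theta b (coef v b).
Proof.
have H (s1 s2 : seq {classic B}) : uniq s1 -> uniq s2 -> {subset s1 <= s2} ->
    (forall b : {classic B}, b \notin s1 -> coef v b = 0) ->
    \sum_(b <- s2) theta b (coef v b) = \sum_(b <- s1) theta b (coef v b).
  move=> u1 u2 s12 v0; rewrite (bigID (mem s1)) /= [X in _ + X]big1 => [|b bs]; last first.
    by rewrite v0 // theta0.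
  rewrite addr0 -big_filter; apply: perm_big; apply: uniq_perm => //.
    exact: filter_uniq.
  by move=> b; rewrite mem_filter; case: (boolP (b \in s1)) => //= /s12.
move=> us v0; pose t := undup (s ++ supp v).
rewrite /fext -(H (supp v) t) ?undup_uniq //; last first.
- exact: coef_supp.
- by move=> b bs; rewrite mem_undup mem_cat bs orbT.
by apply: H; rewrite ?undup_uniq // => b bs; rewrite mem_undup mem_cat bs.
Qed.

Lemma fextD : {morph fext : u v / u + v}.
Proof.
move=> u v; pose s := undup (supp u ++ supp v).
have us : uniq s by apply: undup_uniq.
rewrite !(@fextE s) // => [|b|b|b]; rewrite ?mem_undup ?mem_cat ?negb_or.
- by rewrite -big_split; apply: eq_bigr => b _; rewrite coefD thetaD.
- by case/andP => _; apply: coef_supp.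
- by case/andP => bu _; apply: coef_supp.
by case/andP => bu bv; rewrite coefD !coef_supp // addr0.
Qed.

Lemma fext_mono b (a : A (k - deg b)) : fext (mono a) = theta b a.
Proof.
rewrite (@fextE [:: b : {classic B}]) //.
  by rewrite big_seq1 coef_mono.
move=> b'; rewrite inE => /eqP bb; apply: coef_mono_ne => e.
exact: bb.
Qed.
End Extension.

Lemma free_sum k (v : free_grp k) : v = \sum_(b <- supp v) mono (coef v b).
Proof.
rewrite -[RHS]/(fext (@mono k) v); apply: free_eq => b.
have cD : {morph (fun v : free_grp k => coef v b) : u v / u + v} by [].
have [bs|bs] := boolP ((b : {classic B}) \in supp v); last first.
  rewrite coef_supp // /fext (big_morph _ cD (coef0 k b)) big_seq big1 // => b' b's.
  by rewrite coef_mono_ne // => bb; rewrite -bb b's in bs.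
rewrite /fext (big_morph _ cD (coef0 k b)) (bigD1_seq _ bs (supp_uniq v)) /=.
rewrite coef_mono big1 ?addr0 // => b' /eqP bb.
by rewrite coef_mono_ne // => e; apply: bb.
Qed.

(** The form in which identities are checked on monomials: it also applies to
    maps which are additive but not linear, such as differentials. *)
Lemma additive_ext k (V : zmodType) (f g : free_grp k -> V) (v : free_grp k) :
  {morph f : x y / x + y} -> {morph g : x y / x + y} ->
  (forall b, coef v b != 0 -> f (mono (coef v b)) = g (mono (coef v b))) -> f v = g v.
Proof.
move=> fD gD fg; rewrite (free_sum v).
rewrite (big_morph _ fD (morphD0 fD)) (big_morph _ gD (morphD0 gD)).
apply: eq_bigr => b _; have [v0|/fg//] := eqVneq (coef v b) 0.
by rewrite v0 (morphD0 (@monoD k b)) (morphD0 fD) (morphD0 gD).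
Qed.

(** ** The module structure *)

Lemma free_degree (i j k : G) b : i + j = k -> i + (j - deg b) = k - deg b.
Proof. by move=> <-; rewrite addrA. Qed.

Lemma gmul0r i j k (e : i + j = k) (a : A i) : gmul e a (0 : A j) = 0.
Proof. exact: morphD0 (gmulDr e a). Qed.

Program Definition free_act i j k (e : i + j = k) (a : A i) (v : free_grp j) : free_grp k :=
  exist _ (fun b => gmul (free_degree b e) a (coef v b)) _.
Next Obligation.
by move=> i j k e a v; exists (supp v) => b bs; rewrite coef_supp // gmul0r.
Qed.

Program Definition freeMod : grMod A := @GrMod G A free_grp free_act _ _ _ _.
Next Obligation.
by move=> i j k e v a a'; apply: free_eq => b; rewrite /coef /= gmulDl.
Qed.
Next Obligation.
by move=> i j k e a u v; apply: free_eq => b; rewrite /coef /= gmulDr.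
Qed.
Next Obligation.
move=> i j l ij jl m e1 e2 e3 e4 a c v; apply: free_eq => b; rewrite /coef /=.
exact: gmulA.
Qed.
Next Obligation. by move=> i e v; apply: free_eq => b; rewrite /coef /= gmul1l. Qed.

Lemma coef_act i j k (e : i + j = k) (a : A i) (v : freeMod j) b :
  coef (gact e a v) b = gmul (free_degree b e) a (coef v b).
Proof. by []. Qed.

Lemma act_mono i j k (e : i + j = k) (a : A i) b (c : A (j - deg b)) :
  gact e a (mono c : freeMod j) = mono (gmul (free_degree b e) a c).
Proof.
apply: free_eq => b'; rewrite coef_act.
have [<-|ne] := pselect (b = b'); first by rewrite !coef_mono.
by rewrite !coef_mono_ne // gmul0r.
Qed.

Definition gen b : freeMod (deg b) := mono (ecast z (A z) (esym (subrr (deg b))) (gone A)).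

Lemma gmul_gone_cast i j k (ej : 0 = j) (e : i + j = k) (ek : i = k) (a : A i) :
  gmul e a (ecast z (A z) ej (gone A)) = ecast z (A z) ek a.
Proof. by case: _ / ek e => e; case: _ / ej e => e /=; rewrite gmul1r. Qed.

Lemma monoE k b (a : A (k - deg b)) : mono a = gact (subrK (deg b) k) a (gen b).
Proof.
rewrite act_mono; congr mono.
by rewrite (gmul_gone_cast _ _ erefl).
Qed.

(** ** The universal property *)

Section Linear.
Variables (N : grMod A) (y : forall b, N (deg b)).

Definition lin_fun k : free_grp k -> N k :=
  fext (fun b (a : A (k - deg b)) => gact (subrK (deg b) k) a (y b)).

Lemma lin_funD k : {morph @lin_fun k : u v / u + v}.
Proof. by apply: fextD => b a c; rewrite gactDl. Qed.

Lemma lin_fun_mono k b (a : A (k - deg b)) :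
  lin_fun (mono a) = gact (subrK (deg b) k) a (y b).
Proof. by apply: fext_mono => b0 c d; rewrite gactDl. Qed.

Lemma lin_fun_act i j k (e : i + j = k) (a : A i) (v : freeMod j) :
  lin_fun (gact e a v) = gact e a (lin_fun v).
Proof.
apply: (additive_ext (f := fun v : freeMod j => lin_fun (gact e a v))
  (g := fun v => gact e a (lin_fun v))) => [u w|u w|b _].
- by rewrite gactDr lin_funD.
- by rewrite lin_funD gactDr.
by rewrite act_mono !lin_fun_mono; apply: gactA.
Qed.

Lemma lin_subproof : {f : grHom freeMod N | forall k v, f k v = @lin_fun k v}.
Proof. by exists (@GrHom G A freeMod N lin_fun lin_funD lin_fun_act). Qed.

(* Sealed, so that simplification does not expose the finite sum. *)
Definition lin : grHom freeMod N := sval lin_subproof.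

Lemma lin_mono k b (a : A (k - deg b)) : lin k (mono a) = gact (subrK (deg b) k) a (y b).
Proof. by rewrite /lin (svalP lin_subproof) lin_fun_mono. Qed.

Lemma lin_gen b : lin (deg b) (gen b) = y b.
Proof.
rewrite lin_mono; move: (subrK _ _) (esym _); rewrite subrr => e e'.
by rewrite (eq_irrelevance e' erefl) gact1.
Qed.
End Linear.

Lemma lin_ext_within (T : set B) (N : grMod A) (f g : grHom freeMod N) k (v : freeMod k) :
  within T v -> (forall b, T b -> f (deg b) (gen b) = g (deg b) (gen b)) -> f k v = g k v.
Proof.
move=> vT fg; apply: (additive_ext (@ghD _ _ _ _ f k) (@ghD _ _ _ _ g k)) => b vb.
rewrite monoE !gh_act fg //; apply: contrapT => /vT vb0.
by rewrite vb0 eqxx in vb.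
Qed.

Lemma lin_ext (N : grMod A) (f g : grHom freeMod N) :
  (forall b, f (deg b) (gen b) = g (deg b) (gen b)) -> forall k (v : freeMod k), f k v = g k v.
Proof. by move=> fg k v; apply: (@lin_ext_within setT) => // b nb; case: nb. Qed.

Lemma free_gr_projective : gr_projective freeMod.
Proof.
move=> N L p f p_surj.
pose y b := sval (cid (p_surj _ (f (deg b) (gen b)))).
have yE b : p _ (y b) = f _ (gen b) := svalP (cid (p_surj _ (f (deg b) (gen b)))).
exists (lin y); apply: (@lin_ext _ (grHom_comp p (lin y)) f) => b.
by rewrite /= lin_gen yE.
Qed.
End Free.
Arguments coef : simpl never.

(** ** Sums of linear maps *)

Section GrHomAdd.
Variables (G : gradingGroup) (R : grRing G) (M N : grMod R).

Program Definition grHom_add (f g : grHom M N) : grHom M N :=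
  @GrHom G R M N (fun i x => f i x + g i x) _ _.
Next Obligation. by move=> f g i x y /=; rewrite !ghD addrACA. Qed.
Next Obligation. by move=> f g i j k e a x /=; rewrite !gh_act gactDr. Qed.

Program Definition grHom_opp (f : grHom M N) : grHom M N :=
  @GrHom G R M N (fun i x => - f i x) _ _.
Next Obligation. by move=> f i x y /=; rewrite ghD opprD. Qed.
Next Obligation. by move=> f i j k e a x /=; rewrite gh_act gactNr. Qed.

Program Definition grHom_zero : grHom M N := @GrHom G R M N (fun i x => 0) _ _.
Next Obligation. by move=> i x y /=; rewrite addr0. Qed.
Next Obligation. by move=> i j k e a x /=; rewrite gact0r. Qed.
End GrHomAdd.

(** * Graded modules with a derivation and free dg modules *)

Section Derivations.
Variables (G : gradingGroup) (A : dgRing G).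

(** The condition that the differential squares to zero is left out, since on a free module
    it is itself proved on generators by means of the commutators below. *)
Record derMod := DerMod {
  der_gr :> grMod A;
  der_d : forall i j : G, i + gg1 = j -> der_gr i -> der_gr j;
  der_dD : forall i j (e : i + gg1 = j), {morph der_d e : x y / x + y};
  der_leibniz : forall i j k i' j' k' (e : i + j = k)
      (ei : i + gg1 = i') (ej : j + gg1 = j') (ek : k + gg1 = k')
      (el : i' + j = k') (er : i + j' = k') (a : A i) x,
    der_d ek (gact e a x) =
      gact el (dgr_d ei a) x + koszul (parity i) (gact er a (der_d ej x))
}.

Definition der_of_dg (M : dgMod A) : derMod :=
  DerMod (@dgm_dD _ _ M) (@dgm_leibniz _ _ M).

(** ** The commutator [d H - H d] of a linear map with the derivations *)

Section Commutator.
Variables (M N : derMod) (H : grHom M N).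

Definition comm_fun i (x : M i) : N (i + gg1) :=
  der_d (erefl (i + gg1)) (H i x) - H (i + gg1) (der_d (erefl (i + gg1)) x).

Lemma comm_funD i : {morph @comm_fun i : x y / x + y}.
Proof. by move=> x y; rewrite /comm_fun !(ghD, der_dD); abel. Qed.

Lemma comm_fun_act i j k (e : i + j = k) (a : A i) (x : M j) :
  @comm_fun k (gact e a x) =
  @gact _ _ (grShift gg1 N) _ _ _ e a (comm_fun x : grShift gg1 N j).
Proof.
have el : i + gg1 + j = k + gg1 by rewrite addrAC e.
rewrite /comm_fun gh_act /= parity_gg1 mul1r.
rewrite !(der_leibniz e erefl erefl erefl el (shift_degree gg1 e)).
rewrite ghD (morphD_koszul (@ghD _ _ _ _ H (k + gg1))) !gh_act.
by rewrite gactDr gactNr koszulD koszulN; abel.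
Qed.

(** The commutator is linear because the terms of the Leibniz rule that involve the
    differential of the scalars cancel; hence it is determined by its values on
    generators. *)
Definition comm : grHom M (grShift gg1 N) := @GrHom G A M (grShift gg1 N) comm_fun comm_funD comm_fun_act.
End Commutator.

(** ** The free derivation module on prescribed differentials *)

Section FreeDer.
Variables (B : Type) (deg : B -> G) (D : forall b, freeMod A deg (deg b + gg1)).
Local Notation F := (freeMod A deg).

Lemma free_degree_d (i j : G) b : i + gg1 = j -> i - deg b + gg1 = j - deg b.
Proof. by move=> <-; rewrite addrAC. Qed.

Lemma free_degree_D (i j : G) b : i + gg1 = j -> i - deg b + (deg b + gg1) = j.
Proof. by move=> <-; rewrite addrA subrK. Qed.

Definition free_d i j (e : i + gg1 = j) : F i -> F j :=
  fext (fun b (c : A (i - deg b)) => mono (dgr_d (free_degree_d b e) c) +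
    koszul (parity (i - deg b)) (gact (free_degree_D b e) c (D b))).

Let theta_D i j (e : i + gg1 = j) b :
  {morph (fun c : A (i - deg b) => mono (dgr_d (free_degree_d b e) c) +
    koszul (parity (i - deg b)) (gact (free_degree_D b e) c (D b))) : c c' / c + c'}.
Proof. by move=> c c'; rewrite dgr_dD monoD gactDl koszulD addrACA. Qed.

Lemma free_dD i j (e : i + gg1 = j) : {morph free_d e : u v / u + v}.
Proof. by apply: fextD => b; apply: theta_D. Qed.

Lemma free_d_mono i j (e : i + gg1 = j) b (c : A (i - deg b)) :
  free_d e (mono c) = mono (dgr_d (free_degree_d b e) c) +
    koszul (parity (i - deg b)) (gact (free_degree_D b e) c (D b)).
Proof. by apply: fext_mono => b'; apply: theta_D. Qed.

Lemma free_leibniz i j k i' j' k' (e : i + j = k)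
    (ei : i + gg1 = i') (ej : j + gg1 = j') (ek : k + gg1 = k')
    (el : i' + j = k') (er : i + j' = k') (a : A i) (v : F j) :
  free_d ek (gact e a v) =
    gact el (dgr_d ei a) v + koszul (parity i) (gact er a (free_d ej v)).
Proof.
apply: (@additive_ext _ _ _ _ j (F k') (fun v : F j => free_d ek (gact e a v))
  (fun v : F j => gact el (dgr_d ei a) v + koszul (parity i) (gact er a (free_d ej v))))
  => [u w|u w|b _].
- by rewrite gactDr free_dD.
- by rewrite free_dD !gactDr koszulD addrACA.
rewrite act_mono !free_d_mono act_mono gactDr act_mono.
rewrite (dgr_leibniz (free_degree deg b e) ei (free_degree_d b ej) (free_degree_d b ek)
  (free_degree deg b el) (free_degree deg b er)).
rewrite monoD (morphD_koszul (@monoD _ _ _ _ _ b)) koszulD addrA; congr (_ + _).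
rewrite (gactA _ _ (free_degree_D b ej) er).
rewrite (morphD_koszul (gactDr _ a)) koszulM.
have -> // : parity (k - deg b) = parity i + parity (j - deg b).
by rewrite -raddfD -e /= addrA.
Qed.

Definition freeDer : derMod := @DerMod F free_d free_dD free_leibniz.

Lemma dgr_d_one j (e : 0 + gg1 = j) : dgr_d e (gone A) = 0.
Proof.
have := @dgr_leibniz G A 0 0 0 j j j (addr0 0) e e e
  (etrans (addr0 j) erefl) (etrans (add0r j) erefl) (gone A) (gone A).
rewrite gmul1l gmul1r raddf0 koszul0 gmul1l => E.
by apply: (addrI (dgr_d e (gone A))); rewrite addr0 -E.
Qed.

Lemma dgr_d_cast i i' j' (ei : i = i') (e : i + gg1 = j') (e' : i' + gg1 = j') (a : A i) :
  dgr_d e' (ecast z (A z) ei a) = dgr_d e a.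
Proof. by case: _ / ei e' => e'; rewrite (eq_irrelevance e e'). Qed.

Lemma gact_one_cast (M : grMod A) i j (e0 : 0 = i) (e : i + j = j) (x : M j) :
  gact e (ecast z (A z) e0 (gone A)) x = x.
Proof. by case: _ / e0 e => e /=; rewrite gact1. Qed.

Lemma free_d_gen b : free_d (erefl (deg b + gg1)) (gen A deg b) = D b.
Proof.
rewrite free_d_mono gact_one_cast.
have e0 : 0 + gg1 = deg b + gg1 - deg b by rewrite addrAC subrr.
rewrite (dgr_d_cast (esym (subrr (deg b))) e0) dgr_d_one.
rewrite (morphD0 (@monoD _ _ _ _ _ b)) add0r.
have -> : parity (deg b - deg b) = 0 by rewrite subrr raddf0.
by [].
Qed.

(** With [F' = 0] this recognizes dg morphisms, with [F'] a dg morphism to a shift it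
    recognizes null homotopies. *)
Lemma comm_ext_within (T : set B) (N : derMod) (H : grHom freeDer N)
    (F' : grHom freeDer (grShift gg1 N)) i (v : F i) :
  within T v ->
  (forall b, T b -> der_d (erefl (deg b + gg1)) (H (deg b) (gen A deg b)) -
     H (deg b + gg1) (D b) = F' (deg b) (gen A deg b)) ->
  der_d (erefl (i + gg1)) (H i v) - H (i + gg1) (free_d (erefl (i + gg1)) v) = F' i v.
Proof.
move=> vT HF; rewrite -[LHS]/(comm H i v).
apply: (@lin_ext_within _ _ _ _ T (grShift gg1 N) (comm H) F' i v vT) => b Tb; rewrite -HF //.
by rewrite /comm /comm_fun /= free_d_gen.
Qed.

Lemma comm_ext (N : derMod) (H : grHom freeDer N)
    (F' : grHom freeDer (grShift gg1 N)) :
  (forall b, der_d (erefl (deg b + gg1)) (H (deg b) (gen A deg b)) -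
     H (deg b + gg1) (D b) = F' (deg b) (gen A deg b)) ->
  forall i (v : F i), der_d (erefl (i + gg1)) (H i v) -
    H (i + gg1) (free_d (erefl (i + gg1)) v) = F' i v.
Proof. by move=> HF i v; apply: (@comm_ext_within setT) => // b nb; case: nb. Qed.

Hypothesis DD : forall b, free_d (erefl (deg b + gg1 + gg1)) (D b) = 0.

Lemma free_dd i j k (e : i + gg1 = j) (e' : j + gg1 = k) (v : F i) :
  free_d e' (free_d e v) = 0.
Proof.
apply: (@additive_ext _ _ _ _ i (F k) (fun v : F i => free_d e' (free_d e v))
  (fun v : F i => 0)) => [u w|u w|b _]; first by rewrite !free_dD.
  by rewrite addr0.
move: (coef v b) => c; rewrite monoE.
case: _ / e' => {k}; case: _ / e => {j v}.
have e1 : i - deg b + gg1 + deg b = i + gg1 by rewrite addrAC subrK.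
have e2 : i - deg b + (deg b + gg1) = i + gg1 by rewrite addrA subrK.
rewrite (free_leibniz _ erefl erefl erefl e1 e2) free_d_gen free_dD.
have e3 : i - deg b + gg1 + gg1 + deg b = i + gg1 + gg1 by rewrite -e1 -!addrA (addrC gg1 (_ + _)) -!addrA.
have e4 : i - deg b + gg1 + (deg b + gg1) = i + gg1 + gg1 by rewrite -e1 addrA.
have e5 : i - deg b + (deg b + gg1 + gg1) = i + gg1 + gg1 by rewrite -e2 addrA.
rewrite (free_leibniz e1 erefl erefl erefl e3 e4) free_d_gen dgr_dd gact0l add0r.
rewrite (morphD_koszul (free_dD _)) (free_leibniz e2 erefl erefl erefl e4 e5) DD gact0r.
rewrite koszul_0 addr0 raddfD /= parity_gg1 -koszulM koszul1.
by rewrite koszulN addNr.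
Qed.

Definition freeDg : dgMod A := @DgMod G A F free_d free_dD free_dd free_leibniz.

Lemma freeDg_hom (N : dgMod A) (y : forall b, N (deg b)) :
  (forall b, dgm_d (erefl (deg b + gg1)) (y b) = lin y (deg b + gg1) (D b)) ->
  exists f : dgHom freeDg N, forall i v, f i v = lin y i v.
Proof.
move=> yd; suff fd i j (e : i + gg1 = j) (v : freeDg i) :
    lin y j (dgm_d e v) = dgm_d e (lin y i v).
  by exists (@DgHom G A freeDg N (lin y) fd).
case: _ / e; symmetry; apply/eqP; rewrite -subr_eq0; apply/eqP.
apply: (@comm_ext (der_of_dg N) (lin y) (grHom_zero F (grShift gg1 N))) => b.
by rewrite (lin_gen y) /= yd subrr.
Qed.
End FreeDer.
End Derivations.

Local Open Scope classical_set_scope.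

(** * Sub dg modules spanned by generators *)

Section Within.
Variables (G : gradingGroup) (A : dgRing G) (B : Type) (deg : B -> G).
Local Notation F := (freeMod A deg).
Implicit Types T : set B.

Lemma within0 T k : within T (0 : F k).
Proof. by []. Qed.

Lemma withinD T k (u v : F k) : within T u -> within T v -> within T (u + v).
Proof. by move=> uT vT b nT; rewrite coefD uT // vT // addr0. Qed.

Lemma withinN T k (u : F k) : within T u -> within T (- u).
Proof. by move=> uT b nT; rewrite coefN uT // oppr0. Qed.

Lemma withinB T k (u v : F k) : within T u -> within T v -> within T (u - v).
Proof. by move=> uT vT; apply: withinD => //; apply: withinN. Qed.

Lemma within_koszul T k s (u : F k) : within T u -> within T (koszul s u).
Proof. by move=> uT; rewrite /koszul; case: ifP => // _; apply: withinN. Qed.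

Lemma within_act T i j k (e : i + j = k) (a : A i) (v : F j) :
  within T v -> within T (gact e a v).
Proof. by move=> vT b nT; rewrite coef_act vT // gmul0r. Qed.

Lemma within_mono T k b (c : A (k - deg b)) : T b -> within T (mono c).
Proof. by move=> Tb b' nT; apply: coef_mono_ne => bb; apply: nT; rewrite -bb. Qed.

Lemma within_sub T T' k (v : F k) : T `<=` T' -> within T v -> within T' v.
Proof. by move=> TT vT b nT; apply: vT => /TT. Qed.

Lemma within_sum T k n (v : 'I_n -> F k) :
  (forall l, within T (v l)) -> within T (\sum_(l < n) v l).
Proof.
move=> vT; elim/big_rec: _ => [|l u _ uT]; first exact: within0.
exact: withinD.
Qed.

Program Definition restr T k (v : F k) : F k :=
  exist _ (fun b => if pselect (T b) then coef v b else 0) _.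
Next Obligation.
move=> T k v; exists (supp v) => b bs /=; case: pselect => // Tb.
exact: coef_supp.
Qed.

Lemma restr_within T k (v : F k) : within T (restr T v).
Proof. by move=> b nT; rewrite /coef /=; case: pselect. Qed.

Lemma within_restr T T' k (v : F k) : within T' v -> within (T' `\` T) (v - restr T v).
Proof.
move=> vT b nb; rewrite coefD coefN [coef (restr _ _) _]/coef /=.
case: pselect => [Tb|nT] /=; first by rewrite subrr.
by rewrite subr0; apply: vT => T'b; apply: nb.
Qed.

Lemma within_additive (B' : Type) (deg' : B' -> G) T (T' : set B') k k'
    (f : F k -> freeMod A deg' k') (v : F k) :
  {morph f : x y / x + y} -> within T v ->
  (forall b (c : A (k - deg b)), T b -> within T' (f (mono c))) -> within T' (f v).
Proof.
move=> fD vT H b' nT.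
apply: (@additive_ext _ _ _ _ k (A (k' - deg' b')) (fun v : F k => coef (f v) b')
  (fun v : F k => 0)) => [x y|x y|b vb]; rewrite ?addr0 ?fD //.
by apply: H => //; apply: contrapT => /vT vb0; rewrite vb0 eqxx in vb.
Qed.

Lemma within_lin (B' : Type) (deg' : B' -> G) T (T' : set B')
    (y : forall b, freeMod A deg' (deg b)) k (v : F k) :
  within T v -> (forall b, T b -> within T' (y b)) -> within T' (lin y k v).
Proof.
move=> vT yT; apply: (within_additive (@ghD _ _ _ _ (lin y) k) vT) => b c Tb.
by rewrite lin_mono => b' nT; rewrite coef_act (yT b) // gmul0r.
Qed.

(** Supports are finite.  The base [T0] allows for the empty chain. *)
Lemma within_chain T0 (C : set (set B)) k (v : F k) : total_on C subset ->
  within (T0 `|` \bigcup_(T in C) T) v ->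
  within T0 v \/ exists2 T, C T & within (T0 `|` T) v.
Proof.
move=> Ctot vC.
have H (s : seq {classic B}) :
    (forall b : {classic B}, b \in s -> (T0 `|` \bigcup_(T in C) T) b) ->
    (forall b : {classic B}, b \in s -> T0 b) \/
    exists2 T, C T & forall b : {classic B}, b \in s -> (T0 `|` T) b.
  elim: s => [_|b s IH bs]; first by left.
  have inU (T : set B) : (T0 `|` T) b ->
      (forall b : {classic B}, b \in s -> (T0 `|` T) b) ->
      forall b' : {classic B}, b' \in b :: s -> (T0 `|` T) b'.
    by move=> Tb Ts b'; rewrite inE => /orP[/eqP ->|/Ts].
  have [|sT|[T CT sT]] := IH; first by move=> b' b's; apply: bs; rewrite inE b's orbT.
    have [Tb|[T CT Tb]] := bs b (mem_head _ _).
      by left=> b'; rewrite inE => /orP[/eqP ->|/sT].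
    by right; exists T => //; apply: inU; [right | left; apply: sT].
  right; have [Tb|[T1 CT1 Tb]] := bs b (mem_head _ _).
    by exists T => //; apply: inU => //; left.
  have [TT|TT] := Ctot _ _ CT CT1.
    exists T1 => //; apply: inU => [|b' /sT[]]; [by right | by left |].
    by move=> /TT; right.
  by exists T => //; apply: inU => //; right; apply: TT.
pose s : seq {classic B} := [seq b <- supp v | coef v b != 0].
have sE (b : {classic B}) : b \notin s -> coef v b = 0.
  rewrite mem_filter negb_and negbK => /orP[/eqP //|]; exact: coef_supp.
have wE T : (forall b : {classic B}, b \in s -> T b) -> within T v.
  by move=> sT b nT; apply: sE; apply/negP => /sT.
have [b|sT|[T CT sT]] := H s.
- rewrite mem_filter => /andP[/eqP vb _]; apply: contrapT => nC.
  by apply: vb; apply: vC.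
- by left; apply: wE.
by right; exists T => //; apply: wE.
Qed.

Section Closed.
Variable D : forall b, F (deg b + gg1).

(** The span of [T] is a dg submodule. *)
Definition closed_gens T : Prop := forall b, T b -> within T (D b).

Lemma within_d T i j (e : i + gg1 = j) (v : F i) :
  closed_gens T -> within T v -> within T (free_d D e v).
Proof.
move=> cT vT; apply: (within_additive (free_dD D e) vT) => b c Tb.
rewrite free_d_mono; apply: withinD; first exact: within_mono.
by apply: within_koszul; apply: within_act; apply: cT.
Qed.
End Closed.
End Within.

(** * Adjoining generators to a closed set *)

Section Attach.
Variables (G : gradingGroup) (A : dgRing G) (B : Type) (deg : B -> G).
Local Notation F := (freeMod A deg).
Variable D : forall b, F (deg b + gg1).
Hypothesis DD : forall b, free_d D (erefl (deg b + gg1 + gg1)) (D b) = 0.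
Variables (T : set B) (B1 : Type) (beta : B1 -> B).
Hypothesis beta_inj : injective beta.
Hypothesis betaT : forall j, ~ T (beta j).
Let T' : set B := T `|` range beta.
Hypothesis T_closed : closed_gens D T.
Hypothesis T'_closed : closed_gens D T'.
Let deg1 (j : B1) : G := deg (beta j).
Local Notation E := (freeMod A deg1).

Let beta_inv (b : {classic B}) : option B1 :=
  match pselect (exists j, beta j = b) with
  | left h => Some (sval (cid h))
  | right _ => None
  end.

Let beta_invK j : beta_inv (beta j) = Some j.
Proof.
rewrite /beta_inv; case: pselect => [h|[]]; last by exists j.
by congr Some; apply: beta_inj; apply: (svalP (cid h)).
Qed.

(** The quotient of the span of [T'] by that of [T] is free on [B1]: reading off the
    coefficients at the new generators is the projection. *)
Program Definition quo_fun k (v : F k) : E k := exist _ (fun j => coef v (beta j)) _.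
Next Obligation.
move=> k v; exists (pmap (beta_inv : {classic B} -> option {classic B1}) (supp v)) => j js.
rewrite /=; apply: (@coef_supp G A B deg k v (beta j)); apply/negP => bs; move/negP: js; apply.
by rewrite mem_pmap; apply/mapP; exists (beta j : {classic B}) => //; rewrite beta_invK.
Qed.

Lemma quo_subproof : {f : grHom F E | forall k v, f k v = @quo_fun k v}.
Proof.
have fD k : {morph @quo_fun k : u v / u + v} by move=> u v; apply: free_eq.
have fA i j k (e : i + j = k) (a : A i) (v : F j) :
    quo_fun (gact e a v) = gact e a (quo_fun v : E j).
  by apply: free_eq => b; congr gmul; apply: eq_irrelevance.
by exists (@GrHom G A F E quo_fun fD fA).
Qed.

Definition quo : grHom F E := sval quo_subproof.

Lemma coef_quo k (v : F k) j : coef (quo k v) j = coef v (beta j).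
Proof. by rewrite /quo (svalP quo_subproof). Qed.

Lemma quo_mono k j (c : A (k - deg (beta j))) : quo k (mono c) = mono (c : A (k - deg1 j)).
Proof.
apply: free_eq => j'; rewrite coef_quo.
have [<-|ne] := pselect (j = j'); first by rewrite !coef_mono.
by rewrite !coef_mono_ne // => /beta_inj.
Qed.

Lemma quo_within k (v : F k) : within T v -> quo k v = 0.
Proof. by move=> vT; apply: free_eq => j; rewrite coef_quo coef0; apply: vT. Qed.

Lemma within_quo k (v : F k) : within T' v -> quo k v = 0 -> within T v.
Proof.
move=> vT' v0 b nT; have [[j _ <-]|nb] := pselect (range beta b).
  by rewrite -coef_quo v0 coef0.
by apply: vT' => -[].
Qed.

Definition lift_gens : grHom E F := lin (fun j => gen A deg (beta j)).

Lemma quo_lift k (u : E k) : quo k (lift_gens k u) = u.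
Proof.
apply: (@lin_ext _ _ _ _ E (grHom_comp quo lift_gens) (grHom_id E)) => j.
change (quo _ (lift_gens _ (gen A deg1 j)) = gen A deg1 j).
by rewrite /lift_gens lin_gen; apply: quo_mono.
Qed.

Lemma lift_within k (u : E k) : within T' (lift_gens k u).
Proof.
apply: (@within_lin _ _ _ _ _ _ setT) => [b []//|j _].
by apply: within_mono; right; exists j.
Qed.

Definition quoD j : E (deg1 j + gg1) := quo _ (D (beta j)).

Lemma quo_d i j (e : i + gg1 = j) (v : F i) :
  within T' v -> free_d quoD e (quo i v) = quo j (free_d D e v).
Proof.
move=> vT'.
apply: (@additive_ext _ _ _ _ i (E j) (fun v : F i => free_d quoD e (quo i v))
  (fun v : F i => quo j (free_d D e v))) => [x y|x y|b vb].
- by rewrite ghD free_dD.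
- by rewrite free_dD ghD.
have : T' b by apply: contrapT => /vT' vb0; rewrite vb0 eqxx in vb.
case=> [Tb|[b1 _ eb]].
  rewrite quo_within; last exact: within_mono.
  rewrite (morphD0 (free_dD _ _)) quo_within //.
  by apply: within_d => //; apply: within_mono.
move: (coef v b) => c {vb}; subst b.
rewrite quo_mono !free_d_mono ghD quo_mono; congr (_ + _).
  by congr mono; congr dgr_d; apply: eq_irrelevance.
rewrite (morphD_koszul (@ghD _ _ _ _ quo j)) gh_act.
by congr (koszul _ _); congr gact; apply: eq_irrelevance.
Qed.

Lemma quoDD j : free_d quoD (erefl (deg1 j + gg1 + gg1)) (quoD j) = 0.
Proof.
rewrite quo_d; first by rewrite DD gh0.
by apply: T'_closed; right; exists j.
Qed.

(** Such a chain is a cycle of the quotient; a lift of a chain that it bounds there is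
    what has to be subtracted. *)
Lemma push_into_base : acyclic (freeDg quoDD) ->
  forall i (x : F i), within T' x -> within T (free_d D (erefl (i + gg1)) x) ->
  exists j (e : j + gg1 = i) (y : F j), within T' y /\ within T (x - free_d D e y).
Proof.
move=> aE i x xT' dxT.
have [|j [e [u uE]]] := aE i (quo i x).
  by apply: cycleI; rewrite [LHS]quo_d // quo_within.
exists j, e, (lift_gens j u); split; first exact: lift_within.
apply: within_quo.
  by apply: withinB => //; apply: within_d => //; apply: lift_within.
by rewrite ghD ghN -quo_d ?quo_lift; [apply/eqP; rewrite subr_eq0 -uE | apply: lift_within].
Qed.

(** The converse of [push_into_base], by which the quotients in the filtration of
    an acyclic free dg module are recognized as acyclic. *)
Lemma quo_acyclic :
  (forall i (x : F i), within T' x -> within T (free_d D (erefl (i + gg1)) x) ->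
   exists j (e : j + gg1 = i) (y : F j), within T' y /\ within T (x - free_d D e y)) ->
  acyclic (freeDg quoDD).
Proof.
move=> rel i u cu; have [||j [e [y [yT' xy]]]] := rel i (lift_gens i u).
- exact: lift_within.
- apply: within_quo; first by apply: within_d => //; apply: lift_within.
  by rewrite -quo_d ?quo_lift; [apply: cu | apply: lift_within].
exists j, e, (quo j y); rewrite [LHS]quo_d //; apply/eqP.
by rewrite eq_sym -subr_eq0 -{1}(quo_lift u) -ghN -ghD quo_within.
Qed.

(** The first hypothesis says that every morphism from the quotient to [N[1] ] is
    null-homotopic.  After extending [h] by zero, the defect of the homotopy is a
    morphism that vanishes on [T], hence a morphism [Z] from the quotient; a null
    homotopy [K] of it corrects the extension at the new generators. *)
Lemma extend_homotopy (N : dgMod A) (f : dgHom (freeDg DD) (dgShift N))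
    (h : forall b, N (deg b)) :
  (forall z : forall j, N (deg1 j + gg1),
     (forall j, dgm_d (erefl (deg1 j + gg1 + gg1)) (z j) +
        @lin _ _ _ deg1 (grShift gg1 N) z (deg1 j + gg1) (quoD j) = 0) ->
     exists K : forall j, N (deg1 j), forall j,
       z j = dgm_d (erefl (deg1 j + gg1)) (K j) - lin K (deg1 j + gg1) (quoD j)) ->
  (forall b, T b -> f (deg b) (gen A deg b) =
     dgm_d (erefl (deg b + gg1)) (h b) - lin h (deg b + gg1) (D b)) ->
  exists h' : forall b, N (deg b), (forall b, T b -> h' b = h b) /\
    (forall b, T' b -> f (deg b) (gen A deg b) =
       dgm_d (erefl (deg b + gg1)) (h' b) - lin h' (deg b + gg1) (D b)).
Proof.
move=> null fh.
pose h0 b : N (deg b) := if pselect (T b) then h b else 0.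
have h0T b : T b -> h0 b = h b by rewrite /h0; case: pselect.
have h00 j : h0 (beta j) = 0.
  by rewrite /h0; case: pselect => // Tb; case: (betaT Tb).
have linT (h1 : forall b, N (deg b)) k (v : F k) : (forall b, T b -> h1 b = h b) ->
    within T v -> lin h1 k v = lin h k v.
  by move=> h1h vT; apply: (lin_ext_within vT) => b Tb; rewrite !lin_gen h1h.
pose z j : N (deg1 j + gg1) := f _ (gen A deg (beta j)) + lin h0 _ (D (beta j)).
pose Z := @lin _ _ _ deg1 (grShift gg1 N) z.
have quo_gen j : quo _ (gen A deg (beta j)) = gen A deg1 j by apply: quo_mono.
have Psi i (v : F i) : within T' v ->
    dgm_d (erefl (i + gg1)) (lin h0 i v) - lin h0 (i + gg1) (free_d D (erefl (i + gg1)) v)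
      = f i v - Z i (quo i v).
  move=> vT'; apply: (@comm_ext_within _ _ _ _ D T' (der_of_dg N) (lin h0)
    (grHom_add f (grHom_opp (grHom_comp Z quo))) i v vT') => b Tb.
  rewrite lin_gen /=; case: Tb => [Tb|[j _ <-]].
    rewrite h0T // (linT h0) //; last exact: T_closed.
    have -> : quo _ (gen A deg b) = 0 by apply: quo_within; apply: within_mono.
    by rewrite gh0 subr0 fh.
  rewrite h00 dgm_d0 quo_gen lin_gen /z.
  by abel.
have [j|K KE] := null z.
  rewrite dgm_dD.
  have := Psi _ (D (beta j)) (T'_closed (or_intror (ex_intro2 _ _ j I erefl))).
  rewrite DD gh0 subr0 => ->.
  have := @dgh_d _ _ _ _ f _ _ (erefl (deg (beta j) + gg1)) (gen A deg (beta j)).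
  rewrite /= free_d_gen => ->.
  rewrite (eq_irrelevance (shift_degree_d _ _) erefl).
  by abel.
pose hK b : N (deg b) :=
  match pselect (exists j, beta j = b) with
  | left e => eq_rect _ (fun b => N (deg b)) (K (sval (cid e))) b (svalP (cid e))
  | right _ => 0
  end.
have hKE j : hK (beta j) = K j.
  rewrite /hK; case: pselect => [e|[]]; last by exists j.
  case: (cid e) => j' /= ejj; have jj := beta_inj ejj; subst j'.
  by move: (svalP _) => e1; rewrite (Prop_irrelevance e1 erefl).
pose h' b : N (deg b) := if pselect (T b) then h b else hK b.
have h'T b : T b -> h' b = h b by rewrite /h'; case: pselect.
have h'b j : h' (beta j) = K j.
  by rewrite -hKE /h'; case: pselect => // Tb; case: (betaT Tb).
have h'E k (v : F k) : within T' v -> lin h' k v = lin h0 k v + lin K k (quo k v).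
  move=> vT'; apply: (lin_ext_within (g := grHom_add (lin h0) (grHom_comp (lin K) quo)) vT') => b Tb.
  rewrite lin_gen /= lin_gen; case: Tb => [Tb|[j _ <-]].
    rewrite quo_within; last exact: within_mono.
    by rewrite gh0 addr0 h'T // h0T.
  by rewrite quo_gen lin_gen h'b h00 add0r.
exists h'; split=> // b [Tb|[j _ <-]].
  by rewrite h'T // (linT h') ?fh //; apply: T_closed.
rewrite h'b h'E; last by apply: T'_closed; right; exists j.
have -> : dgm_d (erefl (deg (beta j) + gg1)) (K j) = z j + lin K _ (quoD j).
  by rewrite KE subrK.
rewrite /z -/(quoD j).
by abel.
Qed.
End Attach.

(** * Null homotopies on free dg modules *)

Section NullHomotopy.
Variables (G : gradingGroup) (A : dgRing G) (B : Type) (deg : B -> G).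
Variable D : forall b, freeMod A deg (deg b + gg1).
Hypothesis DD : forall b, free_d D (erefl (deg b + gg1 + gg1)) (D b) = 0.
Local Notation X := (freeDg DD).
Variables (N : dgMod A) (f : dgHom X (dgShift N)).

(** The target is a shift so that homotopies, of degree [-1], become linear maps of
    degree zero without sign: the equation is [f = d h - h d]. *)
Definition null_at (h : forall b, N (deg b)) b : Prop :=
  f (deg b) (gen A deg b) =
    dgm_d (erefl (deg b + gg1)) (h b) - lin h (deg b + gg1) (D b).

Lemma null_of_gens (h : forall b, N (deg b)) :
  (forall b, null_at h b) -> homotopic f (dgHom_zero X (dgShift N)).
Proof.
move=> fh.
have fE i (v : X i) : dgm_d (erefl (i + gg1)) (lin h i v) -
    lin h (i + gg1) (free_d D (erefl (i + gg1)) v) = f i v.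
  apply: (@comm_ext _ _ _ _ D (der_of_dg N) (lin h) f) => b.
  by rewrite lin_gen fh.
apply: (homotopicI (h := fun i (v : X (i + gg1)) => - lin h _ v : dgShift N i)).
- by move=> i u v; rewrite ghD opprD.
- move=> i j k e e' a v /=; rewrite gh_act gactNr !koszulN parity_gg1 mul1r koszulK.
  by rewrite (eq_irrelevance e' (shift_degree gg1 e)).
move=> i v; rewrite /= -fE (eq_irrelevance (shift_degree_d _ _) erefl) dgm_dN.
by abel.
Qed.

(** Zorn's lemma for partial null homotopies, ordered by extension.  The class [Pc]
    carries the invariants of the filtration along which the homotopy is built. *)
Lemma null_by_extension (Pc : set B -> Prop) :
  (forall T, Pc T -> closed_gens D T) ->
  (forall C : set (set B), C `<=` Pc -> total_on C subset -> Pc (\bigcup_(T in C) T)) ->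
  (forall T h, Pc T -> (forall b, T b -> null_at h b) -> (exists b, ~ T b) ->
     exists T' h', [/\ Pc T', T `<=` T', exists b, T' b /\ ~ T b,
       forall b, T b -> h' b = h b & forall b, T' b -> null_at h' b]) ->
  homotopic f (dgHom_zero X (dgShift N)).
Proof.
move=> Pclosed Pchain step.
pose ok (p : set B * (forall b, N (deg b))) :=
  Pc p.1 /\ forall b, p.1 b -> null_at p.2 b.
pose R (s t : {p | ok p}) := `[< (sval s).1 `<=` (sval t).1 /\
  forall b, (sval s).1 b -> (sval t).2 b = (sval s).2 b >].
have RP s t : R s t -> (sval s).1 `<=` (sval t).1 /\
    forall b, (sval s).1 b -> (sval t).2 b = (sval s).2 b by move/asboolP.
have local T h h' b : closed_gens D T -> T b -> (forall b, T b -> h' b = h b) ->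
    null_at h b -> null_at h' b.
  move=> cT Tb hh; rewrite /null_at hh // => ->; congr (_ - _).
  by apply: (lin_ext_within (cT _ Tb)) => b' Tb'; rewrite !lin_gen hh.
have bound (C : set {p | ok p}) : total_on C R -> exists t, forall s, C s -> R s t.
  move=> Ctot.
  pose T := \bigcup_(U in [set (sval s).1 | s in C]) U.
  pose h b : N (deg b) := match pselect (exists s, C s /\ (sval s).1 b) with
    | left e => (sval (sval (cid e))).2 b | right _ => 0 end.
  have hE s b : C s -> (sval s).1 b -> h b = (sval s).2 b.
    move=> Cs sb; rewrite /h; case: pselect => [e|[]]; last by exists s.
    case: (cid e) => s' [Cs' s'b] /=.
    by have [/RP[_ H]|/RP[_ H]] := Ctot _ _ Cs Cs'; [rewrite H | rewrite -H].
  have okT : ok (T, h).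
    split=> [|b] /=.
      apply: Pchain => [_ [s _ <-]|_ _ [s Cs <-] [s' Cs' <-]]; first exact: (svalP s).1.
      by have [/RP[]|/RP[]] := Ctot _ _ Cs Cs'; [left | right].
    move=> [_ [s Cs <-] sb]; apply: (local (sval s).1 (sval s).2) => //.
    - exact: Pclosed (svalP s).1.
    - by move=> b' sb'; apply: hE.
    exact: (svalP s).2.
  exists (exist _ (T, h) okT) => s Cs; apply/asboolP; split=> [b sb|b sb] /=.
    by exists (sval s).1 => //; exists s.
  exact: hE.
have Rrefl t : R t t by apply/asboolP; split.
have Rtrans r s t : R r s -> R s t -> R r t.
  move=> /RP[rs Hrs] /RP[st Hst]; apply/asboolP; split=> b rb; first exact/st/rs.
  by rewrite Hst ?Hrs //; apply: rs.
have [t0 _] : exists t0 : {p | ok p}, True.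
  by have [|t _] := bound set0; [move=> ? ? [] | exists t].
have [[[T h] [PT Th]] maxT] := ZL_preorder t0 Rrefl Rtrans bound.
have [full|/existsNP nfull] := pselect (forall b, T b).
  by apply: (@null_of_gens h) => b; apply: (Th b); apply: full.
have [T' [h' [PT' TT' [b [T'b nTb]] hh' T'h']]] := step T h PT Th nfull.
have okT' : ok (T', h') by [].
have /maxT/RP[/(_ b T'b)] // : R (exist ok (T, h) (conj PT Th)) (exist ok (T', h') okT').
exact/asboolP.
Qed.
End NullHomotopy.

(** * Expressions for elements of a free module *)

Section Expression.
Variables (G : gradingGroup) (A : grRing G) (B : Type) (deg : B -> G).

(** The coefficients are families indexed by all degrees, of which only one value is
    used.  In this form an expression can be an argument of the constructor of an
    inductive type of generators, where the degrees of the generators are not yet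
    defined. *)
Lemma free_expression (T : set B) k (v : freeMod A deg k) : within T v ->
  exists (n : nat) (a : 'I_n -> forall i, A i) (c : 'I_n -> B),
    (forall l, T (c l)) /\ v = \sum_(l < n) mono (a l (k - deg (c l))).
Proof.
move=> vT; pose s : seq {classic B} := [seq b <- supp v | coef v b != 0].
have sT (b : {classic B}) : b \in s -> T b.
  by rewrite mem_filter => /andP[/eqP nb _]; apply: contrapT => /vT.
exists (size s), (fun l i => if pselect (k - deg (tnth (in_tuple s) l) = i) is left e
  then ecast z (A z) e (coef v (tnth (in_tuple s) l)) else 0), (tnth (in_tuple s)).
split=> [l|]; first by apply: sT; apply: mem_tnth.
have vE : v = \sum_(b <- s) mono (coef v b).
  rewrite {1}(free_sum v) big_filter (bigID (fun b => coef v b != 0)) /=.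
  rewrite [X in _ + X]big1 ?addr0 // => b; rewrite negbK => /eqP ->.
  exact: morphD0 (@monoD _ _ _ _ k b).
rewrite [LHS]vE big_tnth; apply: eq_bigr => l _; congr mono.
case: pselect => [e|[]] //.
by rewrite (eq_irrelevance e erefl).
Qed.
End Expression.

(** * Cellular extensions *)

(** The [E s], free on [J s], are the dg modules to be attached.  Base cells carry the
    generators of a given free dg module, with its morphism [phi0] to [M].  The extension
    maps to [M] as well, so that the attaching data contain a null homotopy
    [h] of the composite [E s -> M] of the attaching map with that morphism. *)
Section Cells.
Variables (G : gradingGroup) (A : dgRing G).
Variables (S : Type) (J : S -> Type) (degE : forall s, J s -> G).
Arguments degE : clear implicits.
Variable DE : forall s (j : J s), freeMod A (degE s) (degE s j + gg1).
Arguments DE : clear implicits.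
Hypothesis DDE : forall s j, free_d (DE s) (erefl (degE s j + gg1 + gg1)) (DE s j) = 0.
Variables (B0 : Type) (deg0 : B0 -> G) (D0 : forall b, freeMod A deg0 (deg0 b + gg1)).
Hypothesis DD0 : forall b, free_d D0 (erefl (deg0 b + gg1 + gg1)) (D0 b) = 0.
Variables (M : dgMod A) (phi0 : forall b, M (deg0 b)).
Hypothesis phi0_d : forall b,
  dgm_d (erefl (deg0 b + gg1)) (phi0 b) = lin phi0 (deg0 b + gg1) (D0 b).

(** For each generator [j], the coefficients [a j] and the cells [c j] express the
    value at [j] of the attaching map; the last argument says which generator of the attached
    copy of [E s] is meant. *)
Inductive cell : Type :=
| Base of B0
| Cell s (n : J s -> nat) (a : forall j, 'I_(n j) -> forall i, A i)
    (c : forall j, 'I_(n j) -> cell) (h : forall j, M (degE s j)) of J s.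

Definition cdeg (t : cell) : G :=
  match t with Base b => deg0 b | Cell s _ _ _ _ j => degE s j end.

Local Notation F := (freeMod A cdeg).

Definition att s (n : J s -> nat) (a : forall j, 'I_(n j) -> forall i, A i)
    (c : forall j, 'I_(n j) -> cell) (j : J s) : F (degE s j + gg1) :=
  \sum_(l < n j) mono (a j l (degE s j + gg1 - cdeg (c j l))).

(** The differential of a cell and its image in [M], defined together by recursion
    on the cell.  Whether the data of a cell describe a morphism of complexes compatible
    with [M] can only be decided here, as it involves the differentials of earlier
    cells.  When they do not, [E s] is attached along zero and mapped to zero instead,
    which does no harm and keeps [cell] a plain inductive type. *)
Fixpoint dphi (t : cell) : F (cdeg t + gg1) * M (cdeg t) :=
  match t return F (cdeg t + gg1) * M (cdeg t) with
  | Base b => (lin (fun b => gen A cdeg (Base b)) _ (D0 b), phi0 b)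
  | Cell s n a c h j =>
    let z := att a c in
    let dz j := \sum_(l < n j)
      (mono (dgr_d (free_degree_d cdeg (c j l) (erefl (degE s j + gg1 + gg1))) (a j l _))
        + koszul (parity (degE s j + gg1 - cdeg (c j l)))
            (gact (free_degree_D cdeg (c j l) (erefl (degE s j + gg1 + gg1))) (a j l _)
              (dphi (c j l)).1)) in
    let phiz j := \sum_(l < n j)
      gact (subrK (cdeg (c j l)) (degE s j + gg1)) (a j l _) (dphi (c j l)).2 in
    let ok := forall j,
      dz j + @lin _ _ _ _ (grShift gg1 F) z (degE s j + gg1) (DE s j) = 0 /\
      phiz j = dgm_d (erefl (degE s j + gg1)) (h j) - lin h (degE s j + gg1) (DE s j) in
    let new := lin (fun j => gen A cdeg (Cell a c h j)) in
    if `[< ok >] then (z j + new _ (DE s j), h j) else (new _ (DE s j), 0)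
  end.

Definition cD (t : cell) : F (cdeg t + gg1) := (dphi t).1.
Definition cphi (t : cell) : M (cdeg t) := (dphi t).2.

Section OneCell.
Variables (s : S) (n : J s -> nat) (a : forall j, 'I_(n j) -> forall i, A i)
  (c : forall j, 'I_(n j) -> cell) (h : forall j, M (degE s j)).

(** The test made in the recursion [dphi], in terms of its result. *)
Definition cell_ok : Prop := forall j,
  free_d cD (erefl (degE s j + gg1 + gg1)) (att a c j)
    + @lin _ _ _ _ (grShift gg1 F) (att a c) (degE s j + gg1) (DE s j) = 0 /\
  lin cphi (degE s j + gg1) (att a c j)
    = dgm_d (erefl (degE s j + gg1)) (h j) - lin h (degE s j + gg1) (DE s j).

Definition new_cells : grHom (freeMod A (degE s)) F :=
  @lin _ _ _ (degE s) F (fun j => gen A cdeg (Cell a c h j)).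

Lemma new_cells_gen j :
  new_cells (degE s j) (gen A (degE s) j) = gen A cdeg (Cell a c h j).
Proof. exact: (@lin_gen _ _ _ (degE s) F (fun j => gen A cdeg (Cell a c h j))). Qed.

Lemma dphi_cell j : dphi (Cell a c h j) =
  if `[< cell_ok >] then (att a c j + new_cells _ (DE s j), h j) else (new_cells _ (DE s j), 0).
Proof.
rewrite /=; congr (if _ then _ else _); apply: asbool_equiv_eq.
have dE j' : free_d cD (erefl (degE s j' + gg1 + gg1)) (att a c j') =
    \sum_(l < n j') free_d cD (erefl (degE s j' + gg1 + gg1)) (mono (@a j' l (degE s j' + gg1 - cdeg (@c j' l)))).
  exact: (big_morph _ (free_dD cD _) (morphD0 (free_dD cD _))).
have pE j' : lin cphi (degE s j' + gg1) (att a c j') =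
    \sum_(l < n j') lin cphi (degE s j' + gg1) (mono (@a j' l (degE s j' + gg1 - cdeg (@c j' l)))).
  exact: (big_morph _ (@ghD _ _ _ _ (lin cphi) _) (gh0 _ _)).
split=> H j'; have [H1 H2] := H j'; split.
- by rewrite dE -[RHS]H1; congr (_ + _); apply: eq_bigr => l _; rewrite free_d_mono.
- by rewrite pE -[RHS]H2; apply: eq_bigr => l _; rewrite lin_mono.
- by rewrite -[RHS]H1 dE; congr (_ + _); apply: eq_bigr => l _; rewrite free_d_mono.
by rewrite -[RHS]H2 pE; apply: eq_bigr => l _; rewrite lin_mono.
Qed.

Lemma cD_cell j : cD (Cell a c h j) =
  (if `[< cell_ok >] then att a c j else 0) + new_cells _ (DE s j).
Proof. by rewrite /cD dphi_cell; case: ifP; rewrite //= add0r. Qed.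

Lemma cphi_cell j : cphi (Cell a c h j) = if `[< cell_ok >] then h j else 0.
Proof. by rewrite /cphi dphi_cell; case: ifP. Qed.
End OneCell.

Lemma cD_base b : cD (Base b) = lin (fun b => gen A cdeg (Base b)) _ (D0 b).
Proof. by []. Qed.

Lemma base_comm i (v : freeMod A deg0 i) :
  free_d cD (erefl (i + gg1)) (lin (fun b => gen A cdeg (Base b)) i v) =
    lin (fun b => gen A cdeg (Base b)) (i + gg1) (free_d D0 (erefl (i + gg1)) v).
Proof.
apply/eqP; rewrite -subr_eq0; apply/eqP.
apply: (@comm_ext _ _ _ _ D0 (freeDer cD) (lin (fun b => gen A cdeg (Base b)))
  (grHom_zero _ _)) => b.
by rewrite (lin_gen (fun b => gen A cdeg (Base b))) [LHS]/= (free_d_gen cD (Base b)) cD_base subrr.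
Qed.

(** The square of the differential of a new cell is that of [E s] plus the defect of the
    attaching map, which vanishes in both cases of the definition. *)
Lemma cDD t : free_d cD (erefl (cdeg t + gg1 + gg1)) (cD t) = 0.
Proof.
case: t => [b|s n a c h j]; first by rewrite cD_base base_comm DD0 gh0.
pose att_hom : grHom (freeMod A (degE s)) (grShift gg1 F) :=
  if `[< cell_ok a c h >] then @lin _ _ _ (degE s) (grShift gg1 F) (att a c)
  else grHom_zero _ _.
have newd i (v : freeMod A (degE s) i) :
    free_d cD (erefl (i + gg1)) (new_cells a c h i v) -
    new_cells a c h (i + gg1) (free_d (DE s) (erefl (i + gg1)) v) = att_hom i v.
  apply: (@comm_ext _ _ _ _ (DE s) (freeDer cD) (new_cells a c h) att_hom) => j'.
  rewrite new_cells_gen [LHS]/= (free_d_gen cD (Cell a c h j')) cD_cell addrK.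
  rewrite /att_hom; case: ifP => // _.
  by rewrite (@lin_gen _ _ _ (degE s) (grShift gg1 F) (att a c)).
rewrite cD_cell free_dD.
have := newd _ (DE s j); rewrite DDE gh0 subr0 => ->.
rewrite /att_hom; case: ifP => [/asboolP ok|_]; first by have [] := ok j.
by rewrite (morphD0 (free_dD cD _)) add0r.
Qed.

Definition cellMod : dgMod A := freeDg cDD.

Lemma cellMod_to : exists f : dgHom cellMod M, forall i v, f i v = lin cphi i v.
Proof.
apply: freeDg_hom => -[b|s n a c h j].
  rewrite cD_base [LHS]phi0_d; symmetry.
  apply: (@lin_ext _ _ _ _ M (grHom_comp (lin cphi) (lin (fun b => gen A cdeg (Base b))))
    (lin phi0)) => b'.
  rewrite lin_gen -[LHS]/(lin cphi _ (lin (fun b => gen A cdeg (Base b)) _ (gen A deg0 b'))).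
  by rewrite (lin_gen (fun b => gen A cdeg (Base b))) (lin_gen cphi (Base b')).
rewrite cD_cell cphi_cell ghD.
have -> i v : lin cphi i (new_cells a c h i v) =
    @lin _ _ _ (degE s) M (fun j => if `[< cell_ok a c h >] then h j else 0) i v.
  apply: (@lin_ext _ _ _ _ M (grHom_comp (lin cphi) (new_cells a c h))
    (@lin _ _ _ (degE s) M (fun j => if `[< cell_ok a c h >] then h j else 0))) => j'.
  rewrite lin_gen -[LHS]/(lin cphi _ (new_cells a c h _ _)) new_cells_gen
    (lin_gen cphi (Cell a c h j')).
  exact: cphi_cell.
case: ifP => [/asboolP ok|_]; first by have [_ ->] := ok j; rewrite subrK.
rewrite gh0 add0r [LHS]dgm_d0; symmetry.
by apply: (@lin_ext _ _ _ _ M (@lin _ _ _ (degE s) M (fun j => 0)) (grHom_zero _ _))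
  => j'; rewrite lin_gen.
Qed.

Lemma cellMod_from : exists f : dgHom (freeDg DD0) cellMod,
  forall i v, f i v = lin (fun b => gen A cdeg (Base b)) i v.
Proof.
apply: (@freeDg_hom _ _ _ _ _ _ cellMod (fun b => gen A cdeg (Base b))) => b.
by rewrite [LHS]/= (free_d_gen cD (Base b)) cD_base.
Qed.

(** The extension is its own next step: no attaching map is left, however many
    generators [E s] has, because the constructor of cells takes a family of expressions. *)
Lemma cell_attach s (z : forall j, F (degE s j + gg1)) (h : forall j, M (degE s j)) :
  (forall j, free_d cD (erefl (degE s j + gg1 + gg1)) (z j)
    + @lin _ _ _ (degE s) (grShift gg1 F) z (degE s j + gg1) (DE s j) = 0) ->
  (forall j, lin cphi (degE s j + gg1) (z j)
    = dgm_d (erefl (degE s j + gg1)) (h j) - lin h (degE s j + gg1) (DE s j)) ->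
  exists (n : J s -> nat) (a : forall j, 'I_(n j) -> forall i, A i)
    (c : forall j, 'I_(n j) -> cell), forall j,
    cD (Cell a c h j) = z j + new_cells a c h _ (DE s j) /\ cphi (Cell a c h j) = h j.
Proof.
move=> zd zphi.
have expr j : exists (n : nat) (a : 'I_n -> forall i, A i) (c : 'I_n -> cell),
    z j = \sum_(l < n) mono (a l (degE s j + gg1 - cdeg (c l))).
  have [|n [a [c [_ E]]]] := @free_expression _ _ _ _ setT _ (z j).
    by move=> b nb; case: nb.
  by exists n, a, c.
pose n j := sval (cid (expr j)).
pose a j := sval (cid (svalP (cid (expr j)))).
pose c j := sval (cid (svalP (cid (svalP (cid (expr j)))))).
have zE j : att (n := n) a c j = z j.
  by symmetry; apply: (svalP (cid (svalP (cid (svalP (cid (expr j))))))).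
have ok : cell_ok (n := n) a c h.
  rewrite /cell_ok; have -> : att (n := n) a c = z by apply: functional_extensionality_dep.
  by split; [apply: zd | apply: zphi].
exists n, a, c => j.
by rewrite cD_cell cphi_cell (asboolT ok) zE.
Qed.

(** ** Filtering the cells *)

(** The copies of the [E s] are added as a whole. *)
Definition saturated (T : set cell) : Prop := forall s n a c h j j',
  T (@Cell s n a c h j) -> T (@Cell s n a c h j').

Lemma cell_inj s n a c h : injective (@Cell s n a c h).
Proof.
move=> j j' e.
pose gen_of t : option {s : S & J s} :=
  if t is Cell s _ _ _ _ j then Some (existT J s j) else None.
have [e'] : Some (existT J s j) = Some (existT J s j') := congr1 gen_of e.
have := projT2_eq e'; rewrite /= (Prop_irrelevance (projT1_eq e') erefl).
by [].
Qed.

(** Well-foundedness of the type of cells takes the place of an ordinal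
    filtration. *)
Lemma next_cell (T : set cell) : saturated T -> (forall b, T (Base b)) ->
  (exists t, ~ T t) -> exists s n a c h (j0 : J s),
    (forall j, ~ T (@Cell s n a c h j)) /\ forall j l, T (c j l).
Proof.
move=> satT baseT [t]; elim: t => [b /(_ (baseT b))//|s n a c IH h j nT].
have [[j' [l nTc]]|ex] := pselect (exists j' l, ~ T (c j' l)); first exact: IH nTc.
exists s, n, a, c, h, j; split=> [j' Tj'|j' l]; first by apply: nT; apply: satT Tj'.
by apply: contrapT => nTc; apply: ex; exists j', l.
Qed.

Section OneStep.
Variables (T : set cell) (s : S) (n : J s -> nat)
  (a : forall j, 'I_(n j) -> forall i, A i)
  (c : forall j, 'I_(n j) -> cell) (h : forall j, M (degE s j)).
Hypothesis T_closed : closed_gens cD T.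
Hypothesis T_sat : saturated T.
Hypothesis newT : forall j, ~ T (Cell a c h j).
Hypothesis attT : forall j (l : 'I_(n j)), T (c l).
Let beta := Cell a c h.
Let T' : set cell := T `|` range beta.

Let att_within j : within T (if `[< cell_ok a c h >] then att a c j else 0).
Proof.
case: ifP => _; last exact: within0.
by apply: within_sum => l; apply: within_mono; apply: attT.
Qed.

Lemma step_closed : closed_gens cD T'.
Proof.
move=> t [Tt|[j _ <-]].
  by apply: within_sub (T_closed Tt); apply: subsetUl.
rewrite cD_cell; apply: withinD.
  by apply: within_sub (att_within j); apply: subsetUl.
apply: (@within_lin _ _ _ (degE s) _ _ setT) => [b nb|j' _]; first by case: nb.
by apply: within_mono; right; exists j'.
Qed.

Lemma step_saturated : saturated T'.
Proof.
move=> s1 n1 a1 c1 h1 j j' [Tj|[j1 _ e]]; first by left; apply: T_sat Tj.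
pose siblings t : set cell :=
  if t is Cell s n a c h _ then range (@Cell s n a c h) else set0.
have e' : siblings (Cell a c h j1) = siblings (Cell a1 c1 h1 j) by rewrite -e.
by right; rewrite -[range beta]/(siblings (Cell a c h j1)) e'; exists j'.
Qed.

Let binj : injective beta := @cell_inj s n a c h.

(* So the lemmas on adjoining generators apply with [E s] as the quotient. *)
Let step_quoD : quoD cD binj = DE s.
Proof.
apply: functional_extensionality_dep => j.
rewrite /quoD /beta cD_cell ghD (quo_within binj newT (att_within j)) add0r.
exact: (quo_lift binj (DE s j)).
Qed.

Lemma step_push : acyclic (freeDg (@DDE s)) ->
  forall i (x : F i), within T' x -> within T (free_d cD (erefl (i + gg1)) x) ->
  exists j (e : j + gg1 = i) (y : F j), within T' y /\ within T (x - free_d cD e y).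
Proof.
move=> aE; apply: (@push_into_base _ _ _ _ cD cDD T _ beta binj newT T_closed step_closed).
move: (quoDD _ _ _ _ _); rewrite step_quoD => qDD.
by rewrite (Prop_irrelevance qDD (@DDE s)).
Qed.

Lemma step_extend (N : dgMod A) (f : dgHom cellMod (dgShift N)) (k : forall t, N (cdeg t)) :
  (forall z : forall j, N (degE s j + gg1),
     (forall j, dgm_d (erefl (degE s j + gg1 + gg1)) (z j) +
        @lin _ _ _ (degE s) (grShift gg1 N) z (degE s j + gg1) (DE s j) = 0) ->
     exists K : forall j, N (degE s j), forall j,
       z j = dgm_d (erefl (degE s j + gg1)) (K j) - lin K (degE s j + gg1) (DE s j)) ->
  (forall t, T t -> null_at f k t) ->
  exists k', (forall t, T t -> k' t = k t) /\ forall t, T' t -> null_at f k' t.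
Proof.
move=> null kT; apply: (@extend_homotopy _ _ _ _ cD cDD T _ beta binj newT T_closed
  step_closed N f k _ kT).
by rewrite step_quoD; apply: null.
Qed.
End OneStep.

(** A null homotopy is extended over one copy of [E s] at a time. *)
Lemma cellMod_null (N : dgMod A) (f : dgHom cellMod (dgShift N)) :
  (B0 -> False) ->
  (forall s (z : forall j, N (degE s j + gg1)),
     (forall j, dgm_d (erefl (degE s j + gg1 + gg1)) (z j) +
        @lin _ _ _ (degE s) (grShift gg1 N) z (degE s j + gg1) (DE s j) = 0) ->
     exists K : forall j, N (degE s j), forall j,
       z j = dgm_d (erefl (degE s j + gg1)) (K j) - lin K (degE s j + gg1) (DE s j)) ->
  homotopic f (dgHom_zero cellMod (dgShift N)).
Proof.
move=> noB0 null.
apply: (null_by_extension (Pc := fun T => closed_gens cD T /\ saturated T)).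
- by move=> T [].
- move=> C CP _; split.
    move=> t [T CT Tt]; have [cT _] := CP _ CT.
    by apply: within_sub (cT _ Tt) => u Tu; exists T.
  move=> s n a c h j j' [T CT Tj]; have [_ sT] := CP _ CT.
  by exists T => //; apply: sT Tj.
move=> T k [cT sT] kT nT.
have [|s [n [a [c [h [j0 [new att_T]]]]]]] := next_cell sT _ nT; first by move=> b.
have [k' [kk' k'T]] := step_extend cT new att_T (null s) kT.
exists (T `|` range (Cell a c h)), k'; split=> //.
- by split; [apply: step_closed | apply: step_saturated].
by exists (Cell a c h j0); split=> //; right; exists j0.
Qed.

(** ** Attaching acyclic modules does not change the cohomology *)

Local Notation base := (range Base).

Let base_inj : injective Base. Proof. by move=> b b' []. Qed.

Let base_closed : closed_gens cD base.
Proof.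
move=> _ [b _ <-]; rewrite cD_base.
apply: (@within_lin _ _ _ _ _ _ setT) => [b' nb|b' _]; first by case: nb.
by apply: within_mono; exists b'.
Qed.

(** Here Zorn's lemma gives a maximal set of cells from which chains can be pushed to
    the base; one more copy of [E s], being acyclic, does not destroy this property. *)
Lemma cells_push_to_base : (forall s, acyclic (freeDg (@DDE s))) ->
  forall i (x : F i), within base (free_d cD (erefl (i + gg1)) x) ->
  exists j (e : j + gg1 = i) (y : F j), within base (x - free_d cD e y).
Proof.
move=> aE.
pose pushes (T : set cell) := forall i (x : F i), within T x ->
  within base (free_d cD (erefl (i + gg1)) x) ->
  exists j (e : j + gg1 = i) (y : F j), within T y /\ within base (x - free_d cD e y).
pose P T := [/\ closed_gens cD (base `|` T), saturated (base `|` T) & pushes (base `|` T)].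
have [C CP Ctot|T [[cT sT pT] maxT]] := @Zorn_bigcup cell P.
  split.
  - move=> t [bt|[T CT Tt]].
      by apply: within_sub (base_closed bt) => u; left.
    have [cT _ _] := CP _ CT.
    by apply: within_sub (cT t (or_intror Tt)) => u [bu|Tu]; [left | right; exists T].
  - move=> s n a c h j j' [[]//|[T CT Tj]]; have [_ sT _] := CP _ CT.
    by have [[]//|Tj'] := sT _ _ _ _ _ _ j' (or_intror Tj); right; exists T.
  move=> i x xC dx; have [xb|[T CT xT]] := within_chain Ctot xC.
    exists (i - gg1), (subrK _ _), 0; split; first exact: within0.
    by rewrite (morphD0 (free_dD _ _)) subr0.
  have [_ _ pT] := CP _ CT; have [j [e [y [yT xy]]]] := pT i x xT dx.
  exists j, e, y; split=> //.
  by apply: within_sub yT => u [bu|Tu]; [left | right; exists T].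
have full : forall t, (base `|` T) t.
  apply: contrapT => /existsNP nT.
  have [|s [n [a [c [h [j0 [new att_T]]]]]]] := next_cell sT _ nT.
    by move=> b; left; exists b.
  apply: (maxT (T `|` range (Cell a c h))).
    split; first exact: subsetUl.
    by move=> /(_ (Cell a c h j0)) H; apply: (new j0); right; apply: H; right; exists j0.
  rewrite /P setUA; split; first exact: step_closed.
    exact: step_saturated.
  move=> i x xT' dx.
  have [|j [e [y [yT' xy]]]] := step_push cT new att_T (aE s) xT'.
    by apply: within_sub dx; apply: subsetUl.
  have [|j' [e' [y' [y'T xy']]]] := pT _ _ xy.
    rewrite free_dD (morphDN (free_dD _ _)) (free_dd cDD) subr0.
    exact: dx.
  have jj : j' = j by apply: (addIr gg1); rewrite e e'.
  subst j'; rewrite (eq_irrelevance e' e) {e'} in xy'.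
  exists j, e, (y + y'); split.
    by apply: withinD => //; apply: within_sub y'T; apply: subsetUl.
  by rewrite free_dD opprD addrA.
move=> i x dx; have [|j [e [y [_ xy]]]] := pT i x _ dx; last by exists j, e, y.
by move=> t nt; case: (nt (full t)).
Qed.

Lemma cellMod_quasi_iso (f : dgHom (freeDg DD0) cellMod) :
  (forall i v, f i v = lin (fun b => gen A cdeg (Base b)) i v) ->
  (forall s, acyclic (freeDg (@DDE s))) -> quasi_iso f.
Proof.
move=> fE aE.
have q_f i v : quo A cdeg base_inj i (f i v) = v by rewrite fE; apply: (quo_lift base_inj v).
have f_within i v : within base (f i v).
  rewrite fE; apply: (@within_lin _ _ _ _ _ _ setT) => [b nb|b _]; first by case: nb.
  by apply: within_mono; exists b.
have f_q i (y : F i) : within base y -> f i (quo A cdeg base_inj i y) = y.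
  move=> yb; apply/eqP; rewrite -subr_eq0; apply/eqP; apply: free_eq => t.
  have [[b _ <-]|nt] := pselect (base t).
    by rewrite -(coef_quo base_inj) ghD ghN q_f subrr.
  by rewrite coefD coefN f_within // yb // subrr.
have q_d i j (e : i + gg1 = j) (v : freeDg DD0 i) :
    dgm_d e v = quo A cdeg base_inj j (free_d cD e (f i v)).
  by rewrite -[free_d _ _ _]/(dgm_d e (f i v : cellMod i)) -dgh_d q_f.
move=> i; split=> [x cx [j [e [y dy]]]|y cy].
  subst i; have [|j' [e' [w yw]]] := cells_push_to_base aE (x := y).
    by rewrite [X in within _ X]dy; apply: f_within.
  exists j, erefl, (quo A cdeg base_inj j (y - free_d cD e' w)).
  by rewrite q_d f_q // free_dD (morphDN (free_dD _ _)) (free_dd cDD) subr0 [free_d _ _ _]dy q_f.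
have [|j [e [w yw]]] := cells_push_to_base aE (x := y).
  by rewrite [X in within _ X]cy //; apply: within0.
exists (quo A cdeg base_inj i (y - free_d cD e w)); split.
  move=> j' e'; rewrite q_d f_q // free_dD (morphDN (free_dD _ _)) (free_dd cDD) subr0.
  by rewrite [free_d _ _ _]cy // gh0.
by exists j, e, w; rewrite f_q // opprB addrCA subrr addr0.
Qed.
End Cells.

(** * Resolutions by semi-free dg modules *)

Lemma boundary0 (G : gradingGroup) (A : dgRing G) (M : dgMod A) i : boundary (0 : M i).
Proof. by exists (i - gg1), (subrK _ _), 0; rewrite dgm_d0. Qed.

Lemma acyclic_preimage (G : gradingGroup) (A : dgRing G) (M : dgMod A) i
    (x : M (i + gg1)) : acyclic M -> dgm_d (erefl (i + gg1 + gg1)) x = 0 ->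
  exists y : M i, dgm_d (erefl (i + gg1)) y = x.
Proof.
move=> aM dx; have [|j [e [y yE]]] := aM _ x; first exact: cycleI.
have ji : j = i by apply: addIr e.
by subst j; exists y; rewrite (eq_irrelevance (erefl _) e).
Qed.

(** Every dg module is a shift. *)
Lemma null_shift_target (G : gradingGroup) (A : dgRing G) (X : dgMod A) :
  (forall N, acyclic N -> forall f : dgHom X (dgShift N),
     homotopic f (dgHom_zero X (dgShift N))) ->
  forall N, acyclic N -> forall f : dgHom X N, homotopic f (dgHom_zero X N).
Proof.
move=> H N aN f.
have aN' : acyclic (dgUnshift N).
  apply: acyclic_unshift; apply: acyclic_iso aN.
  have [u [v [vu uv]]] := unshift_isomorphic N; by exists v, u.
have fE : homotopic f (dgHom_comp (dgUnshift_counit N) (dgHom_comp (dgUnshift_unit N) f)).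
  by apply: homotopic_ext => i x /=; rewrite ecast_id2.
apply: homotopic_trans fE _.
apply: homotopic_trans (homotopic_comp (homotopic_ext (fun i x => erefl)) (H _ aN' _)) _.
by apply: homotopic_ext => i x; apply: (gh0 (dgUnshift_counit N)).
Qed.

Section SemiFree.
Variables (G : gradingGroup) (A : dgRing G) (M : dgMod A).

(* The free dg modules on one closed generator, of degree [n].  Attaching such a
   cell kills a cycle of degree [n + gg1], or, along the attaching map zero, creates
   a class of degree [n]. *)
Let J (n : G) : Type := unit.
Let degE (n : G) (_ : J n) : G := n.
Let DE (n : G) (j : J n) : freeMod A (@degE n) (degE j + gg1) := 0.
Let DDE (n : G) (j : J n) : free_d (@DE n) (erefl (degE j + gg1 + gg1)) (DE j) = 0.
Proof. exact: morphD0 (free_dD _ _). Qed.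
Let lin_DE (N : grMod A) n (y : forall j : J n, N (degE j)) (j : J n) :
  lin y (degE j + gg1) (DE j) = 0.
Proof. exact: gh0. Qed.
Let deg0 (b : Empty_set) : G := match b with end.
Let D0 (b : Empty_set) : freeMod A deg0 (deg0 b + gg1) := match b with end.
Let DD0 (b : Empty_set) : free_d D0 (erefl (deg0 b + gg1 + gg1)) (D0 b) = 0.
Proof. by case: b. Qed.
Let phi0 (b : Empty_set) : M (deg0 b) := match b with end.
Let phi0_d (b : Empty_set) :
  dgm_d (erefl (deg0 b + gg1)) (phi0 b) = lin phi0 (deg0 b + gg1) (D0 b).
Proof. by case: b. Qed.
Local Notation S := (cellMod DDE DD0 phi0).

(** Injectivity on cohomology: a cycle of [S] whose image is the boundary of [w] is the
    differential of the cell attached along it with [h = w].  Surjectivity: a cycle [y]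
    of [M] is the image of the cell attached along zero with [h = y]. *)
Lemma semifree_resolution : exists (S : dgMod A) (p : dgHom S M),
  [/\ gr_projective S,
     forall N, acyclic N -> forall f : dgHom S N, homotopic f (dgHom_zero S N)
     & quasi_iso p].
Proof.
have [p pE] := cellMod_to DDE DD0 phi0_d.
exists S, p; split; first exact: free_gr_projective.
  apply: null_shift_target => N aN f; apply: cellMod_null => [[]|n z dz].
  have [y yE] : exists y : N n, dgm_d (erefl (n + gg1)) y = z tt.
    apply: acyclic_preimage => //; have := dz tt.
    by rewrite (@lin_DE (grShift gg1 N) n z tt) addr0.
  by exists (fun _ => y) => -[]; rewrite lin_DE subr0 yE.
move=> i; split=> [x cx [j [e [w dw]]]|y cy].
  subst i.
  have [j'|j'|n [a [c /(_ tt) [cE _]]]] :=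
      @cell_attach G A G J degE DE Empty_set deg0 D0 M phi0 j (fun=> x) (fun=> w).
  - by rewrite (@lin_DE (grShift gg1 (freeMod A _)) j (fun=> x) j') addr0; apply: cx.
  - by rewrite lin_DE subr0 -[LHS]pE dw.
  move: cE; rewrite /new_cells lin_DE addr0 => cE.
  exists j, erefl, (gen A _ (Cell a c (fun=> w) tt)).
  apply: eq_trans cE.
  exact: (free_d_gen (cD DE D0 phi0) (Cell a c (fun=> w) tt)).
have [j'|j'|n [a [c /(_ tt) [cE phiE]]]] :=
    @cell_attach G A G J degE DE Empty_set deg0 D0 M phi0 i (fun=> 0) (fun=> y).
- rewrite (@lin_DE (grShift gg1 (freeMod A _)) i (fun=> 0) j') addr0.
  exact: morphD0 (free_dD _ _).
- by rewrite lin_DE subr0 gh0 cy.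
move: cE; rewrite /new_cells lin_DE addr0 => cE.
exists (gen A _ (Cell a c (fun=> y) tt)); split.
  apply: cycleI; apply: eq_trans cE.
  exact: (free_d_gen (cD DE D0 phi0) (Cell a c (fun=> y) tt)).
rewrite pE.
have -> : lin (cphi DE D0 phi0) i (gen A _ (Cell a c (fun=> y) tt)) = y.
  by rewrite (lin_gen (cphi DE D0 phi0) (Cell a c (fun=> y) tt)).
by rewrite subrr; apply: boundary0.
Qed.
End SemiFree.

(** * Closing a set of generators under acyclicity *)

(** Names for the generators reached by the closure process below.  Unlike the
    generators of an arbitrary free dg module they form a fixed type, which depends
    on [A] only; this bounds the size of the test objects.  [TDiff t n] names the
    [n]-th generator in the differential of the one named [t], and [TFill] names the
    generators of a chain chosen to bound, modulo the part already treated, a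
    relative cycle given by an expression in named generators. *)
Inductive tree (G : gradingGroup) (A : grRing G) : Type :=
| TRoot
| TDiff of tree A & nat
| TFill (k : G) (n : nat) (a : 'I_n -> forall i, A i) (c : 'I_n -> tree A) of nat.

Section Closure.
Variables (G : gradingGroup) (A : dgRing G) (B : Type) (deg : B -> G).
Local Notation F := (freeMod A deg).
Variable D : forall b, F (deg b + gg1).
Hypothesis DD : forall b, free_d D (erefl (deg b + gg1 + gg1)) (D b) = 0.
Hypothesis acyclicX : acyclic (freeDg DD).

Definition acyclic_gens (T : set B) : Prop := forall i (x : F i),
  within T x -> free_d D (erefl (i + gg1)) x = 0 ->
  exists j (e : j + gg1 = i) (y : F j), within T y /\ free_d D e y = x.

Lemma acyclic_gensP T i (x : F (i + gg1)) : acyclic_gens T -> within T x ->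
  free_d D (erefl (i + gg1 + gg1)) x = 0 ->
  exists2 y : F i, within T y & free_d D (erefl (i + gg1)) y = x.
Proof.
move=> aT xT dx; have [j [e [y [yT yE]]]] := aT _ x xT dx.
have ji : j = i by apply: addIr e.
by subst j; exists y => //; rewrite (eq_irrelevance (erefl _) e).
Qed.

(** The quotient by an acyclic dg submodule is acyclic. *)
Lemma fill_exists T i (x : F (i + gg1)) : acyclic_gens T -> closed_gens D T ->
  within T (free_d D (erefl (i + gg1 + gg1)) x) ->
  exists y : F i, within T (x - free_d D (erefl (i + gg1)) y).
Proof.
move=> aT cT dx.
have [|y1 y1T y1E] := acyclic_gensP aT dx; first exact: (free_dd DD).
have [|y yE] := @acyclic_preimage _ _ (freeDg DD) i (x - y1) acyclicX.
  by rewrite /= free_dD (morphDN (free_dD _ _)) y1E subrr.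
by exists y; rewrite [free_d _ _ _]yE opprB addrCA subrr addr0.
Qed.

Variables (T : set B) (b0 : B).
Hypothesis T_closed : closed_gens D T.
Hypothesis T_acyclic : acyclic_gens T.

(* A fixed choice, so that the generators of [fill x] have names. *)
Let fill i (x : F (i + gg1)) : F i :=
  match pselect (exists y : F i, within T (x - free_d D (erefl (i + gg1)) y)) with
  | left e => sval (cid e)
  | right _ => 0
  end.

Let fillP i (x : F (i + gg1)) : within T (free_d D (erefl (i + gg1 + gg1)) x) ->
  within T (x - free_d D (erefl (i + gg1)) (fill x)).
Proof.
move=> dx; rewrite /fill; case: pselect => [e|[]]; last exact: fill_exists.
exact: (svalP (cid e)).
Qed.

Fixpoint reach (t : tree A) : B :=
  match t with
  | TRoot => b0
  | TDiff t n => nth b0 (supp (D (reach t))) n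
  | TFill k n a c m =>
    nth b0 (supp (fill (\sum_(l < n) mono (a l (k + gg1 - deg (reach (c l))))))) m
  end.

Let T' : set B := T `|` range reach.

Let nth_supp k (v : F k) b : coef v b != 0 -> exists m, nth b0 (supp v) m = b.
Proof.
move=> vb; have bs : (b : {classic B}) \in supp v.
  by apply: contraT => nb; rewrite (coef_supp nb) eqxx in vb.
by exists (index (b : {classic B}) (supp v)); exact: (nth_index (b0 : {classic B}) bs).
Qed.

Lemma reach_closed : closed_gens D T'.
Proof.
move=> b [Tb|[t _ <-]]; first by apply: within_sub (T_closed Tb); apply: subsetUl.
move=> b' nb'; apply/eqP; apply: contraT => /nth_supp[m mE]; case: nb'.
by right; exists (TDiff t m).
Qed.

Let fill_within k (x : F (k + gg1)) : within (range reach) x -> within (range reach) (fill x).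
Proof.
move=> xT; have [n [a [c' [c'T xE]]]] := free_expression xT.
have [c cE] : exists c, forall l, reach (c l) = c' l.
  by exists (fun l => s2val (cid2 (c'T l))) => l; apply: (s2valP' (cid2 (c'T l))).
have c'E : c' = reach \o c by apply: funext => l; rewrite /= cE.
subst c'; move=> b nb; apply/eqP; apply: contraT => /nth_supp[m mE]; case: nb.
by exists (TFill k a c m) => //=; rewrite -mE xE.
Qed.

(** Modulo [T], a cycle within [T'] is an expression in reached generators, and its
    filling is again within [T'] by the constructor [TFill]; the remaining cycle is
    within [T], which is acyclic. *)
Lemma reach_acyclic : acyclic_gens T'.
Proof.
move=> i; move: i; apply: grading_shift => k x xT' dx.
pose x1 := x - restr T x.
have x1T : within (range reach) x1.
  by apply: within_sub (within_restr (T := T) xT') => b [[]].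
have dx1 : within T (free_d D (erefl (k + gg1 + gg1)) x1).
  rewrite free_dD dx add0r (morphDN (free_dD _ _)); apply: withinN.
  by apply: within_d => //; apply: restr_within.
have [||z zT zE] := @acyclic_gensP T k (x - free_d D (erefl (k + gg1)) (fill x1)) T_acyclic.
- rewrite -(subrK (restr T x) x) -/x1 addrAC; apply: withinD; first exact: fillP.
  exact: restr_within.
- by rewrite free_dD (morphDN (free_dD _ _)) dx (free_dd DD) subr0.
exists k, erefl, (fill x1 + z); split.
  apply: withinD; last by apply: within_sub zT; apply: subsetUl.
  by apply: within_sub (fill_within x1T); apply: subsetUr.
by rewrite free_dD zE; apply: subrKC.
Qed.

(* One name for each new generator, so that these are indexed injectively by a
   part of [tree A]. *)
Let rep (b : B) : tree A :=
  match pselect (exists t, reach t = b) with left e => sval (cid e) | right _ => TRoot A end.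

Definition fresh (t : tree A) : Prop := ~ T (reach t) /\ rep (reach t) = t.
Definition fresh_reach (t : {t | fresh t}) : B := reach (sval t).

Lemma fresh_reach_inj : injective fresh_reach.
Proof.
move=> [t [nT tE]] [t' [nT' tE']]; rewrite /fresh_reach /= => e.
by apply: eq_exist; rewrite -tE -tE' e.
Qed.

Lemma fresh_reach_new t : ~ T (fresh_reach t).
Proof. by case: t => t []. Qed.

Lemma fresh_reachE : T `|` range fresh_reach = T'.
Proof.
apply/seteqP; split=> b [Tb|]; [by left | | by left |].
  by move=> [t _ <-]; right; exists (sval t).
move=> [t _ <-]; have [Tb|nT] := pselect (T (reach t)); first by left.
have rE : reach (rep (reach t)) = reach t.
  by rewrite /rep; case: pselect => [e|[]]; [apply: (svalP (cid e)) | exists t].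
have fr : fresh (rep (reach t)) by rewrite /fresh rE.
by right; exists (exist _ _ fr).
Qed.
End Closure.

(** * Objects orthogonal to the acyclic graded-free dg modules *)

(** These test objects range over a type that does not depend on the dg modules to
    be tested, so that all of them can be attached at once. *)
Record small (G : gradingGroup) (A : dgRing G) := Small {
  sm_mask : tree A -> Prop;
  sm_deg : {t | sm_mask t} -> G;
  sm_D : forall t, freeMod A sm_deg (sm_deg t + gg1);
  sm_DD : forall t, free_d sm_D (erefl (sm_deg t + gg1 + gg1)) (sm_D t) = 0;
  sm_acyclic : acyclic (freeDg sm_DD)
}.

Section Orthogonal.
Variables (G : gradingGroup) (A : dgRing G).

(** A family [z] subject to the first equation is a morphism from the small dg module to
    [N[1] ], and [K] is a null homotopy of it.  It is stated on generators, the form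
    in which the attaching maps of cells and [extend_homotopy] use it. *)
Definition small_orthogonal (N : dgMod A) : Prop :=
  forall (s : small A) (z : forall t, N (sm_deg (s := s) t + gg1)),
    (forall t, dgm_d (erefl (sm_deg t + gg1 + gg1)) (z t) +
       @lin _ _ _ (@sm_deg _ _ s) (grShift gg1 N) z (sm_deg t + gg1) (sm_D t) = 0) ->
    exists K : forall t, N (sm_deg (s := s) t), forall t,
      z t = dgm_d (erefl (sm_deg t + gg1)) (K t) - lin K (sm_deg t + gg1) (sm_D t).

(** A morphism from a small dg module to [R[1] ] is an attaching map, and the
    cell attached along it is its null homotopy.  The target of the cells is zero, so that
    the data in it are void. *)
Lemma orthogonal_extension (B : Type) (deg : B -> G)
    (D : forall b, freeMod A deg (deg b + gg1))
    (DD : forall b, free_d D (erefl (deg b + gg1 + gg1)) (D b) = 0) :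
  exists (R : dgMod A) (r : dgHom (freeDg DD) R),
    [/\ gr_projective R, small_orthogonal R & quasi_iso r].
Proof.
pose phi0 (b : B) : dgZero A (deg b) := 0.
have z0 i (x : dgZero A i) : x = 0 by rewrite [x]thinmx0.
have DDE (s : small A) t : free_d (@sm_D _ _ s) (erefl (sm_deg t + gg1 + gg1)) (sm_D t) = 0.
  exact: sm_DD.
have [r rE] := cellMod_from DDE DD phi0.
exists (cellMod DDE DD phi0), r; split; first exact: free_gr_projective.
  move=> s z dz.
  have [t|n [a [c cE]]] := @cell_attach G A (small A) (fun s => {t | sm_mask s t})
    (@sm_deg _ _) (@sm_D _ _) B deg D (dgZero A) phi0 s z (fun t => 0) dz.
    by rewrite [LHS]z0 [RHS]z0.
  exists (fun t => gen A _ (Cell a c (fun t => 0 : dgZero A (sm_deg t)) t)) => t.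
  have [E _] := cE t; apply: (canRL (addrK _)); rewrite -[LHS]E; symmetry.
  exact: (free_d_gen (cD (@sm_D _ _) D phi0) (Cell a c (fun t => 0 : dgZero A (sm_deg t)) t)).
apply: cellMod_quasi_iso rE _ => s; have -> : DDE s = @sm_DD _ _ s by apply: Prop_irrelevance.
exact: sm_acyclic.
Qed.

Section Null.
Variables (B : Type) (deg : B -> G) (D : forall b, freeMod A deg (deg b + gg1)).
Hypothesis DD : forall b, free_d D (erefl (deg b + gg1 + gg1)) (D b) = 0.
Hypothesis acyclicX : acyclic (freeDg DD).
Variables (N : dgMod A) (f : dgHom (freeDg DD) (dgShift N)).

(** A homotopy on a closed acyclic set of generators extends to a bigger one
    obtained by closing up one further generator, because the quotient is small. *)
Lemma free_acyclic_null : small_orthogonal N -> homotopic f (dgHom_zero _ (dgShift N)).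
Proof.
move=> orthN.
apply: (null_by_extension (Pc := fun T => closed_gens D T /\ acyclic_gens D T)).
- by move=> T [].
- move=> C CP Ctot; split.
    move=> b [T CT Tb]; have [cT _] := CP _ CT.
    by apply: within_sub (cT _ Tb) => u Tu; exists T.
  move=> i x xC dx.
  rewrite -[\bigcup_(_ in _) _]set0U in xC.
  have [x0|[T CT xT]] := within_chain Ctot xC.
    have -> : x = 0 by apply: free_eq => b; rewrite coef0; apply: x0.
    exists (i - gg1), (subrK _ _), 0; split; first exact: within0.
    exact: morphD0 (free_dD _ _).
  have [_ aT] := CP _ CT; rewrite set0U in xT.
  have [j [e [y [yT yE]]]] := aT i x xT dx; exists j, e, y; split=> //.
  by apply: within_sub yT => u Tu; exists T.
move=> T k [cT aT] kT [b0 nb0].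
pose beta := @fresh_reach _ _ _ _ D T b0.
have binj : injective beta := @fresh_reach_inj _ _ _ _ D T b0.
have bnew : forall t, ~ T (beta t) := @fresh_reach_new _ _ _ _ D T b0.
have cT' : closed_gens D (T `|` range beta).
  by rewrite /beta fresh_reachE; apply: reach_closed.
have aT' : acyclic_gens D (T `|` range beta).
  by rewrite /beta fresh_reachE; apply: reach_acyclic.
have aE : acyclic (freeDg (quoDD DD binj bnew cT cT')).
  apply: quo_acyclic => i x xT' dx.
  have [y1 y1T y1E] := acyclic_gensP aT dx (free_dd DD _ _ _).
  have [||j [e [y [yT' yE]]]] := aT' _ (x - y1).
  - by apply: withinB => //; apply: within_sub y1T; apply: subsetUl.
  - by rewrite free_dD (morphDN (free_dD _ _)) y1E subrr.
  by exists j, e, y; split=> //; rewrite yE opprB addrCA subrr addr0.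
pose s := Small aE.
have [k' [kk' k'T]] := @extend_homotopy _ _ _ _ D DD T _ beta binj bnew cT cT' N f k
  (orthN s) kT.
exists (T `|` range beta), k'; split=> //.
exists b0; split=> //.
by rewrite /beta fresh_reachE; right; exists (TRoot A).
Qed.
End Null.
End Orthogonal.

(** * Graded projective dg modules are retracts of graded free ones *)

(** A disc is a free dg module on a generator and its differential.  A sum of discs is
    contractible, and graded free on arbitrarily many generators. *)
Section Discs.
Variables (G : gradingGroup) (A : dgRing G) (I : Type) (degI : I -> G).

Definition disc_deg (q : I + I) : G :=
  match q with inl q => degI q | inr q => degI q + gg1 end.

Definition disc_D (q : I + I) : freeMod A disc_deg (disc_deg q + gg1) :=
  match q with inl q => gen A disc_deg (inr q) | inr q => 0 end.

Lemma disc_DD q : free_d disc_D (erefl (disc_deg q + gg1 + gg1)) (disc_D q) = 0.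
Proof.
case: q => q; first exact: (free_d_gen disc_D (inr q)).
exact: morphD0 (free_dD _ _).
Qed.

Lemma disc_null (N : dgMod A) (f : dgHom (freeDg disc_DD) (dgShift N)) :
  homotopic f (dgHom_zero _ (dgShift N)).
Proof.
pose h (q : I + I) : N (disc_deg q) :=
  match q with
  | inl q => 0
  | inr q => - f (degI q) (gen A disc_deg (inl q))
  end.
apply: (@null_of_gens _ _ _ _ _ disc_DD N f h) => -[q|q]; rewrite /null_at.
  rewrite [dgm_d _ _]dgm_d0 sub0r (lin_gen h (inr q)) /=.
  by rewrite opprK.
have E : dgm_d (erefl (degI q + gg1)) (gen A disc_deg (inl q) : freeDg disc_DD (degI q)) =
    gen A disc_deg (inr q) := free_d_gen disc_D (inl q).
have := @dgh_d _ _ _ _ f _ _ (erefl (degI q + gg1)) (gen A disc_deg (inl q)).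
rewrite E => -> /=.
rewrite (gh0 (lin h)) subr0 dgm_dN.
by rewrite (eq_irrelevance (shift_degree_d _ _) erefl).
Qed.

(** The identity is null-homotopic: up to an isomorphism it is a morphism to a shift. *)
Lemma disc_acyclic : acyclic (freeDg disc_DD).
Proof.
move=> i x cx.
have [h [hD _ hd]] : homotopic (dgHom_id (freeDg disc_DD)) (dgHom_zero _ _).
  apply: homotopic_trans (homotopic_trans _ (homotopic_comp
    (homotopic_ext (f := dgUnshift_counit (freeDg disc_DD)) (fun i x => erefl))
    (disc_null (dgUnshift_unit (freeDg disc_DD))))) _.
    by apply: homotopic_ext => j y /=; rewrite ecast_id2.
  by apply: homotopic_ext => j y; apply: (gh0 (dgUnshift_counit _)).
exists (i - gg1), (subrK _ _), (h i _ (subrK gg1 i) x).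
have := hd i _ _ (subrK gg1 i) erefl x.
by rewrite (cycle_d _ cx) (morphD0 (hD _ _ _)) addr0 /= subr0.
Qed.
End Discs.

(** [X] is the image of an idempotent [e] of the free module [F] on all its elements.
    The free module [FZ] under infinitely many discs contains a sum of copies of [F],
    embedded by [emb n] for each [n]. *)
Section Retract.
Variables (G : gradingGroup) (A : dgRing G) (X : dgMod A).
Hypothesis projX : gr_projective X.

Let I0 : Type := {i : G & X i}.
Let deg0 (b : I0) : G := projT1 b.
Let I : Type := (nat * I0)%type.
Let degI (q : I) : G := deg0 q.2.
Local Notation F := (freeMod A deg0).
Local Notation dg := (disc_deg degI).
Local Notation FZ := (freeMod A dg).
Local Notation Z := (freeDg (@disc_DD G A I degI)).

Let pi : grHom F X := lin (fun b : I0 => projT2 b).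

Let iota_ex : exists iota : grHom X F, forall i x, pi i (iota i x) = x.
Proof.
have [|g gE] := @projX _ _ pi (grHom_id X); last by exists g.
move=> i y; exists (gen A deg0 (existT _ i y)).
exact: (lin_gen (fun b : I0 => projT2 b) (existT _ i y)).
Qed.
Let iota : grHom X F := sval (cid iota_ex).
Let piK i (x : X i) : pi i (iota i x) = x. Proof. exact: (svalP (cid iota_ex)). Qed.

(* The idempotent of [F] with image [X]. *)
Let e : grHom F F := grHom_comp iota pi.
Let ee i (v : F i) : e i (e i v) = e i v. Proof. by rewrite /= piK. Qed.
Let ei i (x : X i) : e i (iota i x) = iota i x. Proof. by rewrite /= piK. Qed.
Let pe i (v : F i) : pi i (e i v) = pi i v. Proof. by rewrite /= piK. Qed.
Let ce : grHom F F := grHom_add (grHom_id F) (grHom_opp e).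
Let ceE i (v : F i) : ce i v = v - e i v. Proof. by []. Qed.
Let p_ce i (v : F i) : pi i (ce i v) = 0.
Proof. by rewrite ceE ghD ghN pe subrr. Qed.
Let e_ce i (v : F i) : e i (ce i v) = 0.
Proof. by rewrite /e /= -/(ce i v) p_ce gh0. Qed.
Let ce_ce i (v : F i) : ce i (ce i v) = ce i v.
Proof. by rewrite ceE e_ce subr0. Qed.
Let ce_e i (v : F i) : ce i (e i v) = 0.
Proof. by rewrite ceE ee subrr. Qed.
Let ce_i i (x : X i) : ce i (iota i x) = 0.
Proof. by rewrite ceE ei subrr. Qed.
Let ceD i (v : F i) : ce i v + e i v = v.
Proof. by rewrite ceE subrK. Qed.

Let emb (n : nat) : grHom F FZ := @lin _ _ _ deg0 FZ (fun b => gen A dg (inl (n, b))).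

Let emb_gen n b : emb n (deg0 b) (gen A deg0 b) = gen A dg (inl (n, b)).
Proof. exact: (@lin_gen _ _ _ deg0 FZ (fun b => gen A dg (inl (n, b)))). Qed.

(* The swindle: the summand [(1 - e) F] of each copy of [F] stays in place and
   the summand [e F] moves to the next copy, which makes room for [X] in the first
   one.  The maps [PsiX] and [PsiZ] are the components of the inverse. *)
Let Lam : grHom FZ FZ := lin (fun q : I + I =>
  match q return FZ (dg q) with
  | inl (n, b) => emb n _ (ce _ (gen A deg0 b)) + emb n.+1 _ (e _ (gen A deg0 b))
  | inr q => gen A dg (inr q)
  end).
Let PsiX : grHom FZ X := lin (fun q : I + I =>
  match q return X (dg q) with
  | inl (0%N, b) => pi _ (gen A deg0 b) | inl (_, b) => 0 | inr q => 0
  end).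
Let PsiZ : grHom FZ FZ := lin (fun q : I + I =>
  match q return FZ (dg q) with
  | inl (0%N, b) => emb 0 _ (ce _ (gen A deg0 b))
  | inl (m.+1, b) => emb m.+1 _ (ce _ (gen A deg0 b)) + emb m _ (e _ (gen A deg0 b))
  | inr q => gen A dg (inr q)
  end).

Let Lam_emb n i (v : F i) : Lam i (emb n i v) = emb n i (ce i v) + emb n.+1 i (e i v).
Proof.
apply: (@lin_ext _ _ _ _ FZ (grHom_comp Lam (emb n))
  (grHom_add (grHom_comp (emb n) ce) (grHom_comp (emb n.+1) e))) => b.
rewrite -[LHS]/(Lam _ (emb n _ _)) emb_gen.
exact: (lin_gen _ (inl (n, b) : I + I)).
Qed.

Let PsiX_emb0 i (v : F i) : PsiX i (emb 0 i v) = pi i v.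
Proof.
apply: (@lin_ext _ _ _ _ X (grHom_comp PsiX (emb 0)) pi) => b.
rewrite -[LHS]/(PsiX _ (emb 0 _ _)) emb_gen.
exact: (lin_gen _ (inl (0%N, b) : I + I)).
Qed.

Let PsiX_embS n i (v : F i) : PsiX i (emb n.+1 i v) = 0.
Proof.
apply: (@lin_ext _ _ _ _ X (grHom_comp PsiX (emb n.+1)) (grHom_zero F X)) => b.
rewrite -[LHS]/(PsiX _ (emb n.+1 _ _)) emb_gen.
exact: (lin_gen _ (inl (n.+1, b) : I + I)).
Qed.

Let PsiZ_emb0 i (v : F i) : PsiZ i (emb 0 i v) = emb 0 i (ce i v).
Proof.
apply: (@lin_ext _ _ _ _ FZ (grHom_comp PsiZ (emb 0)) (grHom_comp (emb 0) ce)) => b.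
rewrite -[LHS]/(PsiZ _ (emb 0 _ _)) emb_gen.
exact: (lin_gen _ (inl (0%N, b) : I + I)).
Qed.

Let PsiZ_embS n i (v : F i) : PsiZ i (emb n.+1 i v) = emb n.+1 i (ce i v) + emb n i (e i v).
Proof.
apply: (@lin_ext _ _ _ _ FZ (grHom_comp PsiZ (emb n.+1))
  (grHom_add (grHom_comp (emb n.+1) ce) (grHom_comp (emb n) e))) => b.
rewrite -[LHS]/(PsiZ _ (emb n.+1 _ _)) emb_gen.
exact: (lin_gen _ (inl (n.+1, b) : I + I)).
Qed.

Let LamE_r q : Lam _ (gen A dg (inr q)) = gen A dg (inr q).
Proof. exact: (lin_gen _ (inr q : I + I)). Qed.
Let PsiXE_r q : PsiX _ (gen A dg (inr q)) = 0.
Proof. exact: (lin_gen _ (inr q : I + I)). Qed.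
Let PsiZE_r q : PsiZ _ (gen A dg (inr q)) = gen A dg (inr q).
Proof. exact: (lin_gen _ (inr q : I + I)). Qed.

Let PsiX_Lam i (w : FZ i) : PsiX i (Lam i w) = 0.
Proof.
apply: (@lin_ext _ _ _ _ X (grHom_comp PsiX Lam) (grHom_zero FZ X)) => -[[n b]|q].
  rewrite -[LHS]/(PsiX _ (Lam _ _)) -emb_gen Lam_emb ghD PsiX_embS addr0.
  by case: n => [|n]; rewrite ?PsiX_emb0 ?p_ce ?PsiX_embS.
by rewrite -[LHS]/(PsiX _ (Lam _ _)) LamE_r PsiXE_r.
Qed.

Let PsiZ_Lam i (w : FZ i) : PsiZ i (Lam i w) = w.
Proof.
apply: (@lin_ext _ _ _ _ FZ (grHom_comp PsiZ Lam) (grHom_id FZ)) => -[[n b]|q].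
  rewrite -[LHS]/(PsiZ _ (Lam _ _)) -emb_gen Lam_emb ghD PsiZ_embS ce_e ee gh0 add0r.
  have -> : PsiZ (deg0 b) (emb n _ (ce _ (gen A deg0 b))) = emb n _ (ce _ (gen A deg0 b)).
    by case: n => [|n]; rewrite ?PsiZ_emb0 ?ce_ce // PsiZ_embS ce_ce e_ce gh0 addr0.
  by rewrite -ghD ceD emb_gen.
by rewrite -[LHS]/(PsiZ _ (Lam _ _)) LamE_r PsiZE_r.
Qed.

Lemma swindle : exists (Phi : grHom (grSum X FZ) FZ) (Psi : grHom FZ (grSum X FZ)),
  (forall i, cancel (Phi i) (Psi i)) /\ (forall i, cancel (Psi i) (Phi i)).
Proof.
have PhiD i : {morph (fun x : grSum X FZ i => emb 0 i (iota i x.1) + Lam i x.2) : x y / x + y}.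
  by move=> [x w] [x' w'] /=; rewrite !ghD; abel.
have PhiA i j k (eq : i + j = k) (a : A i) (x : grSum X FZ j) :
    emb 0 k (iota k (gact eq a x).1) + Lam k (gact eq a x).2 =
    gact eq a (emb 0 j (iota j x.1) + Lam j x.2).
  by rewrite gactDr -!gh_act.
have PsiD i : {morph (fun w : FZ i => (PsiX i w, PsiZ i w) : grSum X FZ i) : w w' / w + w'}.
  by move=> w w'; rewrite !ghD.
have PsiA i j k (eq : i + j = k) (a : A i) (w : FZ j) :
    (PsiX k (gact eq a w), PsiZ k (gact eq a w)) = gact eq a ((PsiX j w, PsiZ j w) : grSum X FZ j).
  by rewrite /= !gh_act.
pose Phi := @GrHom G A (grSum X FZ) FZ _ PhiD PhiA.
pose Psi := @GrHom G A FZ (grSum X FZ) _ PsiD PsiA.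
exists Phi, Psi; split=> i.
  move=> [x w]; congr (_, _).
    by rewrite -[LHS]/(PsiX i (emb 0 i (iota i x) + Lam i w)) ghD PsiX_emb0 piK PsiX_Lam addr0.
  by rewrite -[LHS]/(PsiZ i (emb 0 i (iota i x) + Lam i w)) ghD PsiZ_emb0 ce_i gh0 add0r PsiZ_Lam.
move=> w; apply: (@lin_ext _ _ _ _ FZ (grHom_comp Phi Psi) (grHom_id FZ)) => -[[n b]|q].
  rewrite -[LHS]/(emb 0 _ (iota _ (PsiX _ _)) + Lam _ (PsiZ _ _)) -emb_gen.
  case: n => [|n].
    rewrite PsiX_emb0 PsiZ_emb0 Lam_emb ce_ce e_ce gh0 addr0.
    by rewrite -ghD -[iota _ _]/(e _ _) addrC ceD.
  rewrite PsiX_embS PsiZ_embS !gh0 add0r ghD !Lam_emb ce_ce e_ce ce_e ee !gh0 addr0 add0r.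
  by rewrite -ghD ceD.
by rewrite -[LHS]/(emb 0 _ (iota _ (PsiX _ _)) + Lam _ (PsiZ _ _)) PsiXE_r PsiZE_r LamE_r !gh0 add0r.
Qed.
End Retract.

(** A graded isomorphism of [Y] with a free module carries the differential of [Y] to that of a
    free dg module. *)
Section Transport.
Variables (G : gradingGroup) (A : dgRing G) (Y : dgMod A) (B : Type) (deg : B -> G).
Local Notation F := (freeMod A deg).
Variables (Phi : grHom Y F) (Psi : grHom F Y).
Hypotheses (PhiK : forall i, cancel (Phi i) (Psi i)) (PsiK : forall i, cancel (Psi i) (Phi i)).

Lemma transport_free : exists (D : forall b, F (deg b + gg1))
    (DD : forall b, free_d D (erefl (deg b + gg1 + gg1)) (D b) = 0)
    (phi : dgHom Y (freeDg DD)) (psi : dgHom (freeDg DD) Y),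
  (forall i, cancel (phi i) (psi i)) /\ (forall i, cancel (psi i) (phi i)).
Proof.
pose D b := Phi _ (dgm_d (erefl (deg b + gg1)) (Psi _ (gen A deg b))).
have Psi_d i j (e : i + gg1 = j) (v : F i) : Psi j (free_d D e v) = dgm_d e (Psi i v).
  case: _ / e; symmetry; apply/eqP; rewrite -subr_eq0; apply/eqP.
  apply: (@comm_ext _ _ _ _ D (der_of_dg Y) Psi (grHom_zero F (grShift gg1 Y))) => b.
  by rewrite /D PhiK subrr.
have DD b : free_d D (erefl (deg b + gg1 + gg1)) (D b) = 0.
  by rewrite -[LHS]PsiK Psi_d /D PhiK dgm_dd gh0.
have Phi_d i j (e : i + gg1 = j) (y : Y i) : Phi j (dgm_d e y) = free_d D e (Phi i y).
  by rewrite -[RHS]PsiK Psi_d PhiK.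
by exists D, DD, (@DgHom G A Y (freeDg DD) Phi Phi_d), (@DgHom G A (freeDg DD) Y Psi Psi_d).
Qed.
End Transport.

Section Final.
Variables (G : gradingGroup) (A : dgRing G).
Implicit Types X Y : dgMod A.

Lemma dgSum_inl_quasi_iso X Y : acyclic Y -> quasi_iso (dgSum_inl X Y).
Proof.
move=> aY i; split=> [x cx [j [e [[y z] E]]]|[x y] cxy].
  by exists j, e, y; case: E.
have cx : @cycle _ _ X i x by move=> j e; case: (cxy j e).
have [|j [e [z zE]]] := aY i y; first by move=> j e; case: (cxy j e).
exists x; split => //; exists j, e, (0, z); rewrite -[LHS]/(_, _) /=.
by rewrite dgm_d0 zE; congr (_, _); rewrite ?subrr ?subr0.
Qed.

(** Add to [X] the discs of the swindle, which are acyclic. *)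
Lemma free_retract X : gr_projective X ->
  exists (B : Type) (deg : B -> G) (D : forall b, freeMod A deg (deg b + gg1))
    (DD : forall b, free_d D (erefl (deg b + gg1 + gg1)) (D b) = 0)
    (s : dgHom X (freeDg DD)) (t : dgHom (freeDg DD) X),
    [/\ forall i, cancel (s i) (t i), quasi_iso s & acyclic X -> acyclic (freeDg DD)].
Proof.
move=> projX; have [Phi [Psi [PhiK PsiK]]] := swindle projX.
set Z := freeDg (@disc_DD G A _ (fun q : nat * {i : G & X i} => projT1 q.2)).
have aZ : acyclic Z by apply: disc_acyclic.
have [D [DD [phi [psi [phiK psiK]]]]] := @transport_free _ _ (dgSum X Z) _ _ Phi Psi PhiK PsiK.
exists _, _, D, DD, (dgHom_comp phi (dgSum_inl X Z)), (dgHom_comp (dgSum_fst X Z) psi).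
have qs : quasi_iso (dgHom_comp phi (dgSum_inl X Z)).
  apply: quasi_iso_comp (dgSum_inl_quasi_iso X aZ) => i; split=> [x _ [j [e [y yE]]]|y cy].
    by exists j, e, (psi j y); rewrite -dgh_d yE phiK.
  exists (psi i y); split; first by move=> j e; rewrite -dgh_d cy gh0.
  by rewrite psiK subrr; exists (i - gg1), (subrK _ _), 0; rewrite dgm_d0.
split=> // [i x|aX i y cy]; first by rewrite /= phiK.
have [_ /(_ _ cy)[x [cx [j [e [z zE]]]]]] := qs i.
have [j' [e' [z' zE']]] := aX i x cx.
have jj : j' = j by apply: (addIr gg1); rewrite e e'.
case: _ / jj e z zE => e z zE.
exists j', e, (z + dgHom_comp phi (dgSum_inl X Z) j' z').
by rewrite dgm_dD zE -dgh_d (eq_irrelevance e e') zE' subrK.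
Qed.

(** Replace [X] by the free dg module of which it is a retract, and extend it.  To see that
    the extension is local, replace the acyclic test object in the same way. *)
Lemma acyclic_orthogonal_resolution X : gr_projective X -> exists (R : dgMod A) (r : dgHom X R),
  [/\ gr_projective R,
      forall Y, gr_projective Y -> acyclic Y -> forall f : dgHom Y R, homotopic f (dgHom_zero Y R)
    & quasi_iso r].
Proof.
move=> projX; have [B [deg [D [DD [s [t [_ qs _]]]]]]] := free_retract projX.
have [R [r [projR orthR qr]]] := orthogonal_extension DD.
exists R, (dgHom_comp r s); split=> //; last exact: quasi_iso_comp.
move=> Y projY aY f.
have null_shift Y' (g : dgHom Y' (dgShift R)) : gr_projective Y' -> acyclic Y' ->
    homotopic g (dgHom_zero Y' (dgShift R)).
  move=> projY' aY'; have [B' [deg' [D' [DD' [s' [t' [sK _ aF]]]]]]] := free_retract projY'.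
  have g0 := free_acyclic_null (aF aY') (dgHom_comp g t') orthR.
  apply: homotopic_trans (homotopic_trans _ (homotopic_comp g0 (homotopic_ext (f := s') (fun i x => erefl)))) _.
    by apply: homotopic_ext => i x /=; rewrite sK.
  exact: homotopic_ext.
have [h [hD hA hd]] := null_shift _ (dgHom_shift f) (gr_projective_shift projY) (acyclic_shift aY).
by apply: (homotopic_unshift (h := h)) => // i j j' e e' x; rewrite -hd.
Qed.
End Final.

Theorem corollary2p2p3 (G : gradingGroup) (A : dgRing G) :
  recollement (Kac_incl A) (K_to_D A).
Proof.
exact: recollement_of_dg_resolutions (@semifree_resolution G A)
  (@acyclic_orthogonal_resolution G A).
Qed.
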